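(* Let $\lambda>0$ and let $v_1(\lambda),\dots,v_P(\lambda)$ be complex numbers. The function $$W_+(x;\lambda)=-\frac{i}{\epsilon}e^{ih(x;\lambda)/\epsilon}\int_{-\infty}^x e^{-ih(z;\lambda)/\epsilon}\Big(\lambda+\sum_{p=1}^P\frac{v_p(\lambda)}{z-z_p}\Big)\,dz$$ is analytic in the upper half $x$-plane if and only if $\{v_p(\lambda)\}_{p=1}^P$ satisfy $$\int_{C_m^>}e^{-ih(z;\lambda)/\epsilon}\Big(\sum_{p=1}^P\frac{v_p(\lambda)}{z-z_p}+\lambda\Big)\,dz=0,\qquad m=1,\dots,P,$$ where $C_m^>:=U_m^>$ unless $ic_m/\epsilon$ is a strictly negative integer, in which case $C_m^>:=\ell_0(z_m)$. (The contours $C_m^>$ extend to $-i\infty$ in $G_0$, making the integrals absolutely convergent.)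
   Context: A star denotes complex conjugation. Let $\epsilon>0$, $P\ge 1$, let $c_1,\dots,c_P$ be nonzero complex numbers with $\sum_{p=1}^P(c_p+c_p^* )=0$, and let $z_1,\dots,z_P\in\mathbb{C}$ satisfy $\mathrm{Im}\{z_p\}>0$ and $\mathrm{Re}\{z_1\}<\dots<\mathrm{Re}\{z_P\}$. Define $$f(x):=\sum_{p=1}^P\Big[c_p\big(\mathrm{Log}(i(x-z_p))+\tfrac{\pi i}{2}\big)+c_p^*\big(\mathrm{Log}(-i(x-z_p^* ))-\tfrac{\pi i}{2}\big)\Big],\qquad h(x;\lambda):=\lambda x+f(x),$$ with $\mathrm{Log}$ the principal branch; thus $f'=u_0$ where $u_0(x)=\sum_{p}\big(\frac{c_p}{x-z_p}+\frac{c_p^*}{x-z_p^*}\big)$. The domain of analyticity of $f$ is $G:=\mathbb{C}\setminus\bigcup_{p}\big(\{z_p+it:t\ge 0\}\cup\{z_p^*-it:t\ge0\}\big)$, and $G_0:=\{\mathrm{Re}\{x\}<\mathrm{Re}\{z_1\}\}\subset G$. The integral in $W_+$ is a convergent improper integral over a path in $G$ from $-\infty$ to $x\in G$ (equivalently, starting from $-i\infty$ in $G_0$). ''Analytic in the upper half $x$-plane'' means that $W_+$, a priori defined for $x\in G$, extends to an analytic function on $\{\mathrm{Im}\{x\}>0\}$. Contours: $\ell_0(z_m)$ originates at $-i\infty$ in $G_0$, runs in $G$, and terminates at $z_m$. $U_m^>$ is a contour on the Riemann surface of $f$ originating at $-i\infty$ in $G_0$ (with the value $f(\infty)=0$) and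 ending at $-i\infty$ over $G_0$, having encircled the singularities $z_1,\dots,z_m$ each exactly once in the positive sense and no other singularity of $f$; concretely, it goes from $-i\infty$ in $G_0$ within $G$ (passing below $z_1,\dots,z_m$ and above all $z_p^*$) up to the region between the upward cuts of $z_m$ and $z_{m+1}$ (to the right of the cut of $z_P$ if $m=P$), then returns above $z_m,\dots,z_1$, crossing the upward cuts of $z_m,\dots,z_1$ with $f$ continued analytically, back over $G_0$ and down to $-i\infty$. *)

(* Defs.v *)
From Stdlib Require Export Reals List.
From Coquelicot Require Export Coquelicot.
Open Scope R_scope.

(* The finite data c_1, ..., c_P, z_1, ..., z_P, v_1, ..., v_P are given by
   functions on nat, of which only the values at 1 <= p <= P are used. *)

Definition Csum (P : nat) (a : nat -> C) : C :=
  sum_n_m (G := C_AbelianMonoid) a 1 P.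

Definition Cexp (w : C) : C :=
  (exp (Re w) * cos (Im w), exp (Re w) * sin (Im w)).

(* Principal argument of w <> 0, with values in (-PI, PI]. *)
Definition Carg (w : C) : R :=
  if Rlt_dec (Im w) 0 then - acos (Re w / Cmod w) else acos (Re w / Cmod w).

Definition Log (w : C) : C := (ln (Cmod w), Carg w).

Definition f (P : nat) (c z : nat -> C) (x : C) : C :=
  Csum P (fun p =>
    c p * (Log (Ci * (x - z p)) + PI * Ci / 2)
    + Cconj (c p) * (Log (- Ci * (x - Cconj (z p))) - PI * Ci / 2))%C.

Definition u0 (P : nat) (c z : nat -> C) (x : C) : C :=
  Csum P (fun p => c p / (x - z p) + Cconj (c p) / (x - Cconj (z p)))%C.

Definition h (P : nat) (c z : nat -> C) (lambda : R) (x : C) : C :=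
  (lambda * x + f P c z x)%C.

Definition up_ray (a x : C) : Prop :=
  exists t : R, 0 <= t /\ x = (a + Ci * t)%C.

Definition down_ray (a x : C) : Prop :=
  exists t : R, 0 <= t /\ x = (a - Ci * t)%C.

Definition G (P : nat) (z : nat -> C) (x : C) : Prop :=
  forall p : nat, (1 <= p <= P)%nat ->
    ~ up_ray (z p) x /\ ~ down_ray (Cconj (z p)) x.

Definition G0 (z : nat -> C) (x : C) : Prop := Re x < Re (z 1%nat).

(* Region between the upward cuts of z_m and z_(m+1), or to the right of the
   cut of z_P when m = P. *)
Definition gap (P : nat) (z : nat -> C) (m : nat) (x : C) : Prop :=
  Re (z m) < Re x /\ ((m < P)%nat -> Re x < Re (z (S m))).

(* Region in which a path from gap m back to G0 may run: it may cross the
   upward cuts of z_1, ..., z_m, but cannot pass below these points, and the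
   cuts of the other singularities remain forbidden. For p <= m the ray
   downwards from z_p contains the cut downwards from z_p^*. *)
Definition return_region (P : nat) (z : nat -> C) (m : nat) (x : C) : Prop :=
  forall p : nat, (1 <= p <= P)%nat ->
    ((p <= m)%nat -> ~ down_ray (z p) x) /\
    ((m < p)%nat -> ~ up_ray (z p) x /\ ~ down_ray (Cconj (z p)) x).

Definition velocity (gamma : R -> C) (t : R) : C :=
  (Derive (fun s => Re (gamma s)) t, Derive (fun s => Im (gamma s)) t).

(* Paths are defined on all of R. A path that is only used up to a parameter b
   can be taken to be constant from b on, so piecewise smoothness on the whole
   of R is no restriction. *)
Definition piecewise_C1 (gamma : R -> C) : Prop :=
  (forall t : R, continuous (U := C_UniformSpace) gamma t) /\
  exists breaks : list R,
    (forall t : R, ~ In t breaks ->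
       ex_derive (K := R_AbsRing) (V := C_R_NormedModule) gamma t /\
       continuous (U := C_UniformSpace) (velocity gamma) t) /\
    (forall t : R, In t breaks ->
       (exists l : C, filterlim (velocity gamma) (at_left t)
                        (locally (T := C_UniformSpace) l)) /\
       (exists r : C, filterlim (velocity gamma) (at_right t)
                        (locally (T := C_UniformSpace) r))).

(* "Originating (ending) at -i oo in G0": the path is eventually a vertical
   ray in G0. *)
Definition originates_at_minus_i_infty (z : nat -> C) (gamma : R -> C) : Prop :=
  exists a T : R, forall t : R, t <= T -> gamma t = (a, t) /\ G0 z (gamma t).

Definition ends_at_minus_i_infty (z : nat -> C) (gamma : R -> C) : Prop :=
  exists a T : R, forall t : R, T <= t -> gamma t = (a, - t) /\ G0 z (gamma t).

(* A contour on the Riemann surface of f: a path, parametrized by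
   -oo < t <= stop or by the whole line if stop = +oo, together with the value
   of f at each of its points. *)
Record contour := Contour {
  path : R -> C;
  fval : R -> C;
  stop : Rbar }.

Definition contour_G (P : nat) (c z : nat -> C) (gamma : R -> C) (b : R)
  : contour :=
  Contour gamma (fun t => f P c z (gamma t)) b.

Definition stop_filter (b : Rbar) : (R -> Prop) -> Prop :=
  match b with
  | Finite t => at_point t
  | _ => Rbar_locally b
  end.

(* exp (-i h / eps) (lambda + sum_p v_p / (z - z_p)) dz along a contour. *)
Definition integrand (eps lambda : R) (P : nat) (z v : nat -> C) (K : contour)
  (t : R) : C :=
  (Cexp (- Ci * (lambda * path K t + fval K t) / eps)
   * (Csum P (fun p => v p / (path K t - z p)) + lambda)
   * velocity (path K) t)%C.

Definition contour_int (eps lambda : R) (P : nat) (z v : nat -> C)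
  (K : contour) : C :=
  RInt_gen (V := C_R_CompleteNormedModule)
    (integrand eps lambda P z v K) (Rbar_locally m_infty) (stop_filter (stop K)).

Definition abs_convergent (eps lambda : R) (P : nat) (z v : nat -> C)
  (K : contour) : Prop :=
  ex_RInt_gen (V := C_R_NormedModule)
    (integrand eps lambda P z v K) (Rbar_locally m_infty) (stop_filter (stop K))
  /\
  ex_RInt_gen (V := R_NormedModule)
    (fun t => Cmod (integrand eps lambda P z v K t))
    (Rbar_locally m_infty) (stop_filter (stop K)).

Definition path_in_G_to (P : nat) (z : nat -> C) (x : C) (gamma : R -> C)
  : Prop :=
  piecewise_C1 gamma /\
  originates_at_minus_i_infty z gamma /\
  (forall t : R, t <= 0 -> G P z (gamma t)) /\
  gamma 0 = x.

(* The path to x starts at -i oo in G0: on the real half-line the constant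
   term lambda makes the integral from -oo oscillate without converging. *)
Definition W_plus (eps lambda : R) (P : nat) (c z v : nat -> C)
  (gamma : C -> R -> C) (x : C) : C :=
  (- (Ci / eps) * Cexp (Ci * h P c z lambda x / eps)
   * contour_int eps lambda P z v (contour_G P c z (gamma x) 0))%C.

Definition extends_analytically_to_upper_half_plane (P : nat) (z : nat -> C)
  (W : C -> C) : Prop :=
  exists E : C -> C,
    (forall x : C, 0 < Im x -> G P z x -> E x = W x) /\
    (forall x : C, 0 < Im x ->
       ex_derive (K := C_AbsRing) (V := C_NormedModule) E x).

(* phi t is the value at gamma t of a branch of f that is continued
   analytically along gamma; since f' = u0, the local branches of f are local
   antiderivatives of u0. *)
Definition continued_along (P : nat) (c z : nat -> C) (gamma phi : R -> C)
  : Prop :=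
  forall t : R, exists (r : R) (F : C -> C),
    0 < r /\
    (forall x : C, Cmod (x - gamma t) < r ->
       is_derive (K := C_AbsRing) (V := C_NormedModule) F x (u0 P c z x)) /\
    locally t (fun s => phi s = F (gamma s)).

Definition is_ell0 (P : nat) (c z : nat -> C) (m : nat) (K : contour) : Prop :=
  exists gamma : R -> C,
    K = contour_G P c z gamma 0 /\
    piecewise_C1 gamma /\
    originates_at_minus_i_infty z gamma /\
    (forall t : R, t < 0 -> G P z (gamma t)) /\
    gamma 0 = z m.

(* Starting in G with the values of f itself, the contour reaches the gap at
   the turning parameter t0 and from there goes back to G0 above
   z_m, ..., z_1. *)
Definition is_U (P : nat) (c z : nat -> C) (m : nat) (K : contour) : Prop :=
  stop K = p_infty /\
  piecewise_C1 (path K) /\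
  originates_at_minus_i_infty z (path K) /\
  ends_at_minus_i_infty z (path K) /\
  continued_along P c z (path K) (fval K) /\
  exists t0 : R,
    (forall t : R, t <= t0 ->
       G P z (path K t) /\ fval K t = f P c z (path K t)) /\
    gap P z m (path K t0) /\
    (forall t : R, t0 <= t -> return_region P z m (path K t)).

Definition strictly_negative_integer (w : C) : Prop :=
  exists n : nat, (0 < n)%nat /\ w = RtoC (- INR n).

Definition is_C_contour (eps : R) (P : nat) (c z : nat -> C) (m : nat)
  (K : contour) : Prop :=
  (strictly_negative_integer (Ci * c m / eps)%C -> is_ell0 P c z m K) /\
  (~ strictly_negative_integer (Ci * c m / eps)%C -> is_U P c z m K).

(* Main.v *)
(**
The branches of f are organised by the number m of upward cuts that have been replaced by
downward ones: the m-th branch lives on the plane cut downwards from z_1, ..., z_m and, as for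
f itself, upwards from the other z_p and downwards from the other z_p^*.  The integrand of W_+
has on each of these simply connected domains a primitive I_m that tends to 0 at -i oo in G_0,
and W_m := -(i/eps) e^{i h_m/eps} I_m coincides with W_(m-1) to the left of z_m.  The integral
over U_m is the constant value of I_0 - I_m in the gap m, and the integral over l_0(z_m) is the
limit of I_0 at z_m.

If W_+ extends, then comparing the extension with W_m across the cut above z_m gives, by
induction on m, I_0 = I_m in the gap m.  Conversely, if I_0 = I_m in all gaps, W_P continues
W_+ across all the upward cuts, and only the points z_m remain.  There, with
alpha = -i c_m/eps and x = z_m - i e^w, the function I_0 expands as
H_0 e^{alpha w}/alpha - i H_1 e^{(alpha+1) w}/(alpha+1) + Y_0 + o(e^{(alpha+1) w}) (with a term linear
in w if alpha = -1; the constant Y_0 is not visible if Re alpha <= -3/2), and W_+ is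
e^{-alpha w} I_0 times a holomorphic function.  Since W_+ is single valued, the linear term
vanishes, and Y_0 vanishes unless alpha is an integer.  It is harmless for alpha = -1, and
alpha = 1, 2, ... is the case in which l_0(z_m) is used, so that Y_0 = 0 there as well.  It
follows that W_+ has a complex derivative at z_m.
*)

Require Import Defs.
From Stdlib Require Import Arith Lra Lia ClassicalEpsilon.
Set Bullet Behavior "Strict Subproofs".

(** * Complex derivatives and the exponential *)

(** Analyticity is complex differentiability at every point, and the proof uses nothing beyond it:
    neither Cauchy's integral formula nor the theorem on removable singularities enters. Primitives
    are integrals along segments in star-shaped pieces, and at z_m the derivative is read off an
    expansion of W_+ whose error is o(x - z_m). This explains the case distinction at z_m. A
    constant Y_0 left by the integration contributes Y_0 e^{-alpha w}; for Re alpha <= -3/2 this is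
    itself o(x - z_m), and so are the logarithms met at alpha = -2, -3, ... The number -3/2 only has
    to separate -1 from -2, so that alpha = -1 is the single resonance in which a logarithm could
    spoil the derivative. It also explains the change of contour. If alpha = 1, 2, ..., then
    e^{-ih/eps} is single valued near z_m and the integrand is bounded there, so a loop that also
    encloses z_m adds no condition to the loops before it; but e^{-ih/eps} vanishes at z_m, and
    dividing by it creates a pole unless I_0 tends to 0. *)

Definition cderiv (F : C -> C) (x l : C) : Prop :=
  is_derive (K := C_AbsRing) (V := C_NormedModule) F x l.

Lemma cderiv_iff (F : C -> C) (x l : C) :
  cderiv F x l <->
  forall e : R, 0 < e -> exists d : R, 0 < d /\ forall y : C, Cmod (y - x) < d ->
    Cmod (F y - F x - (y - x) * l)%C <= e * Cmod (y - x)%C.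
Proof.
  split.
  - intros [_ H] e He.
    destruct (H x (fun P HP => HP) (mkposreal e He)) as [d Hd].
    exists d; split; [apply cond_pos|]. intros y Hy. apply (Hd y Hy).
  - intros H. split; [apply is_linear_scal_l|].
    intros x0 Hx0 e.
    replace x0 with x by (apply (is_filter_lim_locally_unique (V := AbsRing_NormedModule C_AbsRing) x x0 Hx0)).
    destruct (H e (cond_pos e)) as [d [Hd H']].
    exists (mkposreal d Hd). intros y Hy. apply (H' y Hy).
Qed.

Definition ccont (F : C -> C) (x : C) : Prop :=
  forall e : R, 0 < e -> exists d : R, 0 < d /\ forall y : C, Cmod (y - x) < d ->
    Cmod (F y - F x)%C < e.

Lemma Ci_sqr : (Ci * Ci)%C = (- (1))%C.
Proof. apply injective_projections; simpl; ring. Qed.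

Lemma exp_le_compat (x y : R) : x <= y -> exp x <= exp y.
Proof. intros [H| ->]; [left; apply exp_increasing, H|lra]. Qed.

Lemma ln_le_compat (x y : R) : 0 < x -> x <= y -> ln x <= ln y.
Proof. intros Hx [H| ->]; [left; apply ln_increasing; assumption|lra]. Qed.

Lemma Rlt_Rmin_l (x a b : R) : x < Rmin a b -> x < a.
Proof. intros H. eapply Rlt_le_trans; [exact H|apply Rmin_l]. Qed.

Lemma Rlt_Rmin_r (x a b : R) : x < Rmin a b -> x < b.
Proof. intros H. eapply Rlt_le_trans; [exact H|apply Rmin_r]. Qed.

Lemma Cmod_le_sum (w : C) : Cmod w <= Rabs (Re w) + Rabs (Im w).
Proof.
  replace w with (RtoC (Re w) + Ci * RtoC (Im w))%C at 1
    by (destruct w; apply injective_projections; simpl; ring).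
  eapply Rle_trans; [apply Cmod_triangle|].
  rewrite Cmod_mult, Cmod_Ci, !Cmod_R. lra.
Qed.

Lemma im_le_Cmod (w : C) : Rabs (Im w) <= Cmod w.
Proof.
  eapply Rle_trans; [|apply Rmax_Cmod]. apply Rmax_r.
Qed.

Lemma Cmod_sub_sym (x y : C) : Cmod (x - y)%C = Cmod (y - x)%C.
Proof. rewrite <- Cmod_opp. f_equal. ring. Qed.

Lemma Cmod_sub_triangle (x y w : C) : Cmod (x - y)%C <= Cmod (x - w)%C + Cmod (w - y)%C.
Proof. replace (x - y)%C with ((x - w) + (w - y))%C by ring. apply Cmod_triangle. Qed.

Lemma Cmod_triangle_sub (x y : C) : Cmod x - Cmod y <= Cmod (x - y)%C.
Proof.
  generalize (Cmod_triangle (x - y) y). replace (x - y + y)%C with x by ring. lra.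
Qed.

(** The uniform structure of C is that of a product, so its balls are squares. Discs and squares are
    compared here once; all later limits are handled through [Cmod]. *)
Lemma clim_iff {T : Type} (F : (T -> Prop) -> Prop) {FF : Filter F} (phi : T -> C) (l : C) :
  filterlim phi F (locally (T := C_UniformSpace) l) <->
  forall e : R, 0 < e -> F (fun t => Cmod (phi t - l)%C < e).
Proof.
  split.
  - intros H e He.
    assert (He' : 0 < e / 2) by lra.
    generalize (H _ (locally_ball l (mkposreal _ He'))). unfold filtermap.
    apply filter_imp. intros t [H1 H2].
    eapply Rle_lt_trans; [apply Cmod_le_sum|].
    change (Rabs (Re (phi t) - Re l) < e / 2) in H1.
    change (Rabs (Im (phi t) - Im l) < e / 2) in H2.
    change (Rabs (Re (phi t) - Re l) + Rabs (Im (phi t) - Im l) < e). lra.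
  - intros H P [e He]. unfold filtermap.
    generalize (H e (cond_pos e)). apply filter_imp. intros t Ht.
    apply He. split.
    + eapply Rle_lt_trans; [apply (re_le_Cmod (phi t - l)%C)|exact Ht].
    + eapply Rle_lt_trans; [apply (im_le_Cmod (phi t - l)%C)|exact Ht].
Qed.

Lemma ccont_filterlim (F : C -> C) (x : C) {T : Type} (L : (T -> Prop) -> Prop)
  {FF : Filter L} (phi : T -> C) :
  ccont F x -> filterlim phi L (locally (T := C_UniformSpace) x) ->
  filterlim (fun t => F (phi t)) L (locally (T := C_UniformSpace) (F x)).
Proof.
  intros HF Hphi. apply (clim_iff L). intros e He.
  destruct (HF e He) as [d [Hd H]].
  generalize (proj1 (clim_iff L phi x) Hphi d Hd). apply filter_imp.
  intros t Ht. apply H, Ht.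
Qed.

Lemma filterlim_Re {T : Type} (L : (T -> Prop) -> Prop) {FF : Filter L} (phi : T -> C) (l : C) :
  filterlim phi L (locally (T := C_UniformSpace) l) ->
  filterlim (fun t => Re (phi t)) L (locally (Re l)).
Proof.
  intros H P [e He]. unfold filtermap.
  generalize (proj1 (clim_iff L phi l) H e (cond_pos e)). apply filter_imp.
  intros t Ht. apply He. eapply Rle_lt_trans; [apply (re_le_Cmod (phi t - l)%C)|exact Ht].
Qed.

Lemma filterlim_Im {T : Type} (L : (T -> Prop) -> Prop) {FF : Filter L} (phi : T -> C) (l : C) :
  filterlim phi L (locally (T := C_UniformSpace) l) ->
  filterlim (fun t => Im (phi t)) L (locally (Im l)).
Proof.
  intros H P [e He]. unfold filtermap.
  generalize (proj1 (clim_iff L phi l) H e (cond_pos e)). apply filter_imp.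
  intros t Ht. apply He. eapply Rle_lt_trans; [apply (im_le_Cmod (phi t - l)%C)|exact Ht].
Qed.

Lemma filterlim_Cmod {T : Type} (L : (T -> Prop) -> Prop) {FF : Filter L} (phi : T -> C) (l : C) :
  filterlim phi L (locally (T := C_UniformSpace) l) ->
  filterlim (fun t => Cmod (phi t)) L (locally (Cmod l)).
Proof.
  intros H P [e He]. unfold filtermap.
  generalize (proj1 (clim_iff L phi l) H e (cond_pos e)). apply filter_imp.
  intros t Ht. apply He. change (Rabs (Cmod (phi t) - Cmod l) < e).
  apply Rabs_def1; [generalize (Cmod_triangle_sub (phi t) l)|
    generalize (Cmod_triangle_sub l (phi t)); rewrite (Cmod_sub_sym l)]; lra.
Qed.

Lemma filterlim_Cmult {T : Type} (L : (T -> Prop) -> Prop) {FF : Filter L} (phi psi : T -> C) (l m : C) :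
  filterlim phi L (locally (T := C_UniformSpace) l) ->
  filterlim psi L (locally (T := C_UniformSpace) m) ->
  filterlim (fun t => (phi t * psi t)%C) L (locally (T := C_UniformSpace) (l * m)%C).
Proof.
  intros H1 H2. apply (clim_iff L). intros e He.
  set (A := Cmod l + Cmod m + 1).
  assert (HA : 0 < A) by (unfold A; generalize (Cmod_ge_0 l) (Cmod_ge_0 m); lra).
  set (e' := Rmin 1 (e / (2 * A))).
  assert (He1 : e' <= 1) by apply Rmin_l.
  assert (He2 : e' * A <= e / 2).
  { apply Rle_trans with (e / (2 * A) * A).
    - apply Rmult_le_compat_r; [lra|apply Rmin_r].
    - right. field. lra. }
  assert (He' : 0 < e').
  { apply Rmin_pos; [lra|]. apply Rdiv_lt_0_compat; lra. }
  generalize (filter_and _ _ (proj1 (clim_iff L phi l) H1 e' He')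
                (proj1 (clim_iff L psi m) H2 e' He')).
  apply filter_imp. intros t [Ha Hb].
  replace (phi t * psi t - l * m)%C
    with ((phi t - l) * (psi t - m) + (phi t - l) * m + l * (psi t - m))%C by ring.
  eapply Rle_lt_trans; [apply Cmod_triangle|].
  rewrite Cmod_mult.
  eapply Rle_lt_trans; [apply Rplus_le_compat_r, Cmod_triangle|].
  rewrite !Cmod_mult.
  set (a := Cmod (phi t - l)) in *. set (b := Cmod (psi t - m)) in *.
  assert (0 <= a) by apply Cmod_ge_0. assert (0 <= b) by apply Cmod_ge_0.
  unfold A in He2. generalize (Cmod_ge_0 l) (Cmod_ge_0 m). intros.
  assert (a * b <= e') by nra.
  assert (a * Cmod m <= e' * Cmod m) by nra.
  assert (Cmod l * b <= e' * Cmod l) by nra.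
  nra.
Qed.

Lemma cderiv_ccont (F : C -> C) (x l : C) : cderiv F x l -> ccont F x.
Proof.
  intros H e He. destruct (proj1 (cderiv_iff F x l) H 1 Rlt_0_1) as [d [Hd HF]].
  set (A := Cmod l + 2).
  assert (HA : 0 < A) by (unfold A; generalize (Cmod_ge_0 l); lra).
  exists (Rmin d (e / A)). split.
  { apply Rmin_pos; [lra|]. apply Rdiv_lt_0_compat; lra. }
  intros y Hy.
  assert (H1 : Cmod (y - x) < d) by exact (Rlt_Rmin_l _ _ _ Hy).
  assert (H2 : Cmod (y - x) * A < e).
  { replace e with (e / A * A) by (field; lra).
    apply Rmult_lt_compat_r; [lra|]. exact (Rlt_Rmin_r _ _ _ Hy). }
  specialize (HF y H1).
  replace (F y - F x)%C with ((F y - F x - (y - x) * l) + (y - x) * l)%C by ring.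
  eapply Rle_lt_trans; [apply Cmod_triangle|]. rewrite Cmod_mult.
  unfold A in H2. generalize (Cmod_ge_0 (y - x)). nra.
Qed.

Lemma cderiv_ext_loc (F H : C -> C) (x l : C) (d : R) :
  0 < d -> (forall y, Cmod (y - x) < d -> F y = H y) -> cderiv F x l -> cderiv H x l.
Proof.
  intros Hd He HF. apply cderiv_iff. intros e Hee.
  destruct (proj1 (cderiv_iff F x l) HF e Hee) as [d' [Hd' H']].
  exists (Rmin d d'). split; [apply Rmin_pos; lra|]. intros y Hy.
  rewrite <- !He.
  - apply H'. exact (Rlt_Rmin_r _ _ _ Hy).
  - replace (x - x)%C with (RtoC 0) by ring. rewrite Cmod_0. lra.
  - exact (Rlt_Rmin_l _ _ _ Hy).
Qed.

Lemma cderiv_ext (F H : C -> C) (x l : C) :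
  (forall y, F y = H y) -> cderiv F x l -> cderiv H x l.
Proof. intros He. apply (cderiv_ext_loc F H x l 1 Rlt_0_1). auto. Qed.

Lemma cderiv_eq (F : C -> C) (x l m : C) : cderiv F x l -> l = m -> cderiv F x m.
Proof. intros H <-. exact H. Qed.

Lemma cderiv_const (a x : C) : cderiv (fun _ => a) x (RtoC 0).
Proof. apply (is_derive_const (K := C_AbsRing) (V := C_NormedModule)). Qed.

Lemma cderiv_id (x : C) : cderiv (fun y => y) x (RtoC 1).
Proof.
  apply cderiv_iff. intros e He. exists 1. split; [lra|]. intros y _.
  replace (y - x - (y - x) * 1)%C with (RtoC 0) by ring. rewrite Cmod_0.
  generalize (Cmod_ge_0 (y - x)). nra.
Qed.

Lemma cderiv_plus (F H : C -> C) (x l m : C) :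
  cderiv F x l -> cderiv H x m -> cderiv (fun y => F y + H y)%C x (l + m)%C.
Proof. apply (is_derive_plus (K := C_AbsRing) (V := C_NormedModule)). Qed.

Lemma cderiv_minus (F H : C -> C) (x l m : C) :
  cderiv F x l -> cderiv H x m -> cderiv (fun y => F y - H y)%C x (l - m)%C.
Proof. apply (is_derive_minus (K := C_AbsRing) (V := C_NormedModule)). Qed.

(** [C_NormedModule] and [AbsRing_NormedModule C_AbsRing] are two structures with the same norm; the
    product and chain rules are phrased with the second one. *)
Lemma cderiv_abs_ring (F : C -> C) (x l : C) :
  cderiv F x l <-> is_derive (K := C_AbsRing) (V := AbsRing_NormedModule C_AbsRing) F x l.
Proof.
  split; intros [_ H]; (split; [apply is_linear_scal_l|exact H]).
Qed.

Lemma cderiv_mult (F H : C -> C) (x l m : C) :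
  cderiv F x l -> cderiv H x m -> cderiv (fun y => F y * H y)%C x (l * H x + F x * m)%C.
Proof.
  intros HF HH.
  apply cderiv_abs_ring in HF, HH. apply cderiv_abs_ring.
  exact (is_derive_mult (K := C_AbsRing) F H x l m HF HH Cmult_comm).
Qed.

Lemma cderiv_comp (F H : C -> C) (x l m : C) :
  cderiv F (H x) l -> cderiv H x m -> cderiv (fun y => F (H y)) x (m * l)%C.
Proof. intros HF HH. apply cderiv_abs_ring in HH. revert HF HH. apply (is_derive_comp (K := C_AbsRing) (V := C_NormedModule) F H). Qed.

Lemma ccont_mult (F H : C -> C) (x : C) :
  ccont F x -> ccont H x -> ccont (fun y => F y * H y)%C x.
Proof.
  intros HF HH e He.
  set (L := fun P : C -> Prop => exists d, 0 < d /\ forall y, Cmod (y - x) < d -> P y).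
  assert (FL : Filter L).
  { constructor.
    - exists 1. split; [lra|auto].
    - intros P Q [d [Hd HP]] [d' [Hd' HQ]]. exists (Rmin d d').
      split; [apply Rmin_pos; lra|]. intros y Hy. split;
      [apply HP|apply HQ]; (eapply Rlt_le_trans; [exact Hy|]); [apply Rmin_l|apply Rmin_r].
    - intros P Q HPQ [d [Hd HP]]. exists d. auto. }
  apply (proj1 (clim_iff L (fun y => F y * H y)%C _)
    (filterlim_Cmult L F H (F x) (H x) (proj2 (clim_iff L _ _) HF) (proj2 (clim_iff L _ _) HH)) e He).
Qed.

(** The remainder is exactly (y - x)^2 / (y x^2), and |y| > |x|/2 as soon as y is within |x|/2 of
    x. *)
Lemma cderiv_inv (x : C) : x <> 0 -> cderiv (fun y => / y)%C x (- (/ x * / x))%C.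
Proof.
  intros Hx. apply cderiv_iff. intros e He.
  assert (Hm : 0 < Cmod x) by (apply Cmod_gt_0, Hx).
  set (A := Cmod x) in *.
  exists (Rmin (A / 2) (e * (A * A * A) / 2)). split.
  { apply Rmin_pos; [lra|]. apply Rdiv_lt_0_compat; [|lra].
    repeat apply Rmult_lt_0_compat; lra. }
  intros y Hy.
  destruct (Rmin_Rgt_l _ _ _ Hy) as [H1 H2].
  assert (H3 : A / 2 < Cmod y).
  { generalize (Cmod_triangle_sub x y). rewrite Cmod_sub_sym. fold A. lra. }
  assert (Hy0 : y <> 0) by (apply Cmod_gt_0; lra).
  replace (/ y - / x - (y - x) * - (/ x * / x))%C
    with ((y - x) * ((y - x) * (/ y * / x * / x)))%C by (field; auto).
  rewrite !Cmod_mult, !Cmod_inv by auto. fold A.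
  set (B := Cmod y) in *. set (D := Cmod (y - x)) in *.
  assert (HD : 0 <= D) by apply Cmod_ge_0.
  rewrite (Rmult_comm e). apply Rmult_le_compat_l; [exact HD|].
  replace (D * (/ B * / A * / A)) with (D / (B * A * A)) by (field; lra).
  apply Rle_div_l; [apply Rlt_gt; repeat apply Rmult_lt_0_compat; lra|].
  apply Rle_trans with (e * (A * A * A) / 2); [lra|].
  assert (0 < e * (A * A)) by (repeat apply Rmult_lt_0_compat; lra).
  nra.
Qed.

Lemma Cexp_plus (a b : C) : Cexp (a + b)%C = (Cexp a * Cexp b)%C.
Proof.
  unfold Cexp. apply injective_projections; simpl;
  rewrite exp_plus, ?cos_plus, ?sin_plus; unfold Re, Im; ring.
Qed.

Lemma Cexp_0 : Cexp 0 = 1.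
Proof. unfold Cexp; simpl. rewrite exp_0, cos_0, sin_0. apply injective_projections; simpl; ring. Qed.

Lemma Cexp_neq_0 (a : C) : Cexp a <> 0.
Proof.
  intros H. assert (H1 : (Cexp a * Cexp (- a))%C = 1).
  { rewrite <- Cexp_plus, <- Cexp_0. f_equal. ring. }
  rewrite H in H1. apply (f_equal Re) in H1. simpl in H1. lra.
Qed.

Lemma Cexp_opp (a : C) : Cexp (- a)%C = (/ Cexp a)%C.
Proof.
  assert (H1 : (Cexp a * Cexp (- a))%C = 1).
  { rewrite <- Cexp_plus, <- Cexp_0. f_equal. ring. }
  generalize (Cexp_neq_0 a). intros H.
  replace (Cexp (- a)) with (/ Cexp a * (Cexp a * Cexp (- a)))%C by (field; auto).
  rewrite H1. ring.
Qed.

Lemma Cmod_Cexp (a : C) : Cmod (Cexp a) = exp (Re a).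
Proof.
  destruct a as [x y]. unfold Cmod, Cexp; simpl.
  transitivity (sqrt (exp x ^ 2)); [|apply sqrt_pow2; left; apply exp_pos]. f_equal.
  transitivity (exp x ^ 2 * (Rsqr (sin y) + Rsqr (cos y))).
  - unfold Rsqr. ring.
  - rewrite sin2_cos2. ring.
Qed.

(** * Derivatives along curves and the mean value inequality *)

Definition pderiv (phi : R -> C) (t : R) (l : C) : Prop :=
  is_derive (K := R_AbsRing) (V := C_R_NormedModule) phi t l.

Lemma pderiv_iff (phi : R -> C) (t : R) (l : C) :
  pderiv phi t l <->
  forall e : R, 0 < e -> exists d : R, 0 < d /\ forall s : R, Rabs (s - t) < d ->
    Cmod (phi s - phi t - RtoC (s - t) * l)%C <= e * Rabs (s - t).
Proof.
  assert (E : forall s, (phi s - phi t - RtoC (s - t) * l)%C =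
      @minus C_R_NormedModule (@minus C_R_NormedModule (phi s) (phi t)) (scal (minus s t) l)).
  { intros s. apply injective_projections; simpl;
    unfold minus, plus, opp, scal; simpl; unfold mult; simpl; ring. }
  split.
  - intros [_ H] e He.
    destruct (H t (fun P HP => HP) (mkposreal e He)) as [d Hd].
    exists d; split; [apply cond_pos|]. intros s Hs. rewrite E, Cmod_norm. apply (Hd s Hs).
  - intros H. split; [apply is_linear_scal_l|].
    intros x0 Hx0 e.
    replace x0 with t by (apply (is_filter_lim_locally_unique (V := R_NormedModule) t x0 Hx0)).
    destruct (H e (cond_pos e)) as [d [Hd H']].
    exists (mkposreal d Hd). intros s Hs. generalize (H' s Hs). rewrite E, Cmod_norm. auto.
Qed.

Lemma is_derive_eps (phi : R -> R) (t l : R) :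
  is_derive phi t l <->
  forall e : R, 0 < e -> exists d : R, 0 < d /\ forall s : R, Rabs (s - t) < d ->
    Rabs (phi s - phi t - (s - t) * l) <= e * Rabs (s - t).
Proof.
  split.
  - intros [_ H] e He.
    destruct (H t (fun P HP => HP) (mkposreal e He)) as [d Hd].
    exists d; split; [apply cond_pos|]. intros s Hs. apply (Hd s Hs).
  - intros H. split; [apply is_linear_scal_l|].
    intros x0 Hx0 e.
    replace x0 with t by (apply (is_filter_lim_locally_unique (V := R_NormedModule) t x0 Hx0)).
    destruct (H e (cond_pos e)) as [d [Hd H']].
    exists (mkposreal d Hd). intros s Hs. apply (H' s Hs).
Qed.

Lemma pderiv_components (phi : R -> C) (t : R) (l : C) :
  pderiv phi t l <->
  is_derive (fun s => Re (phi s)) t (Re l) /\ is_derive (fun s => Im (phi s)) t (Im l).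
Proof.
  split.
  - intros H. split; apply is_derive_eps; intros e He;
    destruct (proj1 (pderiv_iff phi t l) H e He) as [d [Hd Hs]];
    exists d; (split; [exact Hd|]); intros s Hst;
    (eapply Rle_trans; [|apply (Hs s Hst)]).
    + eapply Rle_trans; [|apply re_le_Cmod]. right. f_equal. unfold Re, Im; simpl; ring.
    + eapply Rle_trans; [|apply im_le_Cmod]. right. f_equal. unfold Re, Im; simpl; ring.
  - intros [H1 H2]. apply pderiv_iff. intros e He.
    destruct (proj1 (is_derive_eps _ _ _) H1 (e / 2) ltac:(lra)) as [d1 [Hd1 Hs1]].
    destruct (proj1 (is_derive_eps _ _ _) H2 (e / 2) ltac:(lra)) as [d2 [Hd2 Hs2]].
    exists (Rmin d1 d2). split; [apply Rmin_pos; lra|]. intros s Hs.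
    eapply Rle_trans; [apply Cmod_le_sum|].
    assert (A1 := Hs1 s (Rlt_Rmin_l _ _ _ Hs)).
    assert (A2 := Hs2 s (Rlt_Rmin_r _ _ _ Hs)).
    replace (Re (phi s - phi t - RtoC (s - t) * l)) with (Re (phi s) - Re (phi t) - (s - t) * Re l)
      by (unfold Re, Im; simpl; ring).
    replace (Im (phi s - phi t - RtoC (s - t) * l)) with (Im (phi s) - Im (phi t) - (s - t) * Im l)
      by (unfold Re, Im; simpl; ring).
    lra.
Qed.

(** A chain rule that mixes two scalar fields: the outer derivative is over C, the inner one over
    R. *)
Lemma cderiv_pderiv (F : C -> C) (gamma : R -> C) (t : R) (l v : C) :
  cderiv F (gamma t) l -> pderiv gamma t v -> pderiv (fun s => F (gamma s)) t (l * v)%C.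
Proof.
  intros HF Hg. apply pderiv_iff. intros e He.
  set (A := Cmod v + 1). assert (HA : 0 < A) by (unfold A; generalize (Cmod_ge_0 v); lra).
  set (B := Cmod l + 1). assert (HB : 0 < B) by (unfold B; generalize (Cmod_ge_0 l); lra).
  destruct (proj1 (cderiv_iff _ _ _) HF (e / (2 * A))) as [d [Hd H]].
  { apply Rdiv_lt_0_compat; lra. }
  destruct (proj1 (pderiv_iff _ _ _) Hg (Rmin 1 (e / (2 * B)))) as [d' [Hd' H']].
  { apply Rmin_pos; [lra|]. apply Rdiv_lt_0_compat; lra. }
  exists (Rmin d' (d / A)). split.
  { apply Rmin_pos; [lra|]. apply Rdiv_lt_0_compat; lra. }
  intros s Hs.
  assert (Hs1 : Rabs (s - t) < d') by exact (Rlt_Rmin_l _ _ _ Hs).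
  assert (Hs2 : Rabs (s - t) * A < d).
  { replace d with (d / A * A) by (field; lra). apply Rmult_lt_compat_r; [lra|].
    exact (Rlt_Rmin_r _ _ _ Hs). }
  specialize (H' s Hs1).
  set (D := Rabs (s - t)) in *. assert (HD : 0 <= D) by apply Rabs_pos.
  assert (E1 : Cmod (gamma s - gamma t - RtoC (s - t) * v) <= 1 * D).
  { eapply Rle_trans; [exact H'|]. apply Rmult_le_compat_r; [lra|apply Rmin_l]. }
  assert (E2 : Cmod (gamma s - gamma t - RtoC (s - t) * v) <= e / (2 * B) * D).
  { eapply Rle_trans; [exact H'|]. apply Rmult_le_compat_r; [lra|apply Rmin_r]. }
  assert (E3 : Cmod (gamma s - gamma t) <= D * A).
  { replace (gamma s - gamma t)%C with ((gamma s - gamma t - RtoC (s - t) * v) + RtoC (s - t) * v)%C by ring.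
    eapply Rle_trans; [apply Cmod_triangle|]. rewrite Cmod_mult, Cmod_R. fold D. unfold A. nra. }
  assert (E4 := H (gamma s) ltac:(lra)).
  replace (F (gamma s) - F (gamma t) - RtoC (s - t) * (l * v))%C with
    ((F (gamma s) - F (gamma t) - (gamma s - gamma t) * l)
     + (gamma s - gamma t - RtoC (s - t) * v) * l)%C by ring.
  eapply Rle_trans; [apply Cmod_triangle|]. rewrite Cmod_mult.
  assert (E5 : Cmod (gamma s - gamma t - RtoC (s - t) * v) * Cmod l <= e / 2 * D).
  { apply Rle_trans with (e / (2 * B) * D * B).
    - apply Rmult_le_compat; try apply Cmod_ge_0; [exact E2|unfold B; lra].
    - right. field. lra. }
  assert (E6 : e / (2 * A) * Cmod (gamma s - gamma t) <= e / 2 * D).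
  { apply Rle_trans with (e / (2 * A) * (D * A)).
    - apply Rmult_le_compat_l; [|exact E3]. left. apply Rdiv_lt_0_compat; lra.
    - right. field. lra. }
  lra.
Qed.

Lemma is_derive_continuity_pt (phi : R -> R) (t l : R) : is_derive phi t l -> continuity_pt phi t.
Proof. intros H. apply derivable_continuous_pt. exists l. apply is_derive_Reals, H. Qed.

(* The real-valued function Re (conj (phi b - phi a) * phi) turns the vector-valued
   mean value inequality into the real mean value theorem. *)
Lemma mean_value_inequality (phi dphi : R -> C) (B dB : R -> R) (a b : R) :
  a <= b ->
  (forall t, a <= t <= b -> pderiv phi t (dphi t)) ->
  (forall t, a <= t <= b -> is_derive B t (dB t)) ->
  (forall t, a <= t <= b -> Cmod (dphi t) <= dB t) ->
  Cmod (phi b - phi a)%C <= B b - B a.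
Proof.
  intros Hab Hphi HB Hle.
  set (D := (phi b - phi a)%C).
  set (m := fun t => Re D * Re (phi t) + Im D * Im (phi t) - Cmod D * B t).
  set (dm := fun t => Re D * Re (dphi t) + Im D * Im (dphi t) - Cmod D * dB t).
  assert (Hm : forall t, a <= t <= b -> is_derive m t (dm t)).
  { intros t Ht. destruct (proj1 (pderiv_components _ _ _) (Hphi t Ht)) as [H1 H2].
    apply (is_derive_minus (K := R_AbsRing) (V := R_NormedModule)).
    - apply (is_derive_plus (K := R_AbsRing) (V := R_NormedModule));
      apply is_derive_scal; assumption.
    - apply is_derive_scal, HB, Ht. }
  destruct (MVT_gen m a b dm) as [c [Hc E]].
  { intros t Ht. apply Hm. rewrite Rmin_left, Rmax_right in Ht by lra. lra. }
  { intros t Ht. eapply is_derive_continuity_pt. apply Hm.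
    rewrite Rmin_left, Rmax_right in Ht by lra. lra. }
  rewrite Rmin_left, Rmax_right in Hc by lra.
  assert (Hdm : dm c <= 0).
  { unfold dm.
    assert (H1 : Re D * Re (dphi c) + Im D * Im (dphi c) <= Cmod D * Cmod (dphi c)).
    { rewrite <- (Cmod_conj D), <- Cmod_mult.
      eapply Rle_trans; [|apply (re_le_Cmod (Cconj D * dphi c)%C)].
      eapply Rle_trans; [|apply Rle_abs]. right. unfold Re, Im; simpl; ring. }
    generalize (Hle c Hc) (Cmod_ge_0 D). nra. }
  assert (Em : m b - m a = Cmod D * (Cmod D - (B b - B a))).
  { unfold m. transitivity (Re D * Re D + Im D * Im D - Cmod D * (B b - B a)).
    - replace (Re (phi b)) with (Re (phi a) + Re D) by (unfold D, Re; simpl; ring).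
      replace (Im (phi b)) with (Im (phi a) + Im D) by (unfold D, Im; simpl; ring).
      ring.
    - generalize (Cmod2_alt D). nra. }
  assert (Hneg : m b - m a <= 0) by (rewrite E; nra).
  (* For D <> 0 the factor |D| cancels. For D = 0 it remains that [B] does not decrease, which is
     the mean value theorem for [B] with [dB] >= |[dphi]| >= 0. *)
  destruct (Rle_lt_or_eq_dec 0 (Cmod D) (Cmod_ge_0 D)) as [H|H]; [nra|].
  rewrite <- H.
  destruct (Rle_lt_or_eq_dec _ _ Hab) as [Hlt|Heq]; [|subst b; lra].
  destruct (MVT_gen B a b dB) as [c' [Hc' E']].
  { intros t Ht. apply HB. rewrite Rmin_left, Rmax_right in Ht by lra. lra. }
  { intros t Ht. eapply is_derive_continuity_pt. apply HB.
    rewrite Rmin_left, Rmax_right in Ht by lra. lra. }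
  rewrite Rmin_left, Rmax_right in Hc' by lra.
  rewrite E'. generalize (Hle c' Hc') (Cmod_ge_0 (dphi c')). nra.
Qed.

Lemma pderiv_segment (a k : C) (t : R) : pderiv (fun s => a + RtoC s * k)%C t k.
Proof.
  apply pderiv_iff. intros e He. exists 1. split; [lra|]. intros s _.
  replace (a + s * k - (a + t * k) - (s - t)%R * k)%C with (RtoC 0)
    by (rewrite RtoC_minus; ring).
  rewrite Cmod_0. generalize (Rabs_pos (s - t)). nra.
Qed.

Lemma mean_value_segment (F dF : C -> C) (M : R) (a b : C) :
  (forall t, 0 <= t <= 1 -> cderiv F (a + RtoC t * (b - a))%C (dF (a + RtoC t * (b - a))%C)) ->
  (forall t, 0 <= t <= 1 -> Cmod (dF (a + RtoC t * (b - a))%C) <= M) ->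
  Cmod (F b - F a)%C <= M * Cmod (b - a)%C.
Proof.
  intros HF HM.
  set (y := fun t : R => F (a + RtoC t * (b - a))%C).
  replace (F b) with (y 1) by (unfold y; f_equal; ring).
  replace (F a) with (y 0) by (unfold y; f_equal; ring).
  replace (M * Cmod (b - a)) with (M * Cmod (b - a) * 1 - M * Cmod (b - a) * 0) by ring.
  apply (mean_value_inequality y (fun t => dF (a + RtoC t * (b - a)) * (b - a))%C
    (fun t => M * Cmod (b - a) * t) (fun _ => M * Cmod (b - a))); [lra| | |].
  - intros t Ht. apply (cderiv_pderiv F (fun t => a + RtoC t * (b - a))%C).
    + apply HF, Ht.
    + apply pderiv_segment.
  - intros t _. auto_derive; [exact I|ring].
  - intros t Ht. rewrite Cmod_mult. apply Rmult_le_compat_r; [apply Cmod_ge_0|]. apply HM, Ht.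
Qed.

Lemma pderiv_Cexp_segment (a k : C) (t : R) :
  pderiv (fun s => Cexp (a + RtoC s * k)) t (k * Cexp (a + RtoC t * k))%C.
Proof.
  destruct a as [a1 a2], k as [k1 k2]. apply pderiv_components.
  unfold Cexp, Re, Im; simpl. split; (auto_derive; [exact I|unfold Rminus; ring]).
Qed.

(** The mean value inequality on the segment from 0 to k is used twice: first for |e^k - 1| <= e
    |k|, then, with this as a bound of the derivative, for |e^k - 1 - k| <= e |k|^2. The functional
    equation carries the estimate from 0 to a. *)
Lemma cderiv_Cexp (a : C) : cderiv Cexp a (Cexp a).
Proof.
  assert (H1 : forall k : C, Cmod k <= 1 -> Cmod (Cexp k - 1)%C <= exp 1 * Cmod k).
  { intros k Hk.
    replace (Cexp k) with (Cexp (0 + RtoC 1 * k)) by (f_equal; ring).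
    replace (RtoC 1) with (Cexp (0 + RtoC 0 * k)) at 2
      by (rewrite <- Cexp_0; f_equal; ring).
    replace (exp 1 * Cmod k) with (exp 1 * Cmod k * 1 - exp 1 * Cmod k * 0) by ring.
    apply (mean_value_inequality (fun s => Cexp (0 + RtoC s * k))
      (fun t => k * Cexp (0 + RtoC t * k))%C
      (fun t => exp 1 * Cmod k * t) (fun _ => exp 1 * Cmod k)); [lra| | |].
    - intros t _. apply pderiv_Cexp_segment.
    - intros t _. auto_derive; [exact I|ring].
    - intros t Ht. rewrite Cmod_mult, Cmod_Cexp, Rmult_comm.
      apply Rmult_le_compat_r; [apply Cmod_ge_0|].
      assert (Re (0 + RtoC t * k) <= 1).
      { eapply Rle_trans; [apply Rle_abs|]. eapply Rle_trans; [apply re_le_Cmod|].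
        rewrite Cplus_0_l, Cmod_mult, Cmod_R, Rabs_pos_eq by lra.
        generalize (Cmod_ge_0 k). nra. }
      apply exp_le_compat, H. }
  assert (H2 : forall k : C, Cmod k <= 1 -> Cmod (Cexp k - 1 - k)%C <= exp 1 * Cmod k * Cmod k).
  { intros k Hk.
    set (y := fun s : R => (Cexp (0 + RtoC s * k) - (1 + RtoC s * k))%C).
    replace (Cexp k - 1 - k)%C with (y 1 - y 0)%C.
    2:{ unfold y. replace (0 + 1 * k)%C with k by ring.
        replace (0 + 0 * k)%C with (RtoC 0) by ring. rewrite Cexp_0. ring. }
    replace (exp 1 * Cmod k * Cmod k) with (exp 1 * Cmod k * Cmod k * 1 - exp 1 * Cmod k * Cmod k * 0) by ring.
    apply (mean_value_inequality y
      (fun t => k * Cexp (0 + RtoC t * k) - k)%C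
      (fun t => exp 1 * Cmod k * Cmod k * t) (fun _ => exp 1 * Cmod k * Cmod k)); [lra| | |].
    - intros t _. unfold y. apply (is_derive_minus (K := R_AbsRing) (V := C_R_NormedModule)).
      + apply pderiv_Cexp_segment.
      + apply pderiv_segment.
    - intros t _. auto_derive; [exact I|ring].
    - intros t Ht.
      replace (k * Cexp (0 + t * k) - k)%C with (k * (Cexp (t * k) - 1))%C
        by (rewrite Cplus_0_l; ring).
      assert (Hm : Cmod (RtoC t * k) <= Cmod k).
      { rewrite Cmod_mult, Cmod_R, Rabs_pos_eq by lra. generalize (Cmod_ge_0 k). nra. }
      rewrite Cmod_mult. generalize (H1 (RtoC t * k)%C ltac:(lra)) (Cmod_ge_0 k) (exp_pos 1). intros.
      rewrite (Rmult_comm (exp 1 * Cmod k)). apply Rmult_le_compat_l; [apply Cmod_ge_0|]. nra. }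
  apply cderiv_iff. intros e He.
  set (A := exp 1 * Cmod (Cexp a)).
  assert (HA : 0 < A).
  { apply Rmult_lt_0_compat; [apply exp_pos|]. apply Cmod_gt_0, Cexp_neq_0. }
  exists (Rmin 1 (e / A)). split; [apply Rmin_pos; [lra|apply Rdiv_lt_0_compat; lra]|].
  intros y Hy.
  assert (Hy1 : Cmod (y - a) <= 1) by (left; exact (Rlt_Rmin_l _ _ _ Hy)).
  assert (Hy2 : A * Cmod (y - a) <= e).
  { replace e with (A * (e / A)) by (field; lra). apply Rmult_le_compat_l; [lra|].
    left; exact (Rlt_Rmin_r _ _ _ Hy). }
  replace (Cexp y) with (Cexp a * Cexp (y - a))%C by (rewrite <- Cexp_plus; f_equal; ring).
  replace (Cexp a * Cexp (y - a) - Cexp a - (y - a) * Cexp a)%C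
    with (Cexp a * (Cexp (y - a) - 1 - (y - a)))%C by ring.
  rewrite Cmod_mult. specialize (H2 _ Hy1).
  generalize (Cmod_ge_0 (Cexp a)) (Cmod_ge_0 (y - a)). intros.
  apply Rle_trans with (Cmod (Cexp a) * (exp 1 * Cmod (y - a) * Cmod (y - a))).
  - apply Rmult_le_compat_l; assumption.
  - replace (Cmod (Cexp a) * (exp 1 * Cmod (y - a) * Cmod (y - a)))
      with (A * Cmod (y - a) * Cmod (y - a)) by (unfold A; ring).
    apply Rmult_le_compat_r; assumption.
Qed.

(** * The principal logarithm *)

Lemma Re_div_Cmod_bound (w : C) : w <> 0 -> -1 <= Re w / Cmod w <= 1.
Proof.
  intros Hw. assert (H : 0 < Cmod w) by (apply Cmod_gt_0, Hw).
  generalize (re_le_Cmod w). intros H1. apply Rabs_le_between in H1.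
  split; [apply Rle_div_r|apply Rle_div_l]; lra.
Qed.

Lemma Carg_bound (w : C) : w <> 0 -> - PI <= Carg w <= PI.
Proof.
  intros Hw. generalize (acos_bound (Re w / Cmod w)) PI_RGT_0. intros.
  unfold Carg. destruct (Rlt_dec (Im w) 0); lra.
Qed.

Lemma Cexp_Log (w : C) : w <> 0 -> Cexp (Log w) = w.
Proof.
  intros Hw. assert (H : 0 < Cmod w) by (apply Cmod_gt_0, Hw).
  assert (Hb := Re_div_Cmod_bound w Hw).
  assert (Hsq : Cmod w * sqrt (1 - (Re w / Cmod w)²) = Rabs (Im w)).
  { rewrite <- (sqrt_pow2 (Cmod w)) at 1 by lra. rewrite <- sqrt_mult_alt by nra.
    rewrite <- sqrt_Rsqr_abs. f_equal.
    transitivity (Cmod w ^ 2 - Re w ^ 2); [unfold Rsqr; field; lra|].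
    rewrite Cmod2_alt. unfold Rsqr. ring. }
  unfold Cexp, Log; simpl. rewrite exp_ln by exact H.
  assert (Hcos : Cmod w * (Re w / Cmod w) = Re w) by (field; lra).
  unfold Carg. destruct w as [a b]. unfold Re, Im in *. simpl in *.
  destruct (Rlt_dec b 0) as [Hb0|Hb0].
  - rewrite cos_neg, sin_neg, cos_acos, sin_acos by exact Hb.
    rewrite Rabs_left in Hsq by exact Hb0. f_equal; lra.
  - rewrite cos_acos, sin_acos by exact Hb.
    rewrite Rabs_pos_eq in Hsq by lra. f_equal; lra.
Qed.

Lemma Log_Cexp (w : C) : - PI < Im w <= PI -> Log (Cexp w) = w.
Proof.
  intros Hw. unfold Log. rewrite Cmod_Cexp, ln_exp. destruct w as [a b].
  unfold Carg. rewrite Cmod_Cexp. unfold Cexp, Re, Im in *; simpl in *.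
  assert (Ha := exp_pos a).
  replace (exp a * cos b / exp a) with (cos b) by (field; lra).
  f_equal. destruct (Rlt_dec (exp a * sin b) 0) as [Hs|Hs].
  - assert (b < 0).
    { apply Rnot_le_lt. intros Hb. assert (0 <= sin b) by (apply sin_ge_0; lra). nra. }
    rewrite <- cos_neg, acos_cos by lra. ring.
  - assert (0 <= b).
    { apply Rnot_lt_le. intros Hb. assert (0 < sin (- b)) by (apply sin_gt_0; lra).
      rewrite sin_neg in *. nra. }
    apply acos_cos. lra.
Qed.

Lemma Log_unique (w y : C) : - PI < Im w <= PI -> Cexp w = y -> Log y = w.
Proof. intros Hw <-. apply Log_Cexp, Hw. Qed.

Lemma Cexp_Im (w : C) : Im (Cexp w) = exp (Re w) * sin (Im w).
Proof. reflexivity. Qed.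

Lemma Cexp_Re (w : C) : Re (Cexp w) = exp (Re w) * cos (Im w).
Proof. reflexivity. Qed.

Definition slit (w : C) : Prop := 0 < Re w \/ Im w <> 0.

Lemma slit_neq_0 (w : C) : slit w -> w <> 0.
Proof. intros [H|H] ->; simpl in H; lra. Qed.

Lemma Carg_slit (w : C) : slit w -> - PI < Carg w < PI.
Proof.
  intros Hw. assert (H0 := slit_neq_0 w Hw).
  assert (Hb := Carg_bound w H0). assert (He := Cexp_Log w H0).
  assert (Hr := Cexp_Re (Log w)). assert (Hi := Cexp_Im (Log w)). rewrite He in Hr, Hi.
  change (Im (Log w)) with (Carg w) in *. assert (Hp := exp_pos (Re (Log w))).
  assert (H : Carg w <> PI /\ Carg w <> - PI).
  { split; intros E; rewrite E in *; rewrite ?cos_neg, ?sin_neg, cos_PI, sin_PI in *;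
    destruct Hw; lra. }
  lra.
Qed.

Lemma Carg_Im_neg (w : C) : Im w < 0 -> - PI < Carg w < 0.
Proof.
  intros Hw. assert (Hs : slit w) by (right; lra).
  assert (Hb := Carg_slit w Hs). split; [lra|]. apply Rnot_le_lt. intros H.
  assert (Hi := Cexp_Im (Log w)). rewrite Cexp_Log in Hi by (apply slit_neq_0, Hs).
  change (Im (Log w)) with (Carg w) in *. assert (Hp := exp_pos (Re (Log w))).
  assert (0 <= sin (Carg w)) by (apply sin_ge_0; lra). nra.
Qed.

Lemma Cexp_Ci_PI : Cexp (Ci * PI) = (- (1))%C.
Proof.
  unfold Cexp, Ci, Re, Im; simpl.
  replace (0 * PI - 1 * 0) with 0 by ring. replace (0 * 0 + 1 * PI) with PI by ring.
  rewrite exp_0, cos_PI, sin_PI. apply injective_projections; simpl; ring.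
Qed.

(** The argument of -w lies in (-PI, 0), so adding PI stays in the principal range. This identity
    compares a logarithm cut upwards with one cut downwards. *)
Lemma Log_opp_pos (w : C) : 0 < Im w -> Log w = (Log (- w) + Ci * PI)%C.
Proof.
  intros Hw. assert (Hn : Im (- w) < 0) by (destruct w; simpl in *; lra).
  assert (Hb := Carg_Im_neg _ Hn). apply Log_unique.
  - replace (Im (Log (- w) + Ci * PI)%C) with (Carg (- w) + PI) by (unfold Im, Log; simpl; ring). lra.
  - rewrite Cexp_plus, Cexp_Log, Cexp_Ci_PI; [ring|]. apply slit_neq_0. right. lra.
Qed.

Lemma Log_opp_neg (w : C) : Im w < 0 -> Log w = (Log (- w) - Ci * PI)%C.
Proof.
  intros Hw. rewrite (Log_opp_pos (- w)%C) by (destruct w; simpl in *; lra).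
  replace (- - w)%C with w by ring. ring.
Qed.

Lemma Log_1 : Log 1 = RtoC 0.
Proof. apply Log_unique; [simpl; generalize PI_RGT_0; lra|apply Cexp_0]. Qed.

Lemma Carg_small (e : R) : 0 < e -> exists d : R, 0 < d /\ forall k : C,
  Cmod k < d -> Rabs (Carg (1 + k)%C) < e.
Proof.
  intros He. set (e' := Rmin e (PI / 2)).
  assert (HPI := PI_RGT_0).
  assert (He' : 0 < e') by (apply Rmin_pos; lra).
  assert (He2 : e' <= PI / 2) by apply Rmin_r.
  assert (Hse : 0 < sin e') by (apply sin_gt_0; lra).
  (* With |k| < 1/2 the modulus [rho] of 1 + k exceeds 1/2, so the sine of its argument, Im k /
     [rho], is below (sin e')/2 in absolute value; on (-PI/2, PI/2) the sine is increasing. *)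
  exists (Rmin (1 / 2) (sin e' / 4)). split; [apply Rmin_pos; lra|].
  intros k Hk.
  destruct (Rmin_Rgt_l _ _ _ Hk) as [Hk1 Hk2].
  assert (Hre := re_le_Cmod k). assert (Him := im_le_Cmod k).
  apply Rabs_le_between in Hre, Him.
  assert (H1 : 1 / 2 < Re (1 + k)) by (destruct k; simpl in *; lra).
  assert (H2 : Im (1 + k) = Im k) by (unfold Im; simpl; ring).
  assert (Hs : slit (1 + k)) by (left; lra).
  assert (Hb := Carg_slit _ Hs).
  assert (Hr := Cexp_Re (Log (1 + k))). assert (Hi := Cexp_Im (Log (1 + k))).
  rewrite Cexp_Log in Hr, Hi by (apply slit_neq_0, Hs).
  change (Im (Log (1 + k))) with (Carg (1 + k)) in *.
  set (th := Carg (1 + k)%C) in *. set (rho := exp (Re (Log (1 + k)))) in *.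
  assert (Hp : 0 < rho) by apply exp_pos. rewrite H2 in Hi.
  assert (Hc : 0 < cos th) by nra.
  assert (Hth : - (PI / 2) < th < PI / 2).
  { split; apply Rnot_le_lt; intros H.
    - assert (cos (- th) <= 0) by (apply cos_le_0; lra). rewrite cos_neg in *. lra.
    - assert (cos th <= 0) by (apply cos_le_0; lra). lra. }
  assert (Hrho : 1 / 2 < rho) by (generalize (COS_bound th); nra).
  apply Rlt_le_trans with e'; [|apply Rmin_l].
  apply Rabs_def1; apply Rnot_le_lt; intros H.
  - assert (sin e' <= sin th) by (apply sin_incr_1; lra). nra.
  - assert (sin e' <= sin (- th)) by (apply sin_incr_1; lra). rewrite sin_neg in *. nra.
Qed.

Lemma Log_small (e : R) : 0 < e -> exists d : R, 0 < d /\ forall k : C,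
  Cmod k < d -> Cmod (Log (1 + k)%C) < e.
Proof.
  intros He.
  destruct (Carg_small (e / 2)) as [d1 [Hd1 H1]]; [lra|].
  assert (Hln : exists d2, 0 < d2 /\ forall x, Rabs (x - 1) < d2 -> Rabs (ln x) < e / 2).
  { assert (Hc := continuous_ln 1 Rlt_0_1).
    destruct (proj1 (filterlim_locally _ _) Hc (mkposreal (e / 2) ltac:(lra))) as [d Hd].
    exists d. split; [apply cond_pos|]. intros x Hx. generalize (Hd x Hx). rewrite ln_1.
    change (Rabs (ln x - 0) < e / 2 -> Rabs (ln x) < e / 2). rewrite Rminus_0_r. auto. }
  destruct Hln as [d2 [Hd2 H2]].
  exists (Rmin d1 d2). split; [apply Rmin_pos; lra|]. intros k Hk.
  eapply Rle_lt_trans; [apply Cmod_le_sum|].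
  assert (Rabs (Carg (1 + k)%C) < e / 2)
    by (apply H1; exact (Rlt_Rmin_l _ _ _ Hk)).
  assert (Rabs (ln (Cmod (1 + k)%C)) < e / 2).
  { apply H2. eapply Rle_lt_trans; [|exact (Rlt_Rmin_r _ _ _ Hk)].
    apply Rabs_le_between.
    generalize (Cmod_triangle 1 k) (Cmod_triangle_sub 1 (- k)%C). rewrite Cmod_1, Cmod_opp.
    replace (1 - - k)%C with (1 + k)%C by ring. lra. }
  change (Rabs (ln (Cmod (1 + k)%C)) + Rabs (Carg (1 + k)%C) < e). lra.
Qed.

Lemma Log_mult (w k : C) : w <> 0 -> (1 + k)%C <> 0 ->
  - PI < Carg w + Carg (1 + k)%C < PI -> Log (w * (1 + k))%C = (Log w + Log (1 + k))%C.
Proof.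
  intros Hw Hk Hb. apply Log_unique.
  - change (- PI < Carg w + Carg (1 + k)%C <= PI). lra.
  - rewrite Cexp_plus, !Cexp_Log by assumption. reflexivity.
Qed.

(** Inverse function argument: with u = Log y and k = y - 1, differentiability of [Cexp] at 0 gives
    |k - u| <= e' |u|. As e' <= 1/2, this yields |u| <= 2 |k| and then |u - k| <= 2 e' |k|. *)
Lemma cderiv_Log_1 : cderiv Log 1 1.
Proof.
  apply cderiv_iff. intros e He.
  set (e' := Rmin (1 / 2) (e / 2)).
  assert (He' : 0 < e') by (apply Rmin_pos; lra).
  assert (He1 : e' <= 1 / 2) by apply Rmin_l. assert (He2 : e' <= e / 2) by apply Rmin_r.
  destruct (proj1 (cderiv_iff _ _ _) (cderiv_Cexp 0) e' He') as [d [Hd H]].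
  destruct (Log_small d Hd) as [d' [Hd' H']].
  exists (Rmin d' 1). split; [apply Rmin_pos; lra|]. intros y Hy.
  destruct (Rmin_Rgt_l _ _ _ Hy) as [Hy1 Hy2].
  assert (Hy0 : y <> 0).
  { intros ->. replace (0 - 1)%C with (- (1))%C in Hy2 by ring. rewrite Cmod_m1 in Hy2. lra. }
  specialize (H' _ Hy1). replace (1 + (y - 1))%C with y in H' by ring.
  specialize (H (Log y)). rewrite Cexp_0, Cexp_Log, Log_1 in * by exact Hy0.
  replace (Log y - 0)%C with (Log y) in * by ring.
  specialize (H H'). rewrite !Cmult_1_r in *.
  set (u := Log y) in *. set (k := (y - 1)%C) in *.
  rewrite Cmod_sub_sym in H.
  assert (Cmod u <= 2 * Cmod k).
  { generalize (Cmod_triangle_sub u k) (Cmod_ge_0 u). nra. }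
  generalize (Cmod_ge_0 u) (Cmod_ge_0 k). nra.
Qed.

(** Near w one has Log y = Log w + Log (y / w), which moves the question to the point 1. The radius
    keeps the argument of y / w below [b], the distance of the argument of w from PI and -PI, so
    that the sum remains principal. *)
Lemma cderiv_Log (w : C) : slit w -> cderiv Log w (/ w)%C.
Proof.
  intros Hw. assert (H0 := slit_neq_0 w Hw). assert (Hb := Carg_slit w Hw).
  assert (Hm : 0 < Cmod w) by (apply Cmod_gt_0, H0).
  set (b := Rmin (PI - Carg w) (Carg w + PI)).
  destruct (Carg_small b) as [d [Hd H]]; [apply Rmin_pos; lra|].
  apply (cderiv_ext_loc (fun y => Log w + Log (/ w * y))%C Log w _ (Rmin 1 d * Cmod w)).
  - apply Rmult_lt_0_compat; [apply Rmin_pos; lra|exact Hm].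
  - intros y Hy. set (k := (/ w * y - 1)%C).
    assert (Hk : Cmod k < Rmin 1 d).
    { replace k with ((y - w) / w)%C by (unfold k; field; exact H0).
      rewrite Cmod_div by exact H0. apply Rlt_div_l; assumption. }
    destruct (Rmin_Rgt_l _ _ _ Hk) as [Hk1 Hk2].
    replace (/ w * y)%C with (1 + k)%C by (unfold k; ring).
    transitivity (Log (w * (1 + k))%C); [|f_equal; unfold k; field; exact H0].
    symmetry. apply Log_mult; [exact H0| |].
    + intros E. apply (f_equal (fun v => Cmod (v - 1))) in E.
      replace (1 + k - 1)%C with k in E by ring. replace (0 - 1)%C with (- (1))%C in E by ring.
      rewrite Cmod_m1 in E. lra.
    + specialize (H k Hk2). apply Rabs_def2 in H. unfold b in H.
      generalize (Rmin_l (PI - Carg w) (Carg w + PI)) (Rmin_r (PI - Carg w) (Carg w + PI)). lra.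
  - eapply cderiv_eq.
    + apply cderiv_plus; [apply cderiv_const|].
      apply (cderiv_comp Log (fun y => / w * y)%C).
      * replace (/ w * w)%C with (RtoC 1) by (field; exact H0). apply cderiv_Log_1.
      * apply cderiv_mult; [apply cderiv_const|apply cderiv_id].
    + cbv beta. ring.
Qed.

(** * Primitives on star-shaped sets *)

Lemma filterlim_Cplus {T : Type} (L : (T -> Prop) -> Prop) {FF : Filter L} (phi psi : T -> C) (l m : C) :
  filterlim phi L (locally (T := C_UniformSpace) l) ->
  filterlim psi L (locally (T := C_UniformSpace) m) ->
  filterlim (fun t => (phi t + psi t)%C) L (locally (T := C_UniformSpace) (l + m)%C).
Proof.
  intros H1 H2. apply (clim_iff L). intros e He.
  assert (He2 : 0 < e / 2) by lra.
  generalize (filter_and _ _ (proj1 (clim_iff L phi l) H1 _ He2)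
                (proj1 (clim_iff L psi m) H2 _ He2)).
  apply filter_imp. intros t [Ha Hb].
  replace (phi t + psi t - (l + m))%C with ((phi t - l) + (psi t - m))%C by ring.
  eapply Rle_lt_trans; [apply Cmod_triangle|]. lra.
Qed.

Lemma filterlim_Cconst {T : Type} (L : (T -> Prop) -> Prop) {FF : Filter L} (l : C) :
  filterlim (fun _ : T => l) L (locally (T := C_UniformSpace) l).
Proof. apply (clim_iff L). intros e He. apply filter_forall. intros _.
  replace (l - l)%C with (RtoC 0) by ring. rewrite Cmod_0. exact He.
Qed.

Lemma filterlim_RtoC {T : Type} (L : (T -> Prop) -> Prop) {FF : Filter L} (phi : T -> R) (l : R) :
  filterlim phi L (locally l) ->
  filterlim (fun t => RtoC (phi t)) L (locally (T := C_UniformSpace) (RtoC l)).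
Proof.
  intros H. apply (clim_iff L). intros e He.
  generalize (H _ (locally_ball l (mkposreal e He))). unfold filtermap. apply filter_imp.
  intros t Ht. rewrite <- RtoC_minus, Cmod_R. exact Ht.
Qed.

Section StarShaped.
Variables (D : C -> Prop) (w : C) (g dg : C -> C).
Hypothesis D_open : forall x, D x -> exists r, 0 < r /\ forall y, Cmod (y - x)%C < r -> D y.
Hypothesis D_star : forall x t, D x -> 0 <= t <= 1 -> D (w + RtoC t * (x - w))%C.
Hypothesis g_deriv : forall x, D x -> cderiv g x (dg x).
Hypothesis dg_cont : forall x, D x -> ccont dg x.

(** The integral of [g] along the segment from w to x, taken by components. It is differentiated
    under the integral sign, hence the continuous derivative [dg] in the hypotheses. *)
Let F (x : C) : C :=
  (RInt (fun t => Re (g (w + RtoC t * (x - w)) * (x - w))%C) 0 1,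
   RInt (fun t => Im (g (w + RtoC t * (x - w)) * (x - w))%C) 0 1).

Section Direction.
Variables (x k : C).
Let base (u v : R) : C := (w + RtoC v * (x + RtoC u * k - w))%C.
Let p (u v : R) : C := (g (base u v) * (x + RtoC u * k - w))%C.
(* q is the derivative of p in u, and also that of v * g (base u v) * k in v; hence the
   integral of p over v in [0, 1] has derivative g (x + u k) k in u. *)
Let q (u v : R) : C := (dg (base u v) * (RtoC v * k) * (x + RtoC u * k - w) + g (base u v) * k)%C.

Lemma star_base_cont (s t : R) :
  filterlim (fun z : R * R => base (fst z) (snd z)) (locally (s, t))
    (locally (T := C_UniformSpace) (base s t)).
Proof.
  unfold base, Cminus.
  assert (H1 : filterlim (fun z : R * R => RtoC (fst z)) (locally (s, t))
    (locally (T := C_UniformSpace) (RtoC s))).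
  { apply (filterlim_RtoC (locally (s, t))). apply (continuous_fst (U := R_UniformSpace) (V := R_UniformSpace) s t). }
  assert (H2 : filterlim (fun z : R * R => RtoC (snd z)) (locally (s, t))
    (locally (T := C_UniformSpace) (RtoC t))).
  { apply (filterlim_RtoC (locally (s, t))). apply (continuous_snd (U := R_UniformSpace) (V := R_UniformSpace) s t). }
  assert (H0 : filterlim (fun z : R * R => (x + RtoC (fst z) * k + - w)%C) (locally (s, t))
    (locally (T := C_UniformSpace) (x + RtoC s * k + - w)%C)).
  { apply (filterlim_Cplus (locally (s, t))); [|apply (filterlim_Cconst (locally (s, t)))].
    apply (filterlim_Cplus (locally (s, t))); [apply (filterlim_Cconst (locally (s, t)))|].
    apply (filterlim_Cmult (locally (s, t))); [exact H1|apply (filterlim_Cconst (locally (s, t)))]. }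
  apply (filterlim_Cplus (locally (s, t))); [apply (filterlim_Cconst (locally (s, t)))|].
  apply (filterlim_Cmult (locally (s, t))); [exact H2|exact H0].
Qed.

Lemma star_base_near (s t : R) : D (base s t) ->
  locally (s, t) (fun z : R * R => D (base (fst z) (snd z))).
Proof.
  intros HD. destruct (D_open _ HD) as [r [Hr H]].
  generalize (proj1 (clim_iff _ _ _) (star_base_cont s t) r Hr). apply filter_imp.
  intros z Hz. apply H, Hz.
Qed.

Lemma star_dp_cont (s t : R) : D (base s t) ->
  filterlim (fun z : R * R => q (fst z) (snd z)) (locally (s, t))
    (locally (T := C_UniformSpace) (q s t)).
Proof.
  intros HD. unfold q, Cminus.
  assert (H1 : filterlim (fun z : R * R => RtoC (fst z)) (locally (s, t))
    (locally (T := C_UniformSpace) (RtoC s))).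
  { apply (filterlim_RtoC (locally (s, t))). apply (continuous_fst (U := R_UniformSpace) (V := R_UniformSpace) s t). }
  assert (H2 : filterlim (fun z : R * R => RtoC (snd z)) (locally (s, t))
    (locally (T := C_UniformSpace) (RtoC t))).
  { apply (filterlim_RtoC (locally (s, t))). apply (continuous_snd (U := R_UniformSpace) (V := R_UniformSpace) s t). }
  assert (H3 : filterlim (fun z : R * R => dg (base (fst z) (snd z))) (locally (s, t))
    (locally (T := C_UniformSpace) (dg (base s t)))).
  { apply (ccont_filterlim dg (base s t) (locally (s, t))); [apply dg_cont, HD|apply star_base_cont]. }
  assert (H4 : filterlim (fun z : R * R => g (base (fst z) (snd z))) (locally (s, t))
    (locally (T := C_UniformSpace) (g (base s t)))).
  { apply (ccont_filterlim g (base s t) (locally (s, t))); [eapply cderiv_ccont, g_deriv, HD|apply star_base_cont]. }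
  assert (H0 : filterlim (fun z : R * R => (x + RtoC (fst z) * k + - w)%C) (locally (s, t))
    (locally (T := C_UniformSpace) (x + RtoC s * k + - w)%C)).
  { apply (filterlim_Cplus (locally (s, t))); [|apply (filterlim_Cconst (locally (s, t)))].
    apply (filterlim_Cplus (locally (s, t))); [apply (filterlim_Cconst (locally (s, t)))|].
    apply (filterlim_Cmult (locally (s, t))); [exact H1|apply (filterlim_Cconst (locally (s, t)))]. }
  apply (filterlim_Cplus (locally (s, t))); [|apply (filterlim_Cmult (locally (s, t))); [exact H4|apply (filterlim_Cconst (locally (s, t)))]].
  apply (filterlim_Cmult (locally (s, t))); [|exact H0].
  apply (filterlim_Cmult (locally (s, t))); [exact H3|].
  apply (filterlim_Cmult (locally (s, t))); [exact H2|apply (filterlim_Cconst (locally (s, t)))].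
Qed.

Lemma star_p_deriv (s t : R) : D (base s t) -> pderiv (fun u => p u t) s (q s t).
Proof.
  intros HD.
  assert (H : cderiv (fun y => g (w + RtoC t * (y - w)) * (y - w))%C (x + RtoC s * k)%C
    (dg (base s t) * RtoC t * (x + RtoC s * k - w) + g (base s t))%C).
  { eapply cderiv_eq.
    - apply cderiv_mult.
      + apply (cderiv_comp g (fun y => w + RtoC t * (y - w))%C); [apply g_deriv, HD|].
        apply cderiv_plus; [apply cderiv_const|]. apply cderiv_mult; [apply cderiv_const|].
        apply cderiv_minus; [apply cderiv_id|apply cderiv_const].
      + apply cderiv_minus; [apply cderiv_id|apply cderiv_const].
    - cbv beta. fold (base s t). ring. }
  replace (q s t) with ((dg (base s t) * RtoC t * (x + RtoC s * k - w) + g (base s t)) * k)%C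
    by (unfold q; ring).
  apply (cderiv_pderiv _ (fun u => x + RtoC u * k)%C s _ _ H). apply pderiv_segment.
Qed.

Lemma star_dp_primitive (s t : R) : D (base s t) ->
  pderiv (fun v => RtoC v * g (base s v) * k)%C t (q s t).
Proof.
  intros HD. set (y := (x + RtoC s * k - w)%C).
  (* For y <> 0 the function is a holomorphic function of b = [base s v], namely (b - w) / y * g b *
     k; for y = 0 the segment shrinks to the point w and the dependence on v is linear. *)
  destruct (classic (y = 0)) as [Hy|Hy].
  - replace (q s t) with (g w * k)%C.
    2:{ unfold q, base. fold y. rewrite Hy. replace (w + RtoC t * 0)%C with w by ring. ring. }
    apply (is_derive_ext (K := R_AbsRing) (V := C_R_NormedModule) (fun v => 0 + RtoC v * (g w * k))%C).
    + intros v. unfold base. fold y. rewrite Hy. replace (w + RtoC v * 0)%C with w by ring.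
      change ((0 + RtoC v * (g w * k))%C = (RtoC v * g w * k)%C). ring.
    + apply pderiv_segment.
  - assert (H : cderiv (fun b => (b - w) / y * g b * k)%C (base s t)
      (g (base s t) / y * k + RtoC t * dg (base s t) * k)%C).
    { eapply cderiv_eq.
      - apply cderiv_mult; [|apply cderiv_const]. apply cderiv_mult; [|apply g_deriv, HD].
        apply cderiv_mult; [|apply cderiv_const].
        apply cderiv_minus; [apply cderiv_id|apply cderiv_const].
      - cbv beta. unfold Cdiv. replace (base s t - w)%C with (RtoC t * y)%C by (unfold base; fold y; ring).
        field. exact Hy. }
    apply (is_derive_ext (K := R_AbsRing) (V := C_R_NormedModule)
      (fun v => (base s v - w) / y * g (base s v) * k)%C).
    + intros v. replace (base s v - w)%C with (RtoC v * y)%C by (unfold base; fold y; ring).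
      change ((RtoC v * y / y * g (base s v) * k)%C = (RtoC v * g (base s v) * k)%C).
      field. exact Hy.
    + replace (q s t) with ((g (base s t) / y * k + RtoC t * dg (base s t) * k) * y)%C.
      2:{ unfold q. fold y. field. exact Hy. }
      apply (cderiv_pderiv _ (fun v => base s v) t _ _ H). apply pderiv_segment.
Qed.

(** [pi] stands for Re or Im, since differentiation under the integral sign is applied to real
    integrands. The derivative is an integral of [q], which telescopes by [star_dp_primitive]. *)
Lemma star_integral_deriv (pi : C -> R) (s : R)
  (pi_lim : forall (L : (R * R -> Prop) -> Prop) (FF : Filter L) (phi : R * R -> C) l,
    filterlim phi L (locally (T := C_UniformSpace) l) -> filterlim (fun t => pi (phi t)) L (locally (pi l)))
  (pi_deriv : forall phi t l, pderiv phi t l -> is_derive (fun s => pi (phi s)) t (pi l)) :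
  (exists d, 0 < d /\ forall u, Rabs (u - s) < d -> D (x + RtoC u * k)%C) ->
  is_derive (fun u => RInt (fun v => pi (p u v)) 0 1) s (pi (g (x + RtoC s * k) * k)%C).
Proof.
  intros [d [Hd HD]].
  assert (HDb : forall u v, Rabs (u - s) < d -> 0 <= v <= 1 -> D (base u v)).
  { intros u v Hu Hv. apply D_star; [apply HD, Hu|exact Hv]. }
  assert (Hs : Rabs (s - s) < d) by (rewrite Rminus_diag, Rabs_R0; exact Hd).
  replace (pi (g (x + RtoC s * k) * k)%C) with
    (RInt (fun t => Derive (fun u => pi (p u t)) s) 0 1).
  - apply (is_derive_RInt_param (fun u v => pi (p u v))).
    + exists (mkposreal d Hd). intros u Hu t Ht. rewrite Rmin_left, Rmax_right in Ht by lra.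
      exists (pi (q u t)). apply pi_deriv, star_p_deriv, HDb; assumption.
    + intros t Ht. rewrite Rmin_left, Rmax_right in Ht by lra.
      assert (Hst := HDb s t Hs Ht).
      apply (continuity_2d_pt_ext_loc (fun u v => pi (q u v))).
      * destruct (star_base_near s t Hst) as [r Hr]. exists r. intros u v Hu Hv.
        symmetry. apply is_derive_unique, pi_deriv, star_p_deriv.
        apply (Hr (u, v)). split; assumption.
      * apply continuity_2d_pt_filterlim. apply (pi_lim _ _ (fun z => q (fst z) (snd z))), star_dp_cont, Hst.
    + exists (mkposreal d Hd). intros u Hu. apply (ex_RInt_continuous (V := R_CompleteNormedModule)).
      intros t Ht. rewrite Rmin_left, Rmax_right in Ht by lra.
      apply (ex_derive_continuous (K := R_AbsRing) (V := R_NormedModule)).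
      assert (Hut := HDb u t Hu Ht).
      exists (pi (dg (base u t) * (x + RtoC u * k - w) * (x + RtoC u * k - w))%C).
      apply pi_deriv. unfold p.
      apply (cderiv_pderiv (fun b => g b * (x + RtoC u * k - w))%C (fun v => base u v)).
      * eapply cderiv_eq; [apply cderiv_mult; [apply g_deriv, Hut|apply cderiv_const]|].
        cbv beta; ring.
      * apply pderiv_segment.
  - transitivity (RInt (fun t => pi (q s t)) 0 1).
    + apply RInt_ext. intros t Ht. rewrite Rmin_left, Rmax_right in Ht by lra.
      apply is_derive_unique, pi_deriv, star_p_deriv, HDb; [exact Hs|lra].
    + apply is_RInt_unique.
      replace (pi (g (x + RtoC s * k) * k)%C) with
        (minus (pi (RtoC 1 * g (base s 1) * k)%C) (pi (RtoC 0 * g (base s 0) * k)%C)).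
      * apply (is_RInt_derive (V := R_CompleteNormedModule) (fun v => pi (RtoC v * g (base s v) * k)%C) (fun t => pi (q s t))).
        -- intros t Ht. rewrite Rmin_left, Rmax_right in Ht by lra.
           apply pi_deriv, star_dp_primitive, HDb; assumption.
        -- intros t Ht. rewrite Rmin_left, Rmax_right in Ht by lra.
           assert (H2 : continuity_2d_pt (fun u v => pi (q u v)) s t).
           { apply continuity_2d_pt_filterlim.
             apply (pi_lim _ _ (fun z => q (fst z) (snd z))), star_dp_cont, HDb; assumption. }
           apply continuity_pt_filterlim. intros e He.
           destruct (H2 (mkposreal e He)) as [r Hr]. exists r. split; [apply cond_pos|].
           intros v [_ Hv]. apply (Hr s v); [rewrite Rminus_diag, Rabs_R0; apply cond_pos|exact Hv].
      (* [pi] is known only through its two hypotheses; the second one, applied to a constant curve,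
         shows that it maps 0 to 0. *)
      * assert (E0 : pi (RtoC 0) = 0).
        { assert (Hz := pi_deriv (fun _ => RtoC 0) 0 (RtoC 0)).
          assert (Hz' : is_derive (fun _ : R => pi (RtoC 0)) 0 (pi (RtoC 0))).
          { apply Hz. apply (is_derive_const (K := R_AbsRing) (V := C_R_NormedModule)). }
          apply is_derive_unique in Hz'. rewrite Derive_const in Hz'. auto. }
        replace (RtoC 0 * g (base s 0) * k)%C with (RtoC 0) by ring. rewrite E0.
        unfold minus, plus, opp; simpl. rewrite Ropp_0, Rplus_0_r. f_equal.
        unfold base. rewrite Cmult_1_l. do 2 f_equal. ring.
Qed.
End Direction.

(** The derivative in every real direction k is g k. Subtracting s k g(x) along the segment from x
    to y leaves a curve whose speed is at most e |k| by continuity of g, and the mean value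
    inequality turns this into complex differentiability. *)
Lemma star_shaped_primitive : exists F : C -> C, forall x, D x -> cderiv F x (g x).
Proof.
  exists F. intros x HD. apply cderiv_iff. intros e He.
  destruct (D_open x HD) as [r [Hr HDr]].
  destruct (cderiv_ccont _ _ _ (g_deriv x HD) e He) as [d [Hd Hg]].
  (* Half the radius leaves room for all parameters |s| < 2, an open neighbourhood of [0, 1]. *)
  exists (Rmin (r / 2) d). split; [apply Rmin_pos; lra|]. intros y Hy.
  destruct (Rmin_Rgt_l _ _ _ Hy) as [Hy1 Hy2].
  set (k := (y - x)%C) in *.
  assert (HDs : forall s, Rabs s < 2 -> D (x + RtoC s * k)%C).
  { intros s Hs. apply HDr. replace (x + RtoC s * k - x)%C with (RtoC s * k)%C by ring.
    rewrite Cmod_mult, Cmod_R. generalize (Cmod_ge_0 k) (Rabs_pos s). nra. }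
  assert (HF : forall s, 0 <= s <= 1 ->
    pderiv (fun u => F (x + RtoC u * k)%C) s (g (x + RtoC s * k) * k)%C).
  { intros s Hs.
    assert (Hex : exists d, 0 < d /\ forall u, Rabs (u - s) < d -> D (x + RtoC u * k)%C).
    { exists 1. split; [lra|]. intros u Hu. apply HDs.
      apply Rabs_def2 in Hu. apply Rabs_def1; lra. }
    apply pderiv_components. split.
    - apply (star_integral_deriv x k Re s); [|intros; apply pderiv_components; assumption|exact Hex].
      intros; apply filterlim_Re; assumption.
    - apply (star_integral_deriv x k Im s); [|intros; apply pderiv_components; assumption|exact Hex].
      intros; apply filterlim_Im; assumption. }
  set (m := fun s : R => (F (x + RtoC s * k) - (0 + RtoC s * (k * g x)))%C).
  replace (F y - F x - k * g x)%C with (m 1 - m 0)%C.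
  2:{ unfold m. replace (x + 1 * k)%C with y by (unfold k; ring).
      replace (x + 0 * k)%C with x by ring. ring. }
  replace (e * Cmod k) with (e * Cmod k * 1 - e * Cmod k * 0) by ring.
  apply (mean_value_inequality m (fun s => g (x + RtoC s * k) * k - k * g x)%C
    (fun t => e * Cmod k * t) (fun _ => e * Cmod k)); [lra| | |].
  - intros s Hs. unfold m. apply (is_derive_minus (K := R_AbsRing) (V := C_R_NormedModule)).
    + apply HF, Hs.
    + apply pderiv_segment.
  - intros t _. auto_derive; [exact I|ring].
  - intros s Hs. replace (g (x + s * k) * k - k * g x)%C with ((g (x + s * k) - g x) * k)%C by ring.
    rewrite Cmod_mult. apply Rmult_le_compat_r; [apply Cmod_ge_0|]. left. apply Hg.
    replace (x + s * k - x)%C with (RtoC s * k)%C by ring.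
    rewrite Cmod_mult, Cmod_R, Rabs_pos_eq by lra. generalize (Cmod_ge_0 k). nra.
Qed.
End StarShaped.

(** * Integrals along paths *)

Notation clim phi L l := (filterlim phi L (locally (T := C_UniformSpace) l)).

Lemma pderiv_continuous (phi : R -> C) (t : R) (l : C) :
  pderiv phi t l -> clim phi (locally t) (phi t).
Proof.
  intros H. apply (ex_derive_continuous (K := R_AbsRing) (V := C_R_NormedModule)). exists l. exact H.
Qed.

Lemma filterlim_locally_left {T : UniformSpace} (phi : R -> T) (t : R) (l : T) :
  filterlim phi (locally t) (locally l) -> filterlim phi (at_left t) (locally l).
Proof. intros H. eapply filterlim_filter_le_1; [apply filter_le_within|exact H]. Qed.

Lemma filterlim_locally_right {T : UniformSpace} (phi : R -> T) (t : R) (l : T) :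
  filterlim phi (locally t) (locally l) -> filterlim phi (at_right t) (locally l).
Proof. intros H. eapply filterlim_filter_le_1; [apply filter_le_within|exact H]. Qed.

(** Only one-sided limits are assumed at the ends, because velocities jump at the breaks of a path
    and a contour may end at a singularity. [k] and [Phi] are replaced by continuous extensions; the
    extended [Phi] and the integral of the extended [k] have the same derivative inside. *)
Lemma is_RInt_smooth_interior (k Phi : R -> C) (s b : R) (A B : C) : s < b ->
  (forall t, s < t < b -> pderiv Phi t (k t) /\ clim k (locally t) (k t)) ->
  clim Phi (at_right s) A -> clim Phi (at_left b) B ->
  (exists l, clim k (at_right s) l) -> (exists l, clim k (at_left b) l) ->
  is_RInt (V := C_R_NormedModule) k s b (B - A)%C /\ ex_RInt (fun t => Cmod (k t)) s b.
Proof.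
  intros Hsb Hd HA HB [lk Hlk] [rk Hrk].
  destruct (C0_extension_lt (T := C_UniformSpace) k lk rk s b Hsb) as [k' [Ck' [Ek' _]]];
    [intros t Ht; apply Hd, Ht|exact Hlk|exact Hrk|].
  destruct (C0_extension_lt (T := C_UniformSpace) Phi A B s b Hsb) as [Phi' [CP [EP [EPs EPb]]]];
    [intros t Ht; eapply pderiv_continuous, Hd, Ht|exact HA|exact HB|].
  set (Psi := fun t => RInt (V := C_R_CompleteNormedModule) k' s t).
  assert (HPsi : forall t, is_RInt (V := C_R_NormedModule) k' s t (Psi t)).
  { intros t. apply (RInt_correct (V := C_R_CompleteNormedModule)).
    apply (ex_RInt_continuous (V := C_R_CompleteNormedModule)). intros u _. apply Ck'. }
  assert (DPsi : forall t, pderiv Psi t (k' t)).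
  { intros t. apply (is_derive_RInt (V := C_R_NormedModule) k' Psi s t); [|apply Ck'].
    apply filter_forall. exact HPsi. }
  assert (EPsi : forall pi : C -> R,
    (pi = Re \/ pi = Im) -> pi (Phi' b) - pi (Psi b) = pi (Phi' s) - pi (Psi s)).
  { intros pi Hpi.
    assert (pi_cont : forall phi t, clim phi (locally t) (phi t) -> continuity_pt (fun t => pi (phi t)) t).
    { intros phi t H. apply continuity_pt_filterlim.
      destruct Hpi; subst pi; [apply (filterlim_Re (locally t))|apply (filterlim_Im (locally t))]; exact H. }
    assert (pi_deriv : forall phi t l, pderiv phi t l -> is_derive (fun t => pi (phi t)) t (pi l)).
    { intros phi t l H. destruct Hpi; subst pi; apply pderiv_components, H. }
    destruct (MVT_gen (fun t => pi (Phi' t) - pi (Psi t)) s b (fun _ => 0)) as [c [_ Hc]].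
    - intros t Ht. rewrite Rmin_left, Rmax_right in Ht by lra.
      replace 0 with (pi (k t) - pi (k' t)) by (rewrite Ek' by exact Ht; ring).
      apply (is_derive_minus (K := R_AbsRing) (V := R_NormedModule)).
      + apply (is_derive_ext_loc (K := R_AbsRing) (V := R_NormedModule) (fun t => pi (Phi t))).
        * assert (Hr : 0 < Rmin (t - s) (b - t)) by (apply Rmin_pos; lra).
          exists (mkposreal _ Hr). intros u Hu. change (Rabs (u - t) < Rmin (t - s) (b - t)) in Hu.
          apply Rabs_def2 in Hu. generalize (Rmin_l (t - s) (b - t)) (Rmin_r (t - s) (b - t)).
          intros. rewrite EP by lra. reflexivity.
        * apply pi_deriv, Hd, Ht.
      + apply pi_deriv, DPsi.
    - intros t _. apply continuity_pt_minus.
      + apply pi_cont, CP.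
      + apply pi_cont. eapply pderiv_continuous, DPsi.
    - lra. }
  split.
  - apply (is_RInt_ext (V := C_R_NormedModule) k').
    { intros t Ht. rewrite Rmin_left, Rmax_right in Ht by lra. apply Ek', Ht. }
    replace (B - A)%C with (Psi b); [apply HPsi|].
    assert (Hz : Psi s = RtoC 0) by apply (RInt_point (V := C_R_CompleteNormedModule)).
    assert (H1 := EPsi Re (or_introl eq_refl)). assert (H2 := EPsi Im (or_intror eq_refl)).
    rewrite EPs, EPb, Hz in H1, H2. unfold Re, Im in *.
    apply injective_projections; simpl in *; lra.
  - apply (ex_RInt_ext (V := R_NormedModule) (fun t => Cmod (k' t))).
    { intros t Ht. rewrite Rmin_left, Rmax_right in Ht by lra. f_equal. apply Ek', Ht. }
    apply (ex_RInt_continuous (V := R_CompleteNormedModule)). intros t _.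
    apply (filterlim_Cmod (locally t)), Ck'.
Qed.

(** Induction on the breaks: the interval is split at each break inside it, and continuity of [Phi]
    there makes the end values telescope. A break outside is dropped. *)
Lemma is_RInt_piecewise (breaks : list R) : forall (k Phi : R -> C) (s b : R) (A B : C), s < b ->
  (forall t, s < t < b -> ~ In t breaks -> pderiv Phi t (k t) /\ clim k (locally t) (k t)) ->
  (forall t, s < t < b -> clim Phi (locally t) (Phi t)) ->
  (forall t, s < t < b -> (exists l, clim k (at_left t) l) /\ (exists l, clim k (at_right t) l)) ->
  clim Phi (at_right s) A -> clim Phi (at_left b) B ->
  (exists l, clim k (at_right s) l) -> (exists l, clim k (at_left b) l) ->
  is_RInt (V := C_R_NormedModule) k s b (B - A)%C /\ ex_RInt (fun t => Cmod (k t)) s b.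
Proof.
  induction breaks as [|a l IH]; intros k Phi s b A B Hsb Hd HPhi Hk HA HB Hks Hkb.
  - apply (is_RInt_smooth_interior k Phi); try assumption. intros t Ht. apply Hd; [exact Ht|intros []].
  - destruct (classic (s < a < b)) as [Ha|Ha].
    + destruct (IH k Phi s a A (Phi a)) as [H1 H1'].
      { lra. }
      { intros t Ht Hn. apply Hd; [lra|]. intros [<-|H]; [lra|auto]. }
      { intros t Ht. apply HPhi. lra. }
      { intros t Ht. apply Hk. lra. }
      { exact HA. }
      { apply filterlim_locally_left, HPhi, Ha. }
      { exact Hks. }
      { apply Hk, Ha. }
      destruct (IH k Phi a b (Phi a) B) as [H2 H2'].
      { lra. }
      { intros t Ht Hn. apply Hd; [lra|]. intros [<-|H]; [lra|auto]. }
      { intros t Ht. apply HPhi. lra. }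
      { intros t Ht. apply Hk. lra. }
      { apply filterlim_locally_right, HPhi, Ha. }
      { exact HB. }
      { apply Hk, Ha. }
      { exact Hkb. }
      split.
      * replace (B - A)%C with (plus (Phi a - A)%C (B - Phi a)%C : C_R_NormedModule).
        -- apply (is_RInt_Chasles (V := C_R_NormedModule) k s a b _ _ H1 H2).
        -- change ((Phi a - A + (B - Phi a))%C = (B - A)%C). ring.
      * apply (ex_RInt_Chasles (V := R_NormedModule) _ s a b H1' H2').
    + apply (IH k Phi); try assumption. intros t Ht Hn. apply Hd; [exact Ht|].
      intros [<-|H]; [auto|auto].
Qed.

Lemma piecewise_velocity_limits (gamma : R -> C) (t : R) : piecewise_C1 gamma ->
  (exists l, clim (velocity gamma) (at_left t) l) /\ (exists l, clim (velocity gamma) (at_right t) l).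
Proof.
  intros [_ [breaks [H1 H2]]]. destruct (classic (In t breaks)) as [H|H].
  - apply H2, H.
  - destruct (H1 t H) as [_ Hc]. split; exists (velocity gamma t).
    + apply filterlim_locally_left, Hc.
    + apply filterlim_locally_right, Hc.
Qed.

Lemma pderiv_velocity (gamma : R -> C) (t : R) :
  ex_derive (K := R_AbsRing) (V := C_R_NormedModule) gamma t -> pderiv gamma t (velocity gamma t).
Proof.
  intros [l Hl]. replace (velocity gamma t) with l; [exact Hl|].
  apply pderiv_components in Hl. destruct Hl as [H1 H2].
  apply injective_projections; symmetry; [apply is_derive_unique, H1|apply is_derive_unique, H2].
Qed.

(* The primitive need not extend to the end point, so that the contour may run into a
   singularity at which both the integrand and its primitive have limits. *)
Lemma path_integral (gamma k : R -> C) (g F : C -> C) (s b : R) (lg lF : C) : s < b ->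
  piecewise_C1 gamma ->
  (forall t, s <= t < b -> cderiv F (gamma t) (g (gamma t)) /\ ccont g (gamma t)) ->
  (forall t, s < t < b -> k t = (g (gamma t) * velocity gamma t)%C) ->
  clim (fun t => g (gamma t)) (at_left b) lg -> clim (fun t => F (gamma t)) (at_left b) lF ->
  is_RInt (V := C_R_NormedModule) k s b (lF - F (gamma s))%C /\ ex_RInt (fun t => Cmod (k t)) s b.
Proof.
  intros Hsb Hg HF Hk Hlg HlF.
  assert (Hg' := Hg). destruct Hg' as [Cg [breaks [Hb _]]].
  assert (H : is_RInt (V := C_R_NormedModule) (fun t => g (gamma t) * velocity gamma t)%C s b
      (lF - F (gamma s))%C /\ ex_RInt (fun t => Cmod (g (gamma t) * velocity gamma t)%C) s b).
  { apply (is_RInt_piecewise breaks _ (fun t => F (gamma t))); [exact Hsb| | | | | | |].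
    - intros t Ht Hn. destruct (Hb t Hn) as [Hd Hc]. destruct (HF t ltac:(lra)) as [HFt Hgt]. split.
      + apply cderiv_pderiv; [exact HFt|]. apply pderiv_velocity, Hd.
      + apply (filterlim_Cmult (locally t)); [|exact Hc].
        apply (ccont_filterlim g (gamma t) (locally t)); [exact Hgt|apply Cg].
    - intros t Ht. destruct (HF t ltac:(lra)) as [HFt _].
      apply (ccont_filterlim F (gamma t) (locally t)); [eapply cderiv_ccont, HFt|apply Cg].
    - intros t Ht. destruct (HF t ltac:(lra)) as [_ Hgt].
      destruct (piecewise_velocity_limits gamma t Hg) as [[l Hl] [r Hr]]. split.
      + exists (g (gamma t) * l)%C. apply (filterlim_Cmult (at_left t)); [|exact Hl].
        apply filterlim_locally_left, (ccont_filterlim g (gamma t) (locally t)); [exact Hgt|apply Cg].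
      + exists (g (gamma t) * r)%C. apply (filterlim_Cmult (at_right t)); [|exact Hr].
        apply filterlim_locally_right, (ccont_filterlim g (gamma t) (locally t)); [exact Hgt|apply Cg].
    - destruct (HF s ltac:(lra)) as [HFt _].
      apply filterlim_locally_right, (ccont_filterlim F (gamma s) (locally s)); [eapply cderiv_ccont, HFt|apply Cg].
    - exact HlF.
    - destruct (HF s ltac:(lra)) as [_ Hgt].
      destruct (piecewise_velocity_limits gamma s Hg) as [_ [r Hr]].
      exists (g (gamma s) * r)%C. apply (filterlim_Cmult (at_right s)); [|exact Hr].
      apply filterlim_locally_right, (ccont_filterlim g (gamma s) (locally s)); [exact Hgt|apply Cg].
    - destruct (piecewise_velocity_limits gamma b Hg) as [[l Hl] _].
      exists (lg * l)%C. apply (filterlim_Cmult (at_left b)); assumption. }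
  destruct H as [H1 H2]. split.
  - eapply (is_RInt_ext (V := C_R_NormedModule)); [|exact H1].
    intros t Ht. rewrite Rmin_left, Rmax_right in Ht by lra. symmetry. apply Hk, Ht.
  - eapply (ex_RInt_ext (V := R_NormedModule)); [|exact H2].
    intros t Ht. rewrite Rmin_left, Rmax_right in Ht by lra. simpl. f_equal. symmetry. apply Hk, Ht.
Qed.

Lemma is_RInt_gen_from {V : NormedModule R_AbsRing} (k : R -> V) (L : (R -> Prop) -> Prop)
  {FL : Filter L} (b : R) (J : R -> V) (l : V) :
  L (fun s => is_RInt k s b (J s)) -> filterlim J L (locally l) ->
  is_RInt_gen k L (at_point b) l.
Proof.
  intros H1 H2 P HP. specialize (H2 P HP). unfold filtermapi.
  apply (Filter_prod _ _ _ (fun s => is_RInt k s b (J s) /\ P (J s)) (fun t => t = b)).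
  - apply filter_and; assumption.
  - reflexivity.
  - intros x y [Hx HPx] ->. exists (J x). split; assumption.
Qed.

Lemma is_RInt_gen_to {V : NormedModule R_AbsRing} (k : R -> V) (L : (R -> Prop) -> Prop)
  {FL : Filter L} (b : R) (J : R -> V) (l : V) :
  L (fun s => is_RInt k b s (J s)) -> filterlim J L (locally l) ->
  is_RInt_gen k (at_point b) L l.
Proof.
  intros H1 H2 P HP. specialize (H2 P HP). unfold filtermapi.
  apply (Filter_prod _ _ _ (fun t => t = b) (fun s => is_RInt k b s (J s) /\ P (J s))).
  - reflexivity.
  - apply filter_and; assumption.
  - intros x y -> [Hx HPx]. exists (J y). split; assumption.
Qed.

Lemma exp_small_left (M s e : R) : 0 < s -> 0 < e -> exists T, forall t, t < T -> M * exp (s * t) < e.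
Proof.
  intros Hs He. set (M' := Rabs M + 1).
  assert (HM : 0 < M') by (unfold M'; generalize (Rabs_pos M); lra).
  exists (ln (e / M') / s). intros t Ht.
  assert (H : s * t < ln (e / M')).
  { apply Rmult_lt_compat_l with (r := s) in Ht; [|exact Hs].
    replace (s * (ln (e / M') / s)) with (ln (e / M')) in Ht by (field; lra). exact Ht. }
  apply exp_increasing in H. rewrite exp_ln in H by (apply Rdiv_lt_0_compat; lra).
  apply Rle_lt_trans with (M' * exp (s * t)).
  - apply Rmult_le_compat_r; [left; apply exp_pos|]. unfold M'. generalize (Rle_abs M). lra.
  - apply Rmult_lt_compat_l with (r := M') in H; [|exact HM].
    replace (M' * (e / M')) with e in H by (field; lra). exact H.
Qed.

Lemma exp_cauchy_left (J : R -> R) (T M s : R) : 0 < s ->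
  (forall u v, u < v < T -> Rabs (J u - J v) <= M * exp (s * v)) ->
  exists l, filterlim J (Rbar_locally m_infty) (locally l).
Proof.
  intros Hs H.
  apply (filterlim_locally_cauchy (U := R_CompleteSpace) (F := Rbar_locally m_infty) J).
  intros e. destruct (exp_small_left M s e Hs (cond_pos e)) as [T' HT'].
  exists (fun u => u < Rmin T T'). split; [exists (Rmin T T'); auto|].
  assert (HJ : forall u v, u <= v -> v < Rmin T T' -> Rabs (J u - J v) < e).
  { intros u v Huv Hv.
    destruct (Rmin_Rgt_l _ _ _ Hv).
    destruct Huv as [Huv|<-].
    - eapply Rle_lt_trans; [apply H; lra|apply HT'; lra].
    - rewrite Rminus_diag, Rabs_R0. apply cond_pos. }
  intros u v Hu Hv. change (Rabs (J v - J u) < e).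
  destruct (Rle_lt_dec u v); [rewrite Rabs_minus_sym|]; apply HJ; lra.
Qed.

Lemma exp_cauchy_left_C (J : R -> C) (T M s : R) : 0 < s ->
  (forall u v, u < v < T -> Cmod (J u - J v)%C <= M * exp (s * v)) ->
  exists l, clim J (Rbar_locally m_infty) l.
Proof.
  intros Hs H.
  destruct (exp_cauchy_left (fun t => Re (J t)) T M s Hs) as [l1 H1].
  { intros u v Huv. eapply Rle_trans; [apply (re_le_Cmod (J u - J v)%C)|apply H, Huv]. }
  destruct (exp_cauchy_left (fun t => Im (J t)) T M s Hs) as [l2 H2].
  { intros u v Huv. eapply Rle_trans; [apply (im_le_Cmod (J u - J v)%C)|apply H, Huv]. }
  exists (l1, l2). apply (clim_iff (Rbar_locally m_infty)). intros e He.
  assert (He2 : 0 < e / 2) by lra.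
  assert (B1 : Rbar_locally m_infty (fun t => Rabs (Re (J t) - l1) < e / 2))
    by exact (H1 _ (locally_ball l1 (mkposreal _ He2))).
  assert (B2 : Rbar_locally m_infty (fun t => Rabs (Im (J t) - l2) < e / 2))
    by exact (H2 _ (locally_ball l2 (mkposreal _ He2))).
  generalize (filter_and _ _ B1 B2). apply filter_imp. intros t [A1 A2].
  eapply Rle_lt_trans; [apply Cmod_le_sum|].
  change (Rabs (Re (J t) - l1) + Rabs (Im (J t) - l2) < e). lra.
Qed.

Lemma is_derive_exp_scaled (M s t : R) : s <> 0 ->
  is_derive (fun t => M / s * exp (s * t)) t (M * exp (s * t)).
Proof. intros Hs. auto_derive; [exact I|field; exact Hs]. Qed.

Lemma RInt_Cmod_exp_bound (k : R -> C) (u v M s : R) : s <> 0 -> u < v ->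
  (forall t, u < t < v -> Cmod (k t) <= M * exp (s * t)) ->
  ex_RInt (fun t => Cmod (k t)) u v ->
  0 <= RInt (fun t => Cmod (k t)) u v <= M / s * exp (s * v) - M / s * exp (s * u).
Proof.
  intros Hs Huv Hk Hex. assert (Hi := RInt_correct (V := R_CompleteNormedModule) _ _ _ Hex). split.
  - eapply is_RInt_ge_0; [|exact Hi|]; [lra|]. intros t _. apply Cmod_ge_0.
  - eapply is_RInt_le; [|exact Hi| |exact Hk]; [lra|].
    apply (is_RInt_derive (V := R_CompleteNormedModule) (fun t => M / s * exp (s * t))).
    + intros t _. apply is_derive_exp_scaled, Hs.
    + intros t _. apply (ex_derive_continuous (K := R_AbsRing) (V := R_NormedModule)).
      auto_derive. exact I.
Qed.

(** The integral converges because its primitive tends to 0. The integral of the modulus has no such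
    primitive and converges by the Cauchy criterion, with the exponential as majorant. *)
Lemma improper_left (k Phi : R -> C) (b T M s : R) (lF : C) : 0 < s ->
  (forall u, u < b -> is_RInt (V := C_R_NormedModule) k u b (lF - Phi u)%C /\ ex_RInt (fun t => Cmod (k t)) u b) ->
  (forall t, t < T -> Cmod (k t) <= M * exp (s * t)) ->
  clim Phi (Rbar_locally m_infty) (RtoC 0) ->
  is_RInt_gen (V := C_R_NormedModule) k (Rbar_locally m_infty) (at_point b) lF /\
  ex_RInt_gen (V := R_NormedModule) (fun t => Cmod (k t)) (Rbar_locally m_infty) (at_point b).
Proof.
  intros Hs Hk HM HPhi. split.
  - apply (is_RInt_gen_from (V := C_R_NormedModule) k _ b (fun u => lF - Phi u)%C).
    + exists b. intros u Hu. apply Hk, Hu.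
    + apply (clim_iff (Rbar_locally m_infty)). intros e He.
      generalize (proj1 (clim_iff _ _ _) HPhi e He). apply filter_imp. intros u Hu.
      replace (lF - Phi u - lF)%C with (0 - Phi u)%C by ring. rewrite Cmod_sub_sym. exact Hu.
  - destruct (exp_cauchy_left (fun u => RInt (fun t => Cmod (k t)) u b) (Rmin b T) (M / s) s Hs) as [l Hl].
    + intros u v [Huv Hv].
      destruct (Rmin_Rgt_l _ _ _ Hv).
      assert (Hvb := proj2 (Hk v ltac:(lra))). assert (Hub := proj2 (Hk u ltac:(lra))).
      assert (Huv' : ex_RInt (fun t => Cmod (k t)) u v).
      { apply (ex_RInt_Chasles_1 (V := R_CompleteNormedModule) _ u v b); [lra|exact Hub]. }
      assert (E := RInt_Chasles (V := R_CompleteNormedModule) _ u v b Huv' Hvb).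
      assert (Hb := RInt_Cmod_exp_bound k u v M s ltac:(lra) Huv (fun t Ht => HM t ltac:(lra)) Huv').
      set (N := fun x y => RInt (fun t => Cmod (k t)) x y : R).
      change (N u v + N v b = N u b) in E. change (Rabs (N u b - N v b) <= M / s * exp (s * v)).
      change (0 <= N u v <= M / s * exp (s * v) - M / s * exp (s * u)) in Hb.
      replace (N u b - N v b) with (N u v) by lra.
      assert (0 <= M / s * exp (s * u)).
      { apply Rmult_le_pos; [|left; apply exp_pos]. apply Rdiv_le_0_compat; [|exact Hs].
        generalize (HM v ltac:(lra)) (Cmod_ge_0 (k v)) (exp_pos (s * v)). nra. }
      rewrite Rabs_pos_eq by lra. lra.
    + exists l. apply (is_RInt_gen_from (V := R_NormedModule) _ _ b
        (fun u => RInt (fun t => Cmod (k t)) u b)); [|exact Hl].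
      exists b. intros u Hu. apply (RInt_correct (V := R_CompleteNormedModule)), Hk, Hu.
Qed.

Lemma improper_right (k Phi : R -> C) (b T M s : R) (A : C) : 0 < s ->
  (forall u, b < u -> is_RInt (V := C_R_NormedModule) k b u (Phi u - A)%C /\ ex_RInt (fun t => Cmod (k t)) b u) ->
  (forall t, T < t -> Cmod (k t) <= M * exp (s * - t)) ->
  clim Phi (Rbar_locally p_infty) (RtoC 0) ->
  is_RInt_gen (V := C_R_NormedModule) k (at_point b) (Rbar_locally p_infty) (- A)%C /\
  ex_RInt_gen (V := R_NormedModule) (fun t => Cmod (k t)) (at_point b) (Rbar_locally p_infty).
Proof.
  intros Hs Hk HM HPhi. split.
  - apply (is_RInt_gen_to (V := C_R_NormedModule) k _ b (fun u => Phi u - A)%C).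
    + exists b. intros u Hu. apply Hk, Hu.
    + apply (clim_iff (Rbar_locally p_infty)). intros e He.
      generalize (proj1 (clim_iff _ _ _) HPhi e He). apply filter_imp. intros u Hu.
      replace (Phi u - A - - A)%C with (Phi u - 0)%C by ring. exact Hu.
  (* The variable is reflected so that the Cauchy criterion at -oo also serves at +oo. *)
  - destruct (exp_cauchy_left (fun u => RInt (fun t => Cmod (k t)) b (- u)) (Rmin (- b) (- T)) (M / s) s Hs) as [l Hl].
    + intros u v [Huv Hv].
      assert (b < - v) by (generalize (Rlt_Rmin_l _ _ _ Hv); lra).
      assert (T < - v) by (generalize (Rlt_Rmin_r _ _ _ Hv); lra).
      assert (Hvb := proj2 (Hk (- v) ltac:(lra))). assert (Hub := proj2 (Hk (- u) ltac:(lra))).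
      assert (Huv' : ex_RInt (fun t => Cmod (k t)) (- v) (- u)).
      { apply (ex_RInt_Chasles_2 (V := R_CompleteNormedModule) _ b (- v) (- u)); [lra|exact Hub]. }
      assert (E := RInt_Chasles (V := R_CompleteNormedModule) _ b (- v) (- u) Hvb Huv').
      assert (Hb := RInt_Cmod_exp_bound k (- v) (- u) M (- s) ltac:(lra) ltac:(lra)).
      destruct Hb as [Hb1 Hb2].
      { intros t Ht. replace (- s * t) with (s * - t) by ring. apply HM. lra. }
      { exact Huv'. }
      set (N := fun x y => RInt (fun t => Cmod (k t)) x y : R).
      change (N b (- v) + N (- v) (- u) = N b (- u)) in E.
      change (Rabs (N b (- u) - N b (- v)) <= M / s * exp (s * v)).
      change (0 <= N (- v) (- u)) in Hb1.
      change (N (- v) (- u) <= M / - s * exp (- s * - u) - M / - s * exp (- s * - v)) in Hb2.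
      replace (N b (- u) - N b (- v)) with (N (- v) (- u)) by lra.
      replace (- s * - u) with (s * u) in Hb2 by ring.
      replace (- s * - v) with (s * v) in Hb2 by ring.
      replace (M / - s) with (- (M / s)) in Hb2 by (field; lra).
      assert (0 <= M / s * exp (s * u)).
      { apply Rmult_le_pos; [|left; apply exp_pos]. apply Rdiv_le_0_compat; [|exact Hs].
        generalize (HM (- v) ltac:(lra)) (Cmod_ge_0 (k (- v))) (exp_pos (s * - - v)). nra. }
      rewrite Rabs_pos_eq by lra. lra.
    + exists l. apply (is_RInt_gen_to (V := R_NormedModule) _ _ b (fun u => RInt (fun t => Cmod (k t)) b u)).
      * exists b. intros u Hu. apply (RInt_correct (V := R_CompleteNormedModule)), Hk, Hu.
      * apply (filterlim_ext (fun u => RInt (fun t => Cmod (k t)) b (- - u))).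
        { intros u. rewrite Ropp_involutive. reflexivity. }
        apply (filterlim_comp _ _ _ Ropp (fun u => RInt (fun t => Cmod (k t)) b (- u)) _ (Rbar_locally m_infty)); [|exact Hl].
        apply (filterlim_Rbar_opp p_infty).
Qed.

(** * Growth in half-strips *)

(* This covers the behaviour at -i oo (with w = -i x) as well as the one at a singularity
   (with w = Log (i (x - z_m))). *)
Section HalfStrip.
Variables (Y dY : C -> C) (P : R -> Prop) (a s M y0 : R).
Hypothesis P_convex : forall u v t, P u -> P v -> 0 <= t <= 1 -> P (u + t * (v - u)).
Hypothesis P_y0 : P y0.
Hypothesis Y_deriv : forall w, Re w < a -> P (Im w) -> cderiv Y w (dY w).
Hypothesis dY_bound : forall w, Re w < a -> P (Im w) -> Cmod (dY w) <= M * exp (s * Re w).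

Lemma half_strip_horizontal (y u v : R) : s <> 0 -> P y -> u <= v < a ->
  Cmod (Y (v, y) - Y (u, y))%C <= M / s * exp (s * v) - M / s * exp (s * u).
Proof.
  intros Hs Hy Huv.
  apply (mean_value_inequality (fun t => Y (t, y)) (fun t => dY (t, y)) (fun t => M / s * exp (s * t))
    (fun t => M * exp (s * t))); [lra| | |].
  - intros t Ht. replace (dY (t, y)) with (dY (t, y) * 1)%C by ring.
    apply (cderiv_pderiv Y (fun t => (t, y))).
    + apply Y_deriv; [simpl; lra|exact Hy].
    + apply (is_derive_ext (K := R_AbsRing) (V := C_R_NormedModule) (fun t => (0, y) + RtoC t * 1)%C);
      [|apply pderiv_segment].
      intros x. apply injective_projections; simpl; ring.
  - intros t _. apply is_derive_exp_scaled, Hs.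
  - intros t Ht. apply dY_bound; [simpl; lra|exact Hy].
Qed.

Lemma half_strip_vertical (u y : R) : P y -> u < a ->
  Cmod (Y (u, y) - Y (u, y0))%C <= M * exp (s * u) * Rabs (y - y0).
Proof.
  intros Hy Hu.
  replace (Rabs (y - y0)) with (Cmod ((u, y) - (u, y0))%C).
  2:{ replace ((u, y) - (u, y0))%C with (Ci * RtoC (y - y0))%C
        by (apply injective_projections; simpl; ring).
      rewrite Cmod_mult, Cmod_Ci, Cmod_R. ring. }
  assert (E : forall t : R, ((u, y0) + RtoC t * ((u, y) - (u, y0)))%C = (u, y0 + t * (y - y0))).
  { intros t. apply injective_projections; simpl; ring. }
  apply (mean_value_segment Y dY); intros t Ht; rewrite E.
  - apply Y_deriv; [exact Hu|apply P_convex; assumption].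
  - apply (dY_bound (u, y0 + t * (y - y0))); [exact Hu|apply P_convex; assumption].
Qed.

(** For s > 0 the derivative is integrable towards Re w = -oo, which gives a limit along the line Im
    w = [y0]. A vertical move at abscissa u costs at most M e^{su} |y - y0|, so the limit is the
    same on all horizontal lines. *)
Lemma half_strip_limit : 0 < s -> exists Y0 : C, forall w, Re w < a -> P (Im w) ->
  Cmod (Y w - Y0)%C <= M * (1 / s + Rabs (Im w - y0)) * exp (s * Re w).
Proof.
  intros Hs.
  assert (HM : 0 <= M).
  { generalize (dY_bound (a - 1, y0)) (Cmod_ge_0 (dY (a - 1, y0))) (exp_pos (s * (a - 1))).
    simpl. intros H. generalize (H ltac:(lra) P_y0). nra. }
  assert (HMs : 0 <= M / s) by (apply Rdiv_le_0_compat; lra).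
  destruct (exp_cauchy_left_C (fun u => Y (u, y0)) a (M / s) s Hs) as [Y0 HY0].
  { intros u v Huv. rewrite Cmod_sub_sym.
    eapply Rle_trans; [apply half_strip_horizontal; [lra|exact P_y0|lra]|].
    generalize (exp_pos (s * u)). nra. }
  exists Y0. intros [u y] Hu Hy. simpl in *.
  assert (H1 : Cmod (Y (u, y0) - Y0)%C <= M / s * exp (s * u)).
  { apply le_epsilon. intros e He.
    destruct (proj1 (clim_iff _ _ _) HY0 e He) as [T HT].
    set (t := Rmin u T - 1).
    assert (t < T) by (unfold t; generalize (Rmin_r u T); lra).
    assert (t < u) by (unfold t; generalize (Rmin_l u T); lra).
    eapply Rle_trans; [apply (Cmod_sub_triangle _ _ (Y (t, y0)))|].
    apply Rplus_le_compat; [|left; apply HT; assumption].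
    eapply Rle_trans; [apply half_strip_horizontal; [lra|exact P_y0|lra]|].
    generalize (exp_pos (s * t)). nra. }
  eapply Rle_trans; [apply (Cmod_sub_triangle _ _ (Y (u, y0)))|].
  generalize (half_strip_vertical u y Hy Hu). intros H2.
  replace (M * (1 / s + Rabs (y - y0)) * exp (s * u))
    with (M * exp (s * u) * Rabs (y - y0) + M / s * exp (s * u)) by (field; lra).
  lra.
Qed.

(** For s < 0 no limit can be separated. Integration starts at Re w = a - 1, a line inside the
    half-strip, and the starting value is absorbed because e^{s (u - a1)} >= 1 to the left of it. *)
Lemma half_strip_bound (l : R) : s < 0 -> (forall y, P y -> Rabs (y - y0) <= l) ->
  exists M', forall w, Re w < a - 1 -> P (Im w) -> Cmod (Y w) <= M' * exp (s * Re w).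
Proof.
  intros Hs Hl. set (a1 := a - 1).
  assert (HM : 0 <= M).
  { generalize (dY_bound (a - 1, y0)) (Cmod_ge_0 (dY (a - 1, y0))) (exp_pos (s * (a - 1))).
    simpl. intros H. generalize (H ltac:(lra) P_y0). nra. }
  set (C0 := Cmod (Y (a1, y0)) + M * exp (s * a1) * l).
  assert (HC0 : 0 <= C0).
  { unfold C0. assert (0 <= l) by (eapply Rle_trans; [apply Rabs_pos|apply (Hl y0 P_y0)]).
    assert (0 <= M * exp (s * a1)) by (generalize (exp_pos (s * a1)); nra).
    generalize (Cmod_ge_0 (Y (a1, y0))). nra. }
  exists (C0 * exp (- s * a1) + M / - s). intros [u y] Hu Hy. simpl in *.
  change (u < a - 1) in Hu. assert (Hua : u <= a1 < a) by (unfold a1; lra).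
  assert (H1 := half_strip_horizontal y u a1 (Rlt_not_eq _ _ Hs) Hy Hua).
  assert (H2 := half_strip_vertical a1 y Hy (proj2 Hua)).
  assert (H3 : M * exp (s * a1) * Rabs (y - y0) <= M * exp (s * a1) * l).
  { apply Rmult_le_compat_l; [generalize (exp_pos (s * a1)); nra|apply Hl, Hy]. }
  assert (H4 : Cmod (Y (u, y)) <= C0 + M / - s * exp (s * u)).
  { unfold C0. generalize (Cmod_triangle_sub (Y (u, y)) (Y (a1, y)))
      (Cmod_triangle_sub (Y (a1, y)) (Y (a1, y0))).
    rewrite (Cmod_sub_sym (Y (u, y))).
    replace (M / s) with (- (M / - s)) in H1 by (field; lra).
    assert (0 <= M / - s * exp (s * a1)).
    { apply Rmult_le_pos; [apply Rdiv_le_0_compat; lra|left; apply exp_pos]. }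
    lra. }
  eapply Rle_trans; [exact H4|]. rewrite Rmult_plus_distr_r. apply Rplus_le_compat_r.
  rewrite Rmult_assoc, <- exp_plus. rewrite <- (Rmult_1_r C0) at 1.
  apply Rmult_le_compat_l; [exact HC0|]. rewrite <- exp_0.
  assert (0 <= - s * a1 + s * u) by (unfold a1; nra).
  destruct H as [H|H]; [left; apply exp_increasing, H|rewrite <- H; lra].
Qed.
End HalfStrip.

(** * Finite sums, twice differentiable functions and elementary estimates *)

Lemma Csum_0 (a : nat -> C) : Csum 0 a = RtoC 0.
Proof. unfold Csum. apply (sum_n_m_zero (G := C_AbelianMonoid)). lia. Qed.

Lemma Csum_S (n : nat) (a : nat -> C) : Csum (S n) a = (Csum n a + a (S n))%C.
Proof. unfold Csum. apply (sum_n_Sm (G := C_AbelianMonoid)). lia. Qed.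

Lemma Csum_ext (n : nat) (a b : nat -> C) :
  (forall p, (1 <= p <= n)%nat -> a p = b p) -> Csum n a = Csum n b.
Proof.
  induction n as [|n IH]; intros H; [rewrite !Csum_0; reflexivity|].
  rewrite !Csum_S, H by lia. f_equal. apply IH. intros p Hp. apply H. lia.
Qed.

Lemma Csum_extract (n m : nat) (a : nat -> C) : (1 <= m <= n)%nat ->
  Csum n a = (Csum n (fun p => if Nat.eqb p m then RtoC 0 else a p) + a m)%C.
Proof.
  assert (H0 : forall n', (n' < m)%nat ->
    Csum n' a = Csum n' (fun p => if Nat.eqb p m then RtoC 0 else a p)).
  { intros n' Hn. apply Csum_ext. intros p Hp.
    destruct (Nat.eqb_spec p m); [lia|reflexivity]. }
  induction n as [|n IH]; intros Hm; [lia|]. rewrite !Csum_S.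
  destruct (Nat.eqb_spec (S n) m) as [<-|Hne].
  - rewrite H0 by lia. ring.
  - rewrite IH by lia. ring.
Qed.

Lemma Csum_bounded {T : Type} (n : nat) (S : T -> Prop) (F : nat -> T -> C) :
  (forall p, (1 <= p <= n)%nat -> exists M, forall x, S x -> Cmod (F p x) <= M) ->
  exists M, forall x, S x -> Cmod (Csum n (fun p => F p x)) <= M.
Proof.
  induction n as [|n IH]; intros H.
  - exists 0. intros x _. rewrite Csum_0, Cmod_0. lra.
  - destruct IH as [M1 H1]; [intros p Hp; apply H; lia|].
    destruct (H (Datatypes.S n)) as [M2 H2]; [lia|].
    exists (M1 + M2). intros x Hx. rewrite Csum_S.
    eapply Rle_trans; [apply Cmod_triangle|]. apply Rplus_le_compat; auto.
Qed.

Lemma cderiv_Csum (n : nat) (F : nat -> C -> C) (x : C) (d : nat -> C) :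
  (forall p, (1 <= p <= n)%nat -> cderiv (F p) x (d p)) ->
  cderiv (fun y => Csum n (fun p => F p y)) x (Csum n d).
Proof.
  induction n as [|n IH]; intros H.
  - apply (cderiv_ext (fun _ => RtoC 0)); [intros y; rewrite Csum_0; reflexivity|].
    rewrite Csum_0. apply cderiv_const.
  - apply (cderiv_ext (fun y => Csum n (fun p => F p y) + F (S n) y)%C);
    [intros y; rewrite Csum_S; reflexivity|].
    rewrite Csum_S. apply cderiv_plus; [apply IH; intros p Hp|]; apply H; lia.
Qed.

(* Two derivatives are enough for a primitive (which needs a continuous derivative) and for a
   second order Taylor estimate. *)
Definition holo2 (D : C -> Prop) (F : C -> C) : Prop :=
  exists dF : C -> C, forall x, D x -> cderiv F x (dF x) /\ exists l, cderiv dF x l.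

Lemma holo2_cderiv (D : C -> Prop) (F : C -> C) (x : C) :
  holo2 D F -> D x -> exists l, cderiv F x l.
Proof. intros [dF H] Hx. exists (dF x). apply H, Hx. Qed.

Lemma holo2_ccont (D : C -> Prop) (F : C -> C) (x : C) : holo2 D F -> D x -> ccont F x.
Proof. intros [dF H] Hx. eapply cderiv_ccont, H, Hx. Qed.

Lemma holo2_const (D : C -> Prop) (a : C) : holo2 D (fun _ => a).
Proof.
  exists (fun _ => RtoC 0). intros x _. split; [apply cderiv_const|].
  exists (RtoC 0). apply cderiv_const.
Qed.

Lemma holo2_id (D : C -> Prop) : holo2 D (fun x => x).
Proof.
  exists (fun _ => RtoC 1). intros x _. split; [apply cderiv_id|].
  exists (RtoC 0). apply cderiv_const.
Qed.

Lemma holo2_plus (D : C -> Prop) (F H : C -> C) :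
  holo2 D F -> holo2 D H -> holo2 D (fun x => F x + H x)%C.
Proof.
  intros [dF HF] [dH HH]. exists (fun x => dF x + dH x)%C. intros x Hx.
  destruct (HF x Hx) as [H1 [l1 H2]]. destruct (HH x Hx) as [H3 [l2 H4]]. split.
  - apply cderiv_plus; assumption.
  - eexists. apply cderiv_plus; eassumption.
Qed.

Lemma holo2_mult (D : C -> Prop) (F H : C -> C) :
  holo2 D F -> holo2 D H -> holo2 D (fun x => F x * H x)%C.
Proof.
  intros [dF HF] [dH HH]. exists (fun x => dF x * H x + F x * dH x)%C. intros x Hx.
  destruct (HF x Hx) as [H1 [l1 H2]]. destruct (HH x Hx) as [H3 [l2 H4]]. split.
  - apply cderiv_mult; assumption.
  - eexists. apply cderiv_plus; apply cderiv_mult; eassumption.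
Qed.

Lemma holo2_minus (D : C -> Prop) (F H : C -> C) :
  holo2 D F -> holo2 D H -> holo2 D (fun x => F x - H x)%C.
Proof.
  intros [dF HF] [dH HH]. exists (fun x => dF x - dH x)%C. intros x Hx.
  destruct (HF x Hx) as [H1 [l1 H2]]. destruct (HH x Hx) as [H3 [l2 H4]]. split.
  - apply cderiv_minus; assumption.
  - eexists. apply cderiv_minus; eassumption.
Qed.

Lemma holo2_ext (D : C -> Prop) (F H : C -> C) :
  (forall x, F x = H x) -> holo2 D F -> holo2 D H.
Proof.
  intros He [dF HF]. exists dF. intros x Hx. destruct (HF x Hx) as [H1 H2]. split; [|exact H2].
  apply (cderiv_ext F); assumption.
Qed.

Lemma holo2_Csum (D : C -> Prop) (n : nat) (F : nat -> C -> C) :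
  (forall p, (1 <= p <= n)%nat -> holo2 D (F p)) -> holo2 D (fun x => Csum n (fun p => F p x)).
Proof.
  induction n as [|n IH]; intros H.
  - apply (holo2_ext D (fun _ => RtoC 0)); [intros x; rewrite Csum_0; reflexivity|apply holo2_const].
  - apply (holo2_ext D (fun x => Csum n (fun p => F p x) + F (S n) x)%C);
    [intros x; rewrite Csum_S; reflexivity|].
    apply holo2_plus; [apply IH; intros p Hp|]; apply H; lia.
Qed.

Lemma holo2_Cexp (D : C -> Prop) (F : C -> C) : holo2 D F -> holo2 D (fun x => Cexp (F x)).
Proof.
  intros [dF HF]. exists (fun x => dF x * Cexp (F x))%C. intros x Hx.
  destruct (HF x Hx) as [H1 [l H2]].
  assert (H : cderiv (fun x => Cexp (F x)) x (dF x * Cexp (F x))%C).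
  { apply (cderiv_comp Cexp F); [apply cderiv_Cexp|exact H1]. }
  split; [exact H|]. eexists. apply cderiv_mult; eassumption.
Qed.

Lemma cderiv_shift (a w x : C) : cderiv (fun y => a * (y - w))%C x a.
Proof.
  eapply cderiv_eq.
  - apply cderiv_mult; [apply cderiv_const|].
    apply cderiv_minus; [apply cderiv_id|apply cderiv_const].
  - cbv beta. ring.
Qed.

Lemma holo2_inv (D : C -> Prop) (F : C -> C) : (forall x, D x -> F x <> 0) ->
  holo2 D F -> holo2 D (fun x => / F x)%C.
Proof.
  intros H0 [dF HF]. exists (fun x => dF x * - (/ F x * / F x))%C. intros x Hx.
  destruct (HF x Hx) as [H1 [l H2]].
  assert (H : cderiv (fun x => / F x)%C x (dF x * - (/ F x * / F x))%C).
  { apply (cderiv_comp Cinv F); [apply cderiv_inv, H0, Hx|exact H1]. }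
  split; [exact H|]. eexists. apply cderiv_mult; [exact H2|].
  apply (cderiv_ext (fun x => (- (1)) * (/ F x * / F x))%C); [intros y; ring|].
  apply cderiv_mult; [apply cderiv_const|apply cderiv_mult; exact H].
Qed.

Lemma holo2_Log (D : C -> Prop) (F : C -> C) : (forall x, D x -> slit (F x)) ->
  holo2 D F -> holo2 D (fun x => Log (F x)).
Proof.
  intros Hs [dF HF].
  assert (Hi : holo2 D (fun x => / F x)%C).
  { apply holo2_inv; [intros x Hx; apply slit_neq_0, Hs, Hx|exists dF; exact HF]. }
  exists (fun x => dF x * / F x)%C. intros x Hx. destruct (HF x Hx) as [H1 [l H2]]. split.
  - apply (cderiv_comp Log F); [apply cderiv_Log, Hs, Hx|exact H1].
  - destruct (holo2_cderiv D _ x Hi Hx) as [l' H']. eexists. apply cderiv_mult; eassumption.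
Qed.

Lemma primitive_unique_segment (F H g : C -> C) (a b : C) :
  (forall t, 0 <= t <= 1 -> cderiv F (a + RtoC t * (b - a))%C (g (a + RtoC t * (b - a))%C) /\
     cderiv H (a + RtoC t * (b - a))%C (g (a + RtoC t * (b - a))%C)) ->
  (F b - H b)%C = (F a - H a)%C.
Proof.
  intros HFH.
  assert (E : Cmod ((F b - H b) - (F a - H a))%C <= 0 * Cmod (b - a)).
  { apply (mean_value_segment (fun x => F x - H x)%C (fun x => g x - g x)%C).
    - intros t Ht. apply cderiv_minus; apply HFH, Ht.
    - intros t Ht. replace (g _ - g _)%C with (RtoC 0) by ring. rewrite Cmod_0. lra. }
  rewrite Rmult_0_l in E.
  assert (E' : ((F b - H b) - (F a - H a))%C = 0).
  { apply Cmod_eq_0. apply Rle_antisym; [exact E|apply Cmod_ge_0]. }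
  replace (F b - H b)%C with (((F b - H b) - (F a - H a)) + (F a - H a))%C by ring.
  rewrite E'. ring.
Qed.

Lemma finite_radius (n : nat) (Q : nat -> C -> Prop) (x : C) :
  (forall p, (1 <= p <= n)%nat -> exists r, 0 < r /\ forall y, Cmod (y - x)%C < r -> Q p y) ->
  exists r, 0 < r /\ forall y, Cmod (y - x)%C < r -> forall p, (1 <= p <= n)%nat -> Q p y.
Proof.
  induction n as [|n IH]; intros H.
  - exists 1. split; [lra|]. intros; lia.
  - destruct IH as [r1 [Hr1 H1]]; [intros p Hp; apply H; lia|].
    destruct (H (S n)) as [r2 [Hr2 H2]]; [lia|].
    exists (Rmin r1 r2). split; [apply Rmin_pos; lra|]. intros y Hy p Hp.
    destruct (Nat.eq_dec p (S n)) as [->|Hne].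
    + apply H2. exact (Rlt_Rmin_r _ _ _ Hy).
    + apply H1; [|lia]. exact (Rlt_Rmin_l _ _ _ Hy).
Qed.

Lemma Re_near (x y : C) (r : R) : Cmod (y - x)%C < r -> Re x - r < Re y < Re x + r.
Proof.
  intros H. generalize (re_le_Cmod (y - x)). intros H1. apply Rabs_le_between in H1.
  change (Re (y - x)) with (Re y - Re x) in H1. lra.
Qed.

Lemma Im_near (x y : C) (r : R) : Cmod (y - x)%C < r -> Im x - r < Im y < Im x + r.
Proof.
  intros H. generalize (im_le_Cmod (y - x)). intros H1. apply Rabs_le_between in H1.
  change (Im (y - x)) with (Im y - Im x) in H1. lra.
Qed.

Lemma Re_segment (a b : C) (t : R) : Re (a + RtoC t * (b - a)) = Re a + t * (Re b - Re a).
Proof. unfold Re; simpl; ring. Qed.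

Lemma Im_segment (a b : C) (t : R) : Im (a + RtoC t * (b - a)) = Im a + t * (Im b - Im a).
Proof. unfold Im; simpl; ring. Qed.

Lemma convex_gt (a u v t : R) : a < u -> a < v -> 0 <= t <= 1 -> a < u + t * (v - u).
Proof.
  intros Hu Hv Ht. destruct (Rle_dec u v); [nra|].
  assert (v <= u + t * (v - u)) by nra. lra.
Qed.

Lemma convex_lt (a u v t : R) : u < a -> v < a -> 0 <= t <= 1 -> u + t * (v - u) < a.
Proof. intros Hu Hv Ht. generalize (convex_gt (- a) (- u) (- v) t). lra. Qed.

Lemma Csum_Im_bounded {T : Type} (n : nat) (S : T -> Prop) (F : nat -> T -> C) :
  (forall p, (1 <= p <= n)%nat -> exists M, forall x, S x -> Rabs (Im (F p x)) <= M) ->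
  exists M, forall x, S x -> Rabs (Im (Csum n (fun p => F p x))) <= M.
Proof.
  induction n as [|n IH]; intros H.
  - exists 0. intros x _. rewrite Csum_0. change (Rabs 0 <= 0). rewrite Rabs_R0. lra.
  - destruct IH as [M1 H1]; [intros p Hp; apply H; lia|].
    destruct (H (Datatypes.S n)) as [M2 H2]; [lia|].
    exists (M1 + M2). intros x Hx. rewrite Csum_S.
    change (Rabs (Im (Csum n (fun p => F p x)) + Im (F (Datatypes.S n) x)) <= M1 + M2).
    eapply Rle_trans; [apply Rabs_triang|]. apply Rplus_le_compat; auto.
Qed.

Lemma finite_upper_bound (n : nat) (a : nat -> R) :
  exists M, 0 <= M /\ forall p, (1 <= p <= n)%nat -> a p <= M.
Proof.
  induction n as [|n [M [HM H]]]; [exists 0; split; [lra|lia]|].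
  exists (Rmax M (a (S n))). split; [eapply Rle_trans; [exact HM|apply Rmax_l]|].
  intros p Hp. destruct (Nat.eq_dec p (S n)) as [->|Hne]; [apply Rmax_r|].
  eapply Rle_trans; [apply H; lia|apply Rmax_l].
Qed.

(** From ln (1 + q) <= q with q = (x - y) / y. Together with [Cmod_conj_shift] it keeps the
    difference of the real parts of the logarithms at z_p and at its conjugate bounded. *)
Lemma ln_ratio_bound (a b r : R) : 1 <= a -> 1 <= b -> 0 <= r -> Rabs (a - b) <= r ->
  Rabs (ln a - ln b) <= r.
Proof.
  intros Ha Hb Hr Hab.
  assert (H : forall x y, 1 <= y -> y <= x -> ln x - ln y <= x - y).
  { intros x y Hy Hxy. assert (E : x = y * (1 + (x - y) / y)) by (field; lra).
    assert (Hq : 0 <= (x - y) / y) by (apply Rdiv_le_0_compat; lra).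
    rewrite E at 1. rewrite ln_mult by lra.
    assert (H1 : ln (1 + (x - y) / y) <= (x - y) / y).
    { destruct (Rle_lt_or_eq_dec _ _ Hq) as [L|L].
      - left. rewrite <- (ln_exp ((x - y) / y)) at 2. apply ln_increasing; [lra|]. apply exp_ineq1. lra.
      - rewrite <- L, Rplus_0_r, ln_1. lra. }
    assert (H2 : (x - y) / y <= x - y).
    { apply Rle_div_l; [lra|]. nra. }
    lra. }
  apply Rabs_le_between in Hab. apply Rabs_le_between.
  destruct (Rle_dec a b) as [L|L].
  - generalize (H b a Ha L). assert (ln a <= ln b).
    { destruct L as [L|L]; [left; apply ln_increasing; lra|rewrite L; lra]. } lra.
  - generalize (H a b Hb ltac:(lra)). assert (ln b <= ln a) by (left; apply ln_increasing; lra). lra.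
Qed.

Lemma Cmod_conj_shift (x w : C) : Rabs (Cmod (x - w)%C - Cmod (x - Cconj w)%C) <= 2 * Rabs (Im w).
Proof.
  assert (H : forall a b : C, Cmod a - Cmod b <= Cmod (a - b)%C) by apply Cmod_triangle_sub.
  assert (E : Cmod ((x - w) - (x - Cconj w))%C = 2 * Rabs (Im w)).
  { replace ((x - w) - (x - Cconj w))%C with (- (Ci * RtoC (2 * Im w)))%C
      by (destruct w; unfold Im; apply injective_projections; simpl; ring).
    rewrite Cmod_opp, Cmod_mult, Cmod_Ci, Cmod_R, Rabs_mult, (Rabs_pos_eq 2) by lra. ring. }
  apply Rabs_le_between. split.
  - generalize (H (x - Cconj w)%C (x - w)%C). rewrite (Cmod_sub_sym (x - Cconj w)), E. lra.
  - generalize (H (x - w)%C (x - Cconj w)%C). rewrite E. lra.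
Qed.

Lemma velocity_ext_loc (gamma : R -> C) (t : R) (w l : C) (d : R) : 0 < d ->
  (forall s, Rabs (s - t) < d -> gamma s = (w + RtoC s * l)%C) -> velocity gamma t = l.
Proof.
  intros Hd H. assert (D : pderiv gamma t l).
  { apply (is_derive_ext_loc (K := R_AbsRing) (V := C_R_NormedModule) (fun s => w + RtoC s * l)%C);
    [|apply pderiv_segment].
    exists (mkposreal d Hd). intros s Hs. symmetry. apply H, Hs. }
  apply pderiv_components in D. destruct D as [D1 D2].
  apply injective_projections; apply is_derive_unique; assumption.
Qed.

Lemma locally_constant_eq (psi : R -> C) (a b : R) : a <= b ->
  (forall t, a <= t <= b -> exists d, 0 < d /\ forall s, Rabs (s - t) < d -> psi s = psi t) ->
  psi b = psi a.
Proof.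
  intros Hab H.
  assert (E : Cmod (psi b - psi a)%C <= 0 - 0).
  { apply (mean_value_inequality psi (fun _ => RtoC 0) (fun _ => 0) (fun _ => 0)); [exact Hab| | |].
    - intros t Ht. destruct (H t Ht) as [d [Hd Hs]]. apply pderiv_iff. intros e He.
      exists d. split; [exact Hd|]. intros s Hst. rewrite (Hs s Hst).
      replace (psi t - psi t - RtoC (s - t) * 0)%C with (RtoC 0) by ring. rewrite Cmod_0.
      generalize (Rabs_pos (s - t)). nra.
    - intros t _. apply (is_derive_const (K := R_AbsRing) (V := R_NormedModule)).
    - intros t _. rewrite Cmod_0. lra. }
  assert (E' : (psi b - psi a)%C = 0).
  { apply Cmod_eq_0. apply Rle_antisym; [lra|apply Cmod_ge_0]. }
  replace (psi b) with ((psi b - psi a) + psi a)%C by ring. rewrite E'. ring.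
Qed.

(** After subtracting the linear part, the derivative dH y - dH w is O(|y - w|) because dH is itself
    differentiable at w; the mean value inequality supplies the second factor |x - w|. *)
Lemma taylor_quadratic (D : C -> Prop) (H : C -> C) (w : C) (r : R) : 0 < r ->
  holo2 D H -> (forall x, Cmod (x - w)%C < r -> D x) ->
  exists (H1 : C) (M r' : R), 0 <= M /\ 0 < r' <= r /\
    forall x, Cmod (x - w)%C < r' ->
      Cmod (H x - H w - (x - w) * H1)%C <= M * (Cmod (x - w)%C * Cmod (x - w)%C).
Proof.
  intros Hr [dH HH] HD.
  destruct (HH w) as [_ [l Hl]].
  { apply HD. replace (w - w)%C with (RtoC 0) by ring. rewrite Cmod_0. exact Hr. }
  destruct (proj1 (cderiv_iff _ _ _) Hl 1 Rlt_0_1) as [d [Hd Hdl]].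
  exists (dH w), (1 + Cmod l), (Rmin r d). split; [|split].
  - generalize (Cmod_ge_0 l). lra.
  - split; [apply Rmin_pos; assumption|apply Rmin_l].
  - intros x Hx.
    destruct (Rmin_Rgt_l _ _ _ Hx) as [Hx1 Hx2].
    replace (H x - H w - (x - w) * dH w)%C with ((H x - dH w * (x - w)) - (H w - dH w * (w - w)))%C by ring.
    rewrite <- Rmult_assoc.
    apply (mean_value_segment (fun y => H y - dH w * (y - w))%C (fun y => dH y - dH w)%C).
    + intros t Ht. apply cderiv_minus; [|apply cderiv_shift]. apply HH, HD.
      replace (w + RtoC t * (x - w) - w)%C with (RtoC t * (x - w))%C by ring.
      rewrite Cmod_mult, Cmod_R, Rabs_pos_eq by lra. generalize (Cmod_ge_0 (x - w)). nra.
    + intros t Ht. set (y := (w + RtoC t * (x - w))%C).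
      assert (Hy : Cmod (y - w) <= Cmod (x - w)).
      { unfold y. replace (w + RtoC t * (x - w) - w)%C with (RtoC t * (x - w))%C by ring.
        rewrite Cmod_mult, Cmod_R, Rabs_pos_eq by lra. generalize (Cmod_ge_0 (x - w)). nra. }
      specialize (Hdl y ltac:(lra)).
      replace (dH y - dH w)%C with ((dH y - dH w - (y - w) * l) + (y - w) * l)%C by ring.
      eapply Rle_trans; [apply Cmod_triangle|]. rewrite Cmod_mult.
      generalize (Cmod_ge_0 l) (Cmod_ge_0 (y - w)). nra.
Qed.

(** Equality of the moduli forces Im a = 0; the imaginary parts then give sin (PI a) = 0. *)
Lemma Cexp_PI_integer (a : C) : Cexp (Ci * PI * a) = Cexp (- (Ci * PI * a)) ->
  exists k : Z, a = RtoC (IZR k).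
Proof.
  intros E. destruct a as [a b]. assert (HPI := PI_RGT_0).
  assert (Eb : b = 0).
  { apply (f_equal Cmod) in E. rewrite !Cmod_Cexp in E. apply exp_inv in E.
    unfold Re in E; simpl in E.
    assert (HH : PI * b = 0) by lra. apply Rmult_integral in HH. lra. }
  subst b. apply (f_equal Im) in E. rewrite !Cexp_Im in E.
  replace (Re (- (Ci * PI * (a, 0)))) with (Re (Ci * PI * (a, 0))) in E by (unfold Re; simpl; ring).
  replace (Im (- (Ci * PI * (a, 0)))) with (- (PI * a)) in E by (unfold Im; simpl; ring).
  replace (Im (Ci * PI * (a, 0))) with (PI * a) in E by (unfold Im; simpl; ring).
  rewrite sin_neg in E.
  assert (Hs : sin (PI * a) = 0).
  { generalize (exp_pos (Re (Ci * PI * (a, 0)))). nra. }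
  destruct (sin_eq_0_0 _ Hs) as [k Hk]. exists k.
  replace (IZR k) with a; [reflexivity|]. apply (Rmult_eq_reg_l PI); lra.
Qed.

Lemma Cmod_Cexp_strip (a w : C) : Rabs (Im w) <= PI ->
  Cmod (Cexp (a * w)) <= exp (Rabs (Im a) * PI) * exp (Re a * Re w).
Proof.
  intros Hw. rewrite Cmod_Cexp, <- exp_plus.
  replace (Re (a * w)) with (Re a * Re w - Im a * Im w) by (unfold Re, Im; simpl; ring).
  assert (H : - (Im a * Im w) <= Rabs (Im a) * PI).
  { eapply Rle_trans; [apply Rle_abs|]. rewrite Rabs_Ropp, Rabs_mult.
    apply Rmult_le_compat_l; [apply Rabs_pos|exact Hw]. }
  apply exp_le_compat. lra.
Qed.

Lemma closed_strip_bound (Phi : C -> C) (a M q : R) :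
  (forall w, Re w < a -> ccont Phi w) ->
  (forall w, Re w < a -> Rabs (Im w) < PI -> Cmod (Phi w) <= M * exp (q * Re w)) ->
  forall w, Re w < a -> Rabs (Im w) <= PI -> Cmod (Phi w) <= M * exp (q * Re w).
Proof.
  intros Hc Hb w Hw Hi. assert (HPI := PI_RGT_0).
  destruct (Rle_lt_or_eq_dec _ _ Hi) as [L|L]; [apply Hb; assumption|].
  apply le_epsilon. intros e He. destruct (Hc w Hw e He) as [d [Hd Hcd]].
  set (t := Rmin (1 / 2) (d / (2 * PI))).
  assert (Ht : 0 < t) by (apply Rmin_pos; [lra|apply Rdiv_lt_0_compat; lra]).
  assert (Ht1 : t <= 1 / 2) by apply Rmin_l.
  assert (Ht2 : t * PI < d).
  { apply Rle_lt_trans with (d / (2 * PI) * PI); [apply Rmult_le_compat_r; [lra|apply Rmin_r]|].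
    replace (d / (2 * PI) * PI) with (d / 2) by (field; lra). lra. }
  set (w' := (Re w, Im w * (1 - t)) : C).
  assert (Hd' : Cmod (w' - w) < d).
  { replace (w' - w)%C with (Ci * RtoC (- (Im w * t)))%C
      by (unfold w'; destruct w; unfold Re, Im; apply injective_projections; simpl; ring).
    rewrite Cmod_mult, Cmod_Ci, Cmod_R, Rabs_Ropp, Rabs_mult, L, (Rabs_pos_eq t) by lra. lra. }
  assert (Hw' : Cmod (Phi w') <= M * exp (q * Re w)).
  { apply (Hb w'); [exact Hw|]. change (Rabs (Im w * (1 - t)) < PI).
    rewrite Rabs_mult, L, (Rabs_pos_eq (1 - t)) by lra. nra. }
  specialize (Hcd w' Hd'). rewrite Cmod_sub_sym in Hcd.
  generalize (Cmod_triangle_sub (Phi w) (Phi w')). lra.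
Qed.

Lemma vanishing_exponential (A M s a : R) : 0 < s ->
  (forall u, u < a -> A <= M * exp (s * u)) -> A <= 0.
Proof.
  intros Hs H. apply le_epsilon. intros e He. rewrite Rplus_0_l.
  destruct (exp_small_left M s e Hs He) as [T HT].
  set (u := Rmin a T - 1).
  assert (u < a) by (unfold u; generalize (Rmin_l a T); lra).
  assert (u < T) by (unfold u; generalize (Rmin_r a T); lra).
  eapply Rle_trans; [apply (H u); assumption|]. left. apply HT. assumption.
Qed.

Lemma ccont_value (F : C -> C) (x l : C) : ccont F x ->
  (forall d, 0 < d -> exists y, Cmod (y - x)%C < d /\ F y = l) -> F x = l.
Proof.
  intros HF H. assert (E : (F x - l)%C = 0).
  { apply Cmod_eq_0. apply Rle_antisym; [|apply Cmod_ge_0]. apply le_epsilon. intros e He.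
    destruct (HF e He) as [d [Hd Hc]]. destruct (H d Hd) as [y [Hy <-]].
    rewrite Cmod_sub_sym, Rplus_0_l. left. apply Hc, Hy. }
  replace (F x) with ((F x - l) + l)%C by ring. rewrite E. ring.
Qed.

Lemma ccont_minus (F H : C -> C) (x : C) : ccont F x -> ccont H x -> ccont (fun y => F y - H y)%C x.
Proof.
  intros HF HH e He. destruct (HF (e / 2) ltac:(lra)) as [d1 [Hd1 G1]].
  destruct (HH (e / 2) ltac:(lra)) as [d2 [Hd2 G2]].
  exists (Rmin d1 d2). split; [apply Rmin_pos; assumption|]. intros y Hy.
  specialize (G1 y (Rlt_Rmin_l _ _ _ Hy)).
  specialize (G2 y (Rlt_Rmin_r _ _ _ Hy)).
  replace (F y - H y - (F x - H x))%C with ((F y - F x) + - (H y - H x))%C by ring.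
  eapply Rle_lt_trans; [apply Cmod_triangle|]. rewrite Cmod_opp. lra.
Qed.

Lemma ccont_const (a x : C) : ccont (fun _ => a) x.
Proof. eapply cderiv_ccont, cderiv_const. Qed.

Lemma Cmod_shift_Re (x : C) (s : R) : Cmod (((Re x + s)%R, Im x) - x)%C = Rabs s.
Proof.
  replace (((Re x + s)%R, Im x) - x)%C with (RtoC s); [apply Cmod_R|].
  destruct x; unfold Re, Im; apply injective_projections; simpl; ring.
Qed.

(** * Branches of f and their primitives *)

Section Data.
Variables (P : nat) (z : nat -> C).
Hypothesis HP : (1 <= P)%nat.
Hypothesis Hz : forall p : nat, (1 <= p <= P)%nat -> 0 < Im (z p).
Hypothesis Hzord : forall p : nat, (1 <= p < P)%nat -> Re (z p) < Re (z (S p)).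

Lemma Re_z_lt (p q : nat) : (1 <= p)%nat -> (p < q)%nat -> (q <= P)%nat -> Re (z p) < Re (z q).
Proof.
  intros Hp Hpq. induction Hpq as [|q Hpq IH]; intros Hq.
  - apply Hzord. lia.
  - eapply Rlt_trans; [apply IH; lia|apply Hzord; lia].
Qed.

Lemma Re_z_le (p q : nat) : (1 <= p)%nat -> (p <= q)%nat -> (q <= P)%nat -> Re (z p) <= Re (z q).
Proof.
  intros Hp Hpq Hq. destruct (Nat.eq_dec p q) as [->|Hne]; [lra|].
  left. apply Re_z_lt; lia.
Qed.

(* Domain of the branch of f whose logarithms at z_1, ..., z_m are cut downwards. *)
Definition domain (m : nat) (x : C) : Prop :=
  forall p : nat, (1 <= p <= P)%nat -> Re x = Re (z p) ->
    ((p <= m)%nat -> Im (z p) < Im x) /\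
    ((m < p)%nat -> - Im (z p) < Im x < Im (z p)).

Lemma up_ray_iff (a x : C) : up_ray a x <-> Re x = Re a /\ Im a <= Im x.
Proof.
  split.
  - intros [t [Ht ->]]. unfold Re, Im; simpl. split; lra.
  - intros [H1 H2]. exists (Im x - Im a). split; [lra|].
    destruct a, x; unfold Re, Im in *; simpl in *. apply injective_projections; simpl; lra.
Qed.

Lemma down_ray_iff (a x : C) : down_ray a x <-> Re x = Re a /\ Im x <= Im a.
Proof.
  split.
  - intros [t [Ht ->]]. unfold Re, Im; simpl. split; lra.
  - intros [H1 H2]. exists (Im a - Im x). split; [lra|].
    destruct a, x; unfold Re, Im in *; simpl in *. apply injective_projections; simpl; lra.
Qed.

Lemma return_region_iff (m : nat) (x : C) : return_region P z m x <-> domain m x.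
Proof.
  split; intros H p Hp; specialize (H p Hp).
  - rewrite !down_ray_iff, up_ray_iff in H. intros HRe.
    assert (HIm : Im (Cconj (z p)) = - Im (z p)) by reflexivity.
    assert (HRc : Re (Cconj (z p)) = Re (z p)) by reflexivity.
    rewrite HIm, HRc in H. destruct H as [H1 H2]. split.
    + intros Hpm. apply Rnot_le_lt. intros Hle. apply (H1 Hpm). split; assumption.
    + intros Hpm. destruct (H2 Hpm) as [H3 H4]. split; apply Rnot_le_lt; intros Hle; tauto.
  - rewrite !down_ray_iff, up_ray_iff.
    assert (HIm : Im (Cconj (z p)) = - Im (z p)) by reflexivity.
    assert (HRc : Re (Cconj (z p)) = Re (z p)) by reflexivity.
    rewrite HIm, HRc. split.
    + intros Hpm [HRe Hle]. destruct (H HRe) as [H1 _]. specialize (H1 Hpm). lra.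
    + intros Hpm. split; intros [HRe Hle]; destruct (H HRe) as [_ H1]; specialize (H1 Hpm); lra.
Qed.

Lemma G_iff (x : C) : G P z x <-> domain 0 x.
Proof.
  rewrite <- return_region_iff. split; intros H p Hp.
  - split; [intros L; exfalso; lia|]. intros _. apply H, Hp.
  - apply (H p Hp). lia.
Qed.

Lemma domain_open (m : nat) (x : C) : domain m x ->
  exists r, 0 < r /\ forall y, Cmod (y - x)%C < r -> domain m y.
Proof.
  intros Hx.
  apply (finite_radius P (fun p y => Re y = Re (z p) ->
    ((p <= m)%nat -> Im (z p) < Im y) /\ ((m < p)%nat -> - Im (z p) < Im y < Im (z p))) x).
  intros p Hp. destruct (Req_dec (Re x) (Re (z p))) as [HRe|HRe].
  - destruct (Hx p Hp HRe) as [H1 H2]. destruct (le_lt_dec p m) as [Hpm|Hpm].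
    + specialize (H1 Hpm). exists (Im x - Im (z p)). split; [lra|]. intros y Hy _.
      apply Im_near in Hy. split; [lra|lia].
    + specialize (H2 Hpm). exists (Rmin (Im x + Im (z p)) (Im (z p) - Im x)).
      split; [apply Rmin_pos; lra|]. intros y Hy _. apply Im_near in Hy.
      generalize (Rmin_l (Im x + Im (z p)) (Im (z p) - Im x)) (Rmin_r (Im x + Im (z p)) (Im (z p) - Im x)).
      intros. split; [lia|lra].
  - exists (Rabs (Re x - Re (z p))). split; [apply Rabs_pos_lt; lra|]. intros y Hy HRy.
    exfalso. generalize (re_le_Cmod (y - x)). change (Re (y - x)) with (Re y - Re x).
    rewrite HRy, Rabs_minus_sym. lra.
Qed.

Lemma domain_left (m : nat) (x : C) : Re x < Re (z 1%nat) -> domain m x.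
Proof.
  intros Hx p Hp HRe. exfalso. assert (Re (z 1%nat) <= Re (z p)) by (apply Re_z_le; lia). lra.
Qed.

Lemma domain_gap (m k : nat) (x : C) : (1 <= k <= P)%nat -> gap P z k x -> domain m x.
Proof.
  intros Hk [H1 H2] p Hp HRe. exfalso. destruct (le_lt_dec p k) as [Hpk|Hpk].
  - assert (Re (z p) <= Re (z k)) by (apply Re_z_le; lia). lra.
  - assert (Re (z (S k)) <= Re (z p)) by (apply Re_z_le; lia).
    assert (Re x < Re (z (S k))) by (apply H2; lia). lra.
Qed.

(** These sets exhaust [domain m] as k grows to P; existence and uniqueness of primitives are proved
    by induction on k. *)
Definition left_domain (m k : nat) (x : C) : Prop :=
  domain m x /\ ((k < P)%nat -> Re x < Re (z (S k))).

(** The part of the domain between the neighbours of z_k. Only the cuts on the vertical line through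
    z_k meet it, which makes it star-shaped; consecutive pieces overlap in the strip between z_k and
    its successor. *)
Definition piece (m k : nat) (x : C) : Prop :=
  domain m x /\ ((1 < k)%nat -> Re (z (pred k)) < Re x) /\ ((k < P)%nat -> Re x < Re (z (S k))).

(** A point of the line through z_k that sees the whole piece: above z_k if the cut there runs
    downwards, and on the real axis, between z_k and its conjugate, if two cuts leave only that
    segment. *)
Definition center (m k : nat) : C :=
  (Re (z k), if (k <=? m)%nat then Im (z k) + 1 else 0).

Lemma piece_open (m k : nat) (x : C) : piece m k x ->
  exists r, 0 < r /\ forall y, Cmod (y - x)%C < r -> piece m k y.
Proof.
  intros [H1 [H2 H3]]. destruct (domain_open m x H1) as [r [Hr H]].
  set (r1 := if (1 <? k)%nat then Re x - Re (z (pred k)) else 1).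
  set (r2 := if (k <? P)%nat then Re (z (S k)) - Re x else 1).
  assert (Hr1 : 0 < r1) by (unfold r1; destruct (Nat.ltb_spec 1 k) as [L|L]; [specialize (H2 L)|]; lra).
  assert (Hr2 : 0 < r2) by (unfold r2; destruct (Nat.ltb_spec k P) as [L|L]; [specialize (H3 L)|]; lra).
  exists (Rmin r (Rmin r1 r2)). split; [repeat apply Rmin_pos; assumption|]. intros y Hy.
  generalize (Rmin_l r (Rmin r1 r2)) (Rmin_r r (Rmin r1 r2)) (Rmin_l r1 r2) (Rmin_r r1 r2). intros.
  split; [apply H; lra|]. apply Re_near in Hy. unfold r1, r2 in *. split; intros L.
  - destruct (Nat.ltb_spec 1 k); [lra|lia].
  - destruct (Nat.ltb_spec k P); [lra|lia].
Qed.

Lemma center_piece (m k : nat) : (1 <= k <= P)%nat -> piece m k (center m k).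
Proof.
  intros Hk. split; [|split].
  - intros p Hp HRe. change (Re (z k) = Re (z p)) in HRe.
    change (Im (center m k)) with (if (k <=? m)%nat then Im (z k) + 1 else 0).
    assert (p = k).
    { destruct (Nat.lt_total p k) as [L|[E|L]]; [|exact E|].
      - assert (Re (z p) < Re (z k)) by (apply Re_z_lt; lia). exfalso; lra.
      - assert (Re (z k) < Re (z p)) by (apply Re_z_lt; lia). exfalso; lra. }
    subst p. assert (0 < Im (z k)) by (apply Hz; lia).
    destruct (Nat.leb_spec k m); split; intros; try lia; lra.
  - intros L. apply Re_z_lt; lia.
  - intros L. apply Re_z_lt; lia.
Qed.

Lemma piece_star (m k : nat) (x : C) (t : R) : (1 <= k <= P)%nat -> piece m k x -> 0 <= t <= 1 ->
  piece m k (center m k + RtoC t * (x - center m k))%C.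
Proof.
  intros Hk [H1 [H2 H3]] Ht.
  destruct (center_piece m k Hk) as [C1 [C2 C3]].
  set (w := center m k) in *. set (y := (w + RtoC t * (x - w))%C).
  assert (ERe : Re y = Re w + t * (Re x - Re w)) by apply Re_segment.
  assert (EIm : Im y = Im w + t * (Im x - Im w)) by apply Im_segment.
  assert (Hl : (1 < k)%nat -> Re (z (pred k)) < Re y).
  { intros L. specialize (H2 L). specialize (C2 L). rewrite ERe. apply convex_gt; assumption. }
  assert (Hr : (k < P)%nat -> Re y < Re (z (S k))).
  { intros L. specialize (H3 L). specialize (C3 L). rewrite ERe. apply convex_lt; assumption. }
  split; [|split; assumption].
  intros p Hp HRe.
  assert (p = k).
  { destruct (Nat.lt_total p k) as [L|[E|L]]; [|exact E|].
    - assert (Re (z p) <= Re (z (pred k))) by (apply Re_z_le; lia).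
      specialize (Hl ltac:(lia)). exfalso; lra.
    - assert (Re (z (S k)) <= Re (z p)) by (apply Re_z_le; lia).
      specialize (Hr ltac:(lia)). exfalso; lra. }
  subst p. assert (Ew : Re w = Re (z k)) by reflexivity.
  destruct (C1 k Hk Ew) as [C4 C5].
  (* The segment from the center meets the line that carries the cuts only at its first point,
     unless it lies in that line. *)
  assert (Hcase : t = 0 \/ Re x = Re (z k)).
  { rewrite ERe, Ew in HRe.
    assert (HH : t * (Re x - Re (z k)) = 0) by lra. apply Rmult_integral in HH. lra. }
  rewrite EIm. destruct Hcase as [->|Hx].
  - rewrite Rmult_0_l, Rplus_0_r. split; assumption.
  - destruct (H1 k Hk Hx) as [H4 H5]. split.
    + intros L. apply convex_gt; auto.
    + intros L. specialize (H5 L). specialize (C5 L). split; [apply convex_gt|apply convex_lt]; tauto.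
Qed.

Lemma strip_point (k : nat) : (S k <= P)%nat ->
  exists x0 : C, Re x0 < Re (z (S k)) /\ ((1 <= k)%nat -> Re (z k) < Re x0).
Proof.
  intros Hk. destruct k as [|k].
  - exists (Re (z 1%nat) - 1, 0). simpl. split; [lra|lia].
  - exists ((Re (z (S k)) + Re (z (S (S k)))) / 2, 0).
    change (Re (_, 0)) with ((Re (z (S k)) + Re (z (S (S k)))) / 2).
    assert (Re (z (S k)) < Re (z (S (S k)))) by (apply Re_z_lt; lia). split; intros; lra.
Qed.

Lemma strip_sub (m k : nat) (x : C) : (S k <= P)%nat ->
  Re x < Re (z (S k)) -> ((1 <= k)%nat -> Re (z k) < Re x) -> piece m (S k) x /\ left_domain m k x.
Proof.
  intros Hk H1 H2.
  assert (HR : domain m x).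
  { intros p Hp HRe. exfalso. destruct (le_lt_dec p k) as [Hpk|Hpk].
    - assert (Re (z p) <= Re (z k)) by (apply Re_z_le; lia). specialize (H2 ltac:(lia)). lra.
    - assert (Re (z (S k)) <= Re (z p)) by (apply Re_z_le; lia). lra. }
  split; [split; [exact HR|split]|split; [exact HR|auto]].
  - intros L. apply H2. lia.
  - intros L. assert (Re (z (S k)) < Re (z (S (S k)))) by (apply Re_z_lt; lia). lra.
Qed.

Lemma strip_primitive_unique (m k : nat) (F H g : C -> C) (x0 x : C) : (S k <= P)%nat ->
  (forall x, left_domain m k x -> cderiv F x (g x)) ->
  (forall x, piece m (S k) x -> cderiv H x (g x)) ->
  Re x0 < Re (z (S k)) -> ((1 <= k)%nat -> Re (z k) < Re x0) ->
  Re x < Re (z (S k)) -> ((1 <= k)%nat -> Re (z k) < Re x) ->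
  (F x - H x)%C = (F x0 - H x0)%C.
Proof.
  intros Hk HF HH A1 A2 B1 B2. apply (primitive_unique_segment F H g x0 x). intros t Ht.
  assert (Hs : piece m (S k) (x0 + RtoC t * (x - x0))%C /\ left_domain m k (x0 + RtoC t * (x - x0))%C).
  { apply strip_sub; [exact Hk| |].
    - rewrite Re_segment. apply convex_lt; assumption.
    - intros L. rewrite Re_segment. apply convex_gt; auto. }
  split; [apply HF, Hs|apply HH, Hs].
Qed.

Lemma left_domain_S (m k : nat) (x : C) : (S k <= P)%nat -> left_domain m (S k) x ->
  left_domain m k x \/ (Re (z (S k)) <= Re x /\ piece m (S k) x).
Proof.
  intros Hk [H1 H2]. destruct (Rlt_le_dec (Re x) (Re (z (S k)))) as [L|L].
  - left. split; [exact H1|auto].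
  - right. split; [exact L|]. split; [exact H1|]. split; [|exact H2].
    intros K. assert (Re (z k) < Re (z (S k))) by (apply Re_z_lt; lia). simpl. lra.
Qed.

(** The primitive on the next star-shaped piece is shifted by a constant [a], so that it agrees with
    the previous one on the convex strip where both are defined. The point [x0] of the strip fixes
    [a]. *)
Lemma domain_primitive_left (m : nat) (g : C -> C) : holo2 (domain m) g ->
  forall k, (k <= P)%nat -> exists F, forall x, left_domain m k x -> cderiv F x (g x).
Proof.
  intros [dg Hg]. induction k as [|k IH]; intros Hk.
  - destruct (star_shaped_primitive (fun x => Re x < Re (z 1%nat)) (z 1%nat - 1)%C g dg) as [F HF].
    + intros x Hx. exists (Re (z 1%nat) - Re x). split; [lra|]. intros y Hy. apply Re_near in Hy. lra.
    + intros x t Hx Ht. rewrite Re_segment.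
      assert (E : Re (z 1%nat - 1)%C = Re (z 1%nat) - 1) by (unfold Re; simpl; ring). apply convex_lt; lra.
    + intros x Hx. apply Hg, domain_left, Hx.
    + intros x Hx. destruct (Hg x (domain_left m x Hx)) as [_ [l Hl]]. eapply cderiv_ccont, Hl.
    + exists F. intros x [_ Hx]. apply HF, Hx. lia.
  - destruct IH as [F1 H1]; [lia|].
    destruct (star_shaped_primitive (piece m (S k)) (center m (S k)) g dg) as [F2 H2].
    + apply piece_open.
    + intros x t Hx Ht. apply piece_star; [lia|exact Hx|exact Ht].
    + intros x [Hx _]. apply Hg, Hx.
    + intros x [Hx _]. destruct (Hg x Hx) as [_ [l Hl]]. eapply cderiv_ccont, Hl.
    + destruct (strip_point k Hk) as [x0 [A1 A2]].
      set (a := (F1 x0 - F2 x0)%C).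
      exists (fun x => if Rlt_dec (Re x) (Re (z (S k))) then F1 x else (F2 x + a)%C).
      intros x Hx. destruct (left_domain_S m k x Hk Hx) as [HL|[HL HPc]].
      * assert (L : Re x < Re (z (S k))) by (apply HL; lia).
        apply (cderiv_ext_loc F1 _ x _ (Re (z (S k)) - Re x)); [lra| |apply H1, HL].
        intros y Hy. apply Re_near in Hy. destruct (Rlt_dec (Re y) (Re (z (S k)))); [reflexivity|lra].
      * assert (Hr : exists r, 0 < r /\ ((1 <= k)%nat -> r <= Re x - Re (z k))).
        { destruct k as [|k]; [exists 1; split; [lra|lia]|].
          exists (Re x - Re (z (S k))).
          assert (Re (z (S k)) < Re (z (S (S k)))) by (apply Re_z_lt; lia).
          split; intros; lra. }
        destruct Hr as [r [Hr Hrk]].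
        apply (cderiv_ext_loc (fun y => F2 y + a)%C _ x _ r); [exact Hr| |].
        -- intros y Hy. destruct (Rlt_dec (Re y) (Re (z (S k)))) as [L|L]; [|reflexivity].
           assert (E : (F1 y - F2 y)%C = a).
           { apply (strip_primitive_unique m k F1 F2 g x0 y); try assumption.
             intros K. specialize (Hrk K). apply Re_near in Hy. lra. }
           rewrite <- E. ring.
        -- eapply cderiv_eq; [apply cderiv_plus; [apply H2, HPc|apply cderiv_const]|]. ring.
Qed.

Lemma domain_primitive (m : nat) (g : C -> C) : holo2 (domain m) g ->
  exists F, forall x, domain m x -> cderiv F x (g x).
Proof.
  intros Hg. destruct (domain_primitive_left m g Hg P (le_n P)) as [F HF].
  exists F. intros x Hx. apply HF. split; [exact Hx|lia].
Qed.

Lemma left_domain_primitive_unique (m : nat) (F H g : C -> C) (k : nat) : (k <= P)%nat ->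
  (forall x, left_domain m k x -> cderiv F x (g x)) ->
  (forall x, left_domain m k x -> cderiv H x (g x)) ->
  exists a, forall x, left_domain m k x -> (F x - H x)%C = a.
Proof.
  induction k as [|k IH]; intros Hk HF HH.
  - exists (F (z 1%nat - 1)%C - H (z 1%nat - 1)%C)%C. intros x Hx.
    apply (primitive_unique_segment F H g). intros t Ht.
    assert (HL : left_domain m 0 (z 1%nat - 1 + RtoC t * (x - (z 1%nat - 1)))%C).
    { assert (L : Re (z 1%nat - 1 + RtoC t * (x - (z 1%nat - 1)))%C < Re (z 1%nat)).
      { rewrite Re_segment. destruct Hx as [_ Hx]. specialize (Hx ltac:(lia)).
        assert (E : Re (z 1%nat - 1)%C = Re (z 1%nat) - 1) by (unfold Re; simpl; ring). apply convex_lt; lra. }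
      split; [apply domain_left, L|intros _; exact L]. }
    split; [apply HF, HL|apply HH, HL].
  - assert (Hsub : forall x, left_domain m k x -> left_domain m (S k) x).
    { intros x [H1 H2]. split; [exact H1|]. intros L.
      assert (Re (z (S k)) < Re (z (S (S k)))) by (apply Re_z_lt; lia).
      specialize (H2 ltac:(lia)). lra. }
    destruct IH as [a Ha]; [lia|auto|auto|].
    assert (Hps : forall x, piece m (S k) x -> left_domain m (S k) x).
    { intros x [H1 [_ H2]]. split; assumption. }
    destruct (strip_point k Hk) as [x0 [A1 A2]].
    destruct (strip_sub m k x0 Hk A1 A2) as [Hx0 Hx0'].
    assert (Hc : forall x, piece m (S k) x -> (F x - H x)%C = (F (center m (S k)) - H (center m (S k)))%C).
    { intros x Hx. apply (primitive_unique_segment F H g). intros t Ht.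
      split; [apply HF|apply HH]; apply Hps, piece_star; try assumption; lia. }
    exists a. intros x Hx. destruct (left_domain_S m k x Hk Hx) as [HL|[_ HPc]]; [apply Ha, HL|].
    rewrite (Hc x HPc), <- (Hc x0 Hx0). apply Ha, Hx0'.
Qed.

(** * The branches of the integrand and their primitives *)

Variables (eps : R) (c : nat -> C) (lambda : R) (v : nat -> C).
Hypothesis Heps : 0 < eps.
Hypothesis Hc0 : forall p : nat, (1 <= p <= P)%nat -> c p <> RtoC 0.
Hypothesis Hlambda : 0 < lambda.

(* Moving the cut of the logarithm downwards leaves its values to the right of z_p unchanged,
   hence the constant 3 pi i/2 instead of pi i/2. *)
Definition log_branch (m p : nat) (x : C) : C :=
  if (p <=? m)%nat then (Log (- Ci * (x - z p)) + 3 * PI * Ci / 2)%C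
  else (Log (Ci * (x - z p)) + PI * Ci / 2)%C.

Definition f_branch_term (m p : nat) (x : C) : C :=
  (c p * log_branch m p x + Cconj (c p) * (Log (- Ci * (x - Cconj (z p))) - PI * Ci / 2))%C.

Definition f_branch (m : nat) (x : C) : C := Csum P (fun p => f_branch_term m p x).

Definition exp_branch (m : nat) (x : C) : C := Cexp (- Ci * (lambda * x + f_branch m x) / eps).

Definition rational_part (x : C) : C := (Csum P (fun p => v p / (x - z p)) + lambda)%C.

Definition integrand_branch (m : nat) (x : C) : C := (exp_branch m x * rational_part x)%C.

Lemma f_branch_0 (x : C) : f_branch 0 x = f P c z x.
Proof.
  apply Csum_ext. intros p Hp. unfold f_branch_term, log_branch.
  destruct (Nat.leb_spec p 0); [lia|reflexivity].
Qed.

Lemma slit_mCi (x w : C) : (Re x = Re w -> Im w < Im x) -> slit (- Ci * (x - w)).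
Proof.
  intros H. unfold slit.
  assert (E1 : Re (- Ci * (x - w)) = Im x - Im w) by (unfold Re, Im; simpl; ring).
  assert (E2 : Im (- Ci * (x - w)) = Re w - Re x) by (unfold Re, Im; simpl; ring).
  rewrite E1, E2. destruct (Req_dec (Re x) (Re w)) as [E|E]; [left; specialize (H E)|right]; lra.
Qed.

Lemma slit_Ci (x w : C) : (Re x = Re w -> Im x < Im w) -> slit (Ci * (x - w)).
Proof.
  intros H. unfold slit.
  assert (E1 : Re (Ci * (x - w)) = Im w - Im x) by (unfold Re, Im; simpl; ring).
  assert (E2 : Im (Ci * (x - w)) = Re x - Re w) by (unfold Re, Im; simpl; ring).
  rewrite E1, E2. destruct (Req_dec (Re x) (Re w)) as [E|E]; [left; specialize (H E)|right]; lra.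
Qed.

Lemma domain_slit (m p : nat) (x : C) : (1 <= p <= P)%nat -> domain m x ->
  ((p <= m)%nat -> slit (- Ci * (x - z p))) /\ ((m < p)%nat -> slit (Ci * (x - z p))) /\
  slit (- Ci * (x - Cconj (z p))).
Proof.
  intros Hp Hx. assert (H0 := Hz p Hp). specialize (Hx p Hp). repeat split.
  - intros L. apply slit_mCi. intros E. apply Hx; assumption.
  - intros L. apply slit_Ci. intros E. apply Hx; assumption.
  - apply slit_mCi. intros E. change (Re (Cconj (z p))) with (Re (z p)) in E.
    change (Im (Cconj (z p))) with (- Im (z p)).
    destruct (Hx E) as [H1 H2]. destruct (le_lt_dec p m) as [L|L].
    + specialize (H1 L). lra.
    + specialize (H2 L). lra.
Qed.

Lemma domain_neq (m p : nat) (x : C) : (1 <= p <= P)%nat -> domain m x ->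
  (x - z p)%C <> 0 /\ (x - Cconj (z p))%C <> 0.
Proof.
  intros Hp Hx. destruct (domain_slit m p x Hp Hx) as [H1 [H2 H3]].
  assert (E : forall a w : C, slit (a * w) -> w <> 0).
  { intros a w Hs ->. apply (slit_neq_0 _ Hs). ring. }
  split; [|eapply E, H3].
  destruct (le_lt_dec p m) as [L|L]; [eapply E, H1, L|eapply E, H2, L].
Qed.

Lemma cderiv_Log_shift (a w x : C) : slit (a * (x - w)) ->
  cderiv (fun y => Log (a * (y - w))) x (/ (x - w))%C.
Proof.
  intros Hs. assert (H0 := slit_neq_0 _ Hs).
  eapply cderiv_eq.
  - apply (cderiv_comp Log (fun y => a * (y - w))%C); [apply cderiv_Log, Hs|apply cderiv_shift].
  - cbv beta. field. split; intros E; apply H0; rewrite E; ring.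
Qed.

Lemma cderiv_plus_const (F : C -> C) (a x l : C) :
  cderiv F x l -> cderiv (fun y => F y + a)%C x l.
Proof.
  intros H. eapply cderiv_eq; [apply cderiv_plus; [exact H|apply cderiv_const]|]. ring.
Qed.

Lemma cderiv_scal (F : C -> C) (a x l : C) :
  cderiv F x l -> cderiv (fun y => a * F y)%C x (a * l)%C.
Proof.
  intros H. eapply cderiv_eq; [apply cderiv_mult; [apply cderiv_const|exact H]|]. cbv beta. ring.
Qed.

Lemma cderiv_f_branch (m : nat) (x : C) : domain m x -> cderiv (f_branch m) x (u0 P c z x).
Proof.
  intros Hx. unfold f_branch, u0. apply (cderiv_Csum P (fun p => f_branch_term m p)
    x (fun p => c p / (x - z p) + Cconj (c p) / (x - Cconj (z p)))%C).
  intros p Hp. destruct (domain_slit m p x Hp Hx) as [H1 [H2 H3]].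
  unfold f_branch_term. apply cderiv_plus; apply cderiv_scal.
  - unfold log_branch. destruct (Nat.leb_spec p m) as [L|L]; apply cderiv_plus_const;
    apply cderiv_Log_shift; auto.
  - apply (cderiv_plus_const _ (- (PI * Ci / 2))%C). apply cderiv_Log_shift, H3.
Qed.

Lemma holo2_shift (D : C -> Prop) (a w : C) : holo2 D (fun x => a * (x - w))%C.
Proof.
  apply holo2_mult; [apply holo2_const|]. apply holo2_minus; [apply holo2_id|apply holo2_const].
Qed.

Lemma holo2_f_branch_term (D : C -> Prop) (m p : nat) :
  (forall x, D x -> ((p <= m)%nat -> slit (- Ci * (x - z p))) /\ ((m < p)%nat -> slit (Ci * (x - z p)))
    /\ slit (- Ci * (x - Cconj (z p)))) ->
  holo2 D (f_branch_term m p).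
Proof.
  intros H. unfold f_branch_term, log_branch.
  apply holo2_plus; (apply holo2_mult; [apply holo2_const|]).
  - destruct (Nat.leb_spec p m) as [L|L];
    (apply holo2_plus; [|apply holo2_const]); (apply holo2_Log; [|apply holo2_shift]);
    intros x Hx; apply H; assumption.
  - apply holo2_minus; [|apply holo2_const]. apply holo2_Log; [|apply holo2_shift].
    intros x Hx. apply H, Hx.
Qed.

Lemma holo2_f_branch (m : nat) : holo2 (domain m) (f_branch m).
Proof.
  unfold f_branch. apply holo2_Csum. intros p Hp. apply holo2_f_branch_term.
  intros x Hx. apply domain_slit; assumption.
Qed.

Lemma holo2_exp_branch_of (D : C -> Prop) (F : C -> C) : holo2 D F ->
  holo2 D (fun x => Cexp (- Ci * (lambda * x + F x) / eps)).
Proof.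
  intros H. apply holo2_Cexp. unfold Cdiv. apply holo2_mult; [|apply holo2_const].
  apply holo2_mult; [apply holo2_const|]. apply holo2_plus; [|exact H].
  apply holo2_mult; [apply holo2_const|apply holo2_id].
Qed.

Lemma holo2_exp_branch (m : nat) : holo2 (domain m) (exp_branch m).
Proof. apply holo2_exp_branch_of, holo2_f_branch. Qed.

Lemma holo2_frac (D : C -> Prop) (a w : C) : (forall x, D x -> (x - w)%C <> 0) ->
  holo2 D (fun x => a / (x - w))%C.
Proof.
  intros H. unfold Cdiv. apply holo2_mult; [apply holo2_const|].
  apply holo2_inv; [exact H|]. apply holo2_minus; [apply holo2_id|apply holo2_const].
Qed.

Lemma holo2_integrand_branch (m : nat) : holo2 (domain m) (integrand_branch m).
Proof.
  unfold integrand_branch. apply holo2_mult; [apply holo2_exp_branch|]. unfold rational_part.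
  apply holo2_plus; [|apply holo2_const].
  apply (holo2_Csum _ P (fun p x => v p / (x - z p))%C). intros p Hp.
  apply holo2_frac. intros x Hx. apply (domain_neq m p x Hp Hx).
Qed.

Lemma exp_branch_neq_0 (m : nat) (x : C) : exp_branch m x <> 0.
Proof. apply Cexp_neq_0. Qed.

Lemma f_branch_term_other (k p : nat) (x : C) : p <> S k -> f_branch_term (S k) p x = f_branch_term k p x.
Proof.
  intros Hp. unfold f_branch_term, log_branch.
  destruct (Nat.leb_spec p (S k)), (Nat.leb_spec p k); try lia; reflexivity.
Qed.

Lemma f_branch_step (k : nat) (x : C) : (S k <= P)%nat ->
  (f_branch (S k) x - f_branch k x)%C = (f_branch_term (S k) (S k) x - f_branch_term k (S k) x)%C.
Proof.
  intros Hk. unfold f_branch.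
  rewrite (Csum_extract P (S k) (fun p => f_branch_term (S k) p x)) by lia.
  rewrite (Csum_extract P (S k) (fun p => f_branch_term k p x)) by lia.
  rewrite (Csum_ext P (fun p => if Nat.eqb p (S k) then RtoC 0 else f_branch_term (S k) p x)
    (fun p => if Nat.eqb p (S k) then RtoC 0 else f_branch_term k p x)); [ring|].
  intros p Hp. destruct (Nat.eqb_spec p (S k)); [reflexivity|apply f_branch_term_other; assumption].
Qed.

Lemma Im_Ci_mult (w : C) : Im (Ci * w) = Re w.
Proof. unfold Re, Im; simpl; ring. Qed.

Lemma f_branch_right (k : nat) (x : C) : (S k <= P)%nat -> Re (z (S k)) < Re x -> f_branch (S k) x = f_branch k x.
Proof.
  intros Hk Hx. assert (E := f_branch_step k x Hk).
  replace (f_branch (S k) x) with ((f_branch (S k) x - f_branch k x) + f_branch k x)%C by ring. rewrite E.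
  unfold f_branch_term, log_branch.
  destruct (Nat.leb_spec (S k) (S k)); [|lia]. destruct (Nat.leb_spec (S k) k); [lia|].
  rewrite (Log_opp_pos (Ci * (x - z (S k)))).
  2:{ rewrite Im_Ci_mult. change (0 < Re x - Re (z (S k))). lra. }
  replace (- (Ci * (x - z (S k))))%C with (- Ci * (x - z (S k)))%C by ring.
  field.
Qed.

Lemma f_branch_left (k : nat) (x : C) : (S k <= P)%nat -> Re x < Re (z (S k)) ->
  f_branch (S k) x = (f_branch k x + 2 * PI * Ci * c (S k))%C.
Proof.
  intros Hk Hx. assert (E := f_branch_step k x Hk).
  replace (f_branch (S k) x) with ((f_branch (S k) x - f_branch k x) + f_branch k x)%C by ring. rewrite E.
  unfold f_branch_term, log_branch.
  destruct (Nat.leb_spec (S k) (S k)); [|lia]. destruct (Nat.leb_spec (S k) k); [lia|].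
  rewrite (Log_opp_neg (Ci * (x - z (S k)))).
  2:{ rewrite Im_Ci_mult. change (Re x - Re (z (S k)) < 0). lra. }
  replace (- (Ci * (x - z (S k))))%C with (- Ci * (x - z (S k)))%C by ring.
  field.
Qed.

Lemma f_branch_gap (m k : nat) (x : C) : (m <= k)%nat -> (k <= P)%nat ->
  ((1 <= k)%nat -> Re (z k) < Re x) -> f_branch m x = f_branch 0 x.
Proof.
  intros Hmk HkP Hx. induction m as [|m IH]; [reflexivity|].
  rewrite f_branch_right; [apply IH; lia|lia|].
  eapply Rle_lt_trans; [|apply Hx; lia]. apply Re_z_le; lia.
Qed.

Lemma eps_neq_0 : RtoC eps <> 0.
Proof. intros E. apply (f_equal Re) in E. simpl in E. lra. Qed.

(** The factor gained by e^{-ih/eps} when f gains 2 pi i c_k. *)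
Definition jump (k : nat) : C := Cexp (2 * PI * c k / eps).

Lemma exp_branch_left (k : nat) (x : C) : (S k <= P)%nat -> Re x < Re (z (S k)) ->
  exp_branch (S k) x = (jump (S k) * exp_branch k x)%C.
Proof.
  intros Hk Hx. unfold exp_branch, jump. rewrite f_branch_left by assumption. rewrite <- Cexp_plus. f_equal.
  assert (E := Ci_sqr).
  transitivity ((- (Ci * Ci) * (2 * PI * c (S k)) + - Ci * (lambda * x + f_branch k x)) / eps)%C.
  - unfold Cdiv. ring.
  - rewrite E. field. apply eps_neq_0.
Qed.

Lemma exp_branch_gap (m k : nat) (x : C) : (m <= k)%nat -> (k <= P)%nat ->
  ((1 <= k)%nat -> Re (z k) < Re x) -> exp_branch m x = exp_branch 0 x.
Proof. intros Hmk HkP Hx. unfold exp_branch. rewrite (f_branch_gap m k) by assumption. reflexivity. Qed.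

(** The modulus of e^{-if/eps} is e^{Im f/eps}, so Im f has to be bounded far below. Each pair of
    conjugate terms contributes Re c_p times a sum of arguments and Im c_p times the difference of
    two logarithms of moduli; both stay bounded. The decay is then that of e^{-i lambda x/eps}. *)
Lemma integrand_branch_bound (m : nat) : exists M T, forall x, Im x < T ->
  Cmod (integrand_branch m x) <= M * exp (lambda / eps * Im x).
Proof.
  destruct (finite_upper_bound P (fun p => Im (z p))) as [B [HB0 HB]].
  (* Below T every point is at distance at least 1 from all z_p and their conjugates, so the
     fractions are bounded by |v_p| and [ln_ratio_bound] applies. *)
  set (T := - 1 - B). set (S := fun x : C => Im x < T).
  assert (Hlow : forall (x w : C), Im w <= B -> - Im w <= B -> S x ->
    1 <= Cmod (x - w)%C /\ 1 <= Cmod (x - Cconj w)%C).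
  { intros x w Hw1 Hw2 Hx. unfold S, T in Hx. split; (eapply Rle_trans; [|apply im_le_Cmod]).
    - change (1 <= Rabs (Im x - Im w)). rewrite Rabs_left; lra.
    - change (1 <= Rabs (Im x - - Im w)). rewrite Rabs_left; lra. }
  assert (Hq : exists M, forall x, S x -> Cmod (Csum P (fun p => v p / (x - z p))%C) <= M).
  { apply (Csum_bounded P S (fun p x => v p / (x - z p))%C). intros p Hp. exists (Cmod (v p)).
    intros x Hx. assert (Hzp := Hz p Hp). assert (HBp := HB p Hp).
    destruct (Hlow x (z p)) as [H1 _]; [lra|lra|exact Hx|].
    rewrite Cmod_div by (apply Cmod_gt_0; lra). apply Rle_div_l; [lra|].
    generalize (Cmod_ge_0 (v p)). nra. }
  assert (Hf : exists M, forall x, S x -> Rabs (Im (f_branch m x)) <= M).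
  { apply (Csum_Im_bounded P S (fun p x => f_branch_term m p x)). intros p Hp.
    assert (Hzp := Hz p Hp). assert (HBp := HB p Hp).
    exists (Rabs (Re (c p)) * (5 * PI) + Rabs (Im (c p)) * (2 * Im (z p))).
    intros x Hx. destruct (Hlow x (z p)) as [H1 H2]; [lra|lra|exact Hx|].
    set (L2 := Log (- Ci * (x - Cconj (z p)))).
    assert (HL2 : Re L2 = ln (Cmod (x - Cconj (z p))) /\ - PI <= Im L2 <= PI).
    { split.
      - unfold L2, Log, Re. simpl. rewrite Cmod_mult, Cmod_opp, Cmod_Ci. f_equal. ring.
      - apply Carg_bound. intros E. apply (f_equal Cmod) in E.
        rewrite Cmod_mult, Cmod_opp, Cmod_Ci, Cmod_0 in E. lra. }
    assert (HL1 : Re (log_branch m p x) = ln (Cmod (x - z p)) /\ - PI <= Im (log_branch m p x) <= 3 * PI).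
    { assert (HPI := PI_RGT_0). unfold log_branch. destruct (p <=? m)%nat.
      - assert (Hn : (- Ci * (x - z p))%C <> 0).
        { intros E. apply (f_equal Cmod) in E. rewrite Cmod_mult, Cmod_opp, Cmod_Ci, Cmod_0 in E. lra. }
        assert (Hc := Carg_bound _ Hn). split.
        + transitivity (ln (Cmod (- Ci * (x - z p)))); [unfold Re, Log; simpl; field|].
          rewrite Cmod_mult, Cmod_opp, Cmod_Ci. f_equal. ring.
        + replace (Im (Log (- Ci * (x - z p)) + 3 * PI * Ci / 2)%C) with
            (Carg (- Ci * (x - z p)) + 3 * PI / 2) by (unfold Im, Log; simpl; field). lra.
      - assert (Hn : (Ci * (x - z p))%C <> 0).
        { intros E. apply (f_equal Cmod) in E. rewrite Cmod_mult, Cmod_Ci, Cmod_0 in E. lra. }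
        assert (Hc := Carg_bound _ Hn). split.
        + transitivity (ln (Cmod (Ci * (x - z p)))); [unfold Re, Log; simpl; field|].
          rewrite Cmod_mult, Cmod_Ci. f_equal. ring.
        + replace (Im (Log (Ci * (x - z p)) + PI * Ci / 2)%C) with
            (Carg (Ci * (x - z p)) + PI / 2) by (unfold Im, Log; simpl; field). lra. }
    destruct HL1 as [R1 B1]. destruct HL2 as [R2 B2].
    replace (Im (f_branch_term m p x)) with
      (Re (c p) * (Im (log_branch m p x) + Im L2 - PI / 2) + Im (c p) * (Re (log_branch m p x) - Re L2)).
    2:{ unfold f_branch_term. fold L2. unfold Re, Im; simpl. field. }
    eapply Rle_trans; [apply Rabs_triang|]. rewrite !Rabs_mult.
    apply Rplus_le_compat; (apply Rmult_le_compat_l; [apply Rabs_pos|]).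
    - assert (HPI := PI_RGT_0). apply Rabs_le_between. lra.
    - rewrite R1, R2. apply ln_ratio_bound; [exact H1|exact H2|lra|].
      eapply Rle_trans; [apply Cmod_conj_shift|]. rewrite Rabs_pos_eq by lra. lra. }
  destruct Hq as [M1 HM1]. destruct Hf as [M2 HM2].
  exists (exp (M2 / eps) * (M1 + lambda)), T. intros x Hx. specialize (HM1 x Hx). specialize (HM2 x Hx).
  unfold integrand_branch. rewrite Cmod_mult.
  replace (exp (M2 / eps) * (M1 + lambda) * exp (lambda / eps * Im x))
    with ((exp (M2 / eps) * exp (lambda / eps * Im x)) * (M1 + lambda)) by ring.
  apply Rmult_le_compat; try apply Cmod_ge_0.
  - unfold exp_branch. rewrite Cmod_Cexp, <- exp_plus.
    replace (Re (- Ci * (lambda * x + f_branch m x) / eps)%C) with (Im (f_branch m x) / eps + lambda / eps * Im x).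
    2:{ unfold Re, Im; simpl. field. lra. }
    assert (Im (f_branch m x) / eps <= M2 / eps).
    { apply Rmult_le_compat_r; [left; apply Rinv_0_lt_compat, Heps|].
      eapply Rle_trans; [apply Rle_abs|exact HM2]. }
    apply exp_le_compat. lra.
  - unfold rational_part. eapply Rle_trans; [apply Cmod_triangle|]. rewrite Cmod_R, (Rabs_pos_eq lambda) by lra. lra.
Qed.

(** The limit is required on every vertical ray of G_0, since a contour may originate along any of
    them. *)
Definition is_primitive (m : nat) (I : C -> C) : Prop :=
  (forall x, domain m x -> cderiv I x (integrand_branch m x)) /\
  (forall a, a < Re (z 1%nat) -> clim (fun t => I (a, t)) (Rbar_locally m_infty) (RtoC 0)).

Lemma primitive_exists (m : nat) : exists I, is_primitive m I.
Proof.
  destruct (domain_primitive m (integrand_branch m) (holo2_integrand_branch m)) as [F HF].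
  destruct (integrand_branch_bound m) as [M [T HM]].
  set (s := lambda / eps). assert (Hs : 0 < s) by (apply Rdiv_lt_0_compat; assumption).
  assert (EIm : forall w, Im (Ci * w) = Re w) by apply Im_Ci_mult.
  assert (ERe : forall w, Re (Ci * w) = - Im w) by (intros w; unfold Re, Im; simpl; ring).
  assert (HR : forall w, - Im w < Re (z 1%nat) -> domain m (Ci * w)).
  { intros w Hw. apply domain_left. rewrite ERe. exact Hw. }
  (* The variable is w = -i x, so Re w = Im x and Im w = -Re x; the half-plane G_0 becomes the
     condition - Im w < Re z_1. *)
  destruct (half_strip_limit (fun w => F (Ci * w)%C) (fun w => Ci * integrand_branch m (Ci * w))%C
    (fun y => - y < Re (z 1%nat)) T s M (- (Re (z 1%nat) - 1))) as [Y0 HY0].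
  - intros u v' t Hu Hv Ht. generalize (convex_lt (Re (z 1%nat)) (- u) (- v') t Hu Hv Ht). lra.
  - lra.
  - intros w _ Hw. apply (cderiv_comp F (fun w => Ci * w)%C); [apply HF, HR, Hw|].
    eapply cderiv_eq; [apply cderiv_scal, cderiv_id|]. ring.
  - intros w Hw _. rewrite Cmod_mult, Cmod_Ci, Rmult_1_l.
    rewrite <- (EIm w). apply HM. rewrite EIm. exact Hw.
  - exact Hs.
  - exists (fun x => F x - Y0)%C. split.
    + intros x Hx. apply (cderiv_plus_const F (- Y0)%C), HF, Hx.
    + intros a Ha. apply (clim_iff (Rbar_locally m_infty)). intros e He.
      set (A := M * (1 / s + Rabs (- a - - (Re (z 1%nat) - 1)))).
      destruct (exp_small_left A s e Hs He) as [T' HT'].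
      exists (Rmin T T'). intros t Ht.
      destruct (Rmin_Rgt_l _ _ _ Ht).
      specialize (HY0 (t, - a)).
      replace (Ci * (t, (- a)%R))%C with ((a, t) : C) in HY0
        by (apply injective_projections; simpl; ring).
      replace (F (a, t) - Y0 - 0)%C with (F (a, t) - Y0)%C by ring.
      eapply Rle_lt_trans; [apply HY0|].
      * change (t < T). assumption.
      * change (- - a < Re (z 1%nat)). lra.
      * apply HT'. assumption.
Qed.

(** To the left of z_(k+1) both sides are primitives of the integrand of branch k + 1, so they
    differ by a constant, and both tend to 0 at -i oo in G_0. *)
Lemma primitive_left (k : nat) (I J : C -> C) (x : C) : (S k <= P)%nat -> is_primitive k I -> is_primitive (S k) J ->
  domain k x -> Re x < Re (z (S k)) -> J x = (jump (S k) * I x)%C.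
Proof.
  intros Hk [HI1 HI2] [HJ1 HJ2] Hx HxR.
  (* Two consecutive domains differ only on the vertical line through z_(k+1). *)
  assert (HRS : forall y, left_domain k k y <-> left_domain (S k) k y).
  { intros y. split; intros [H1 H2]; (split; [|exact H2]); specialize (H2 ltac:(lia));
    intros p Hp HRe; specialize (H1 p Hp HRe); split; intros L.
    - destruct (Nat.eq_dec p (S k)) as [->|Hne]; [lra|]. apply H1. lia.
    - apply H1. lia.
    - apply H1. lia.
    - destruct (Nat.eq_dec p (S k)) as [->|Hne]; [lra|]. apply H1. lia. }
  destruct (left_domain_primitive_unique k J (fun y => jump (S k) * I y)%C (integrand_branch (S k)) k)
    as [a Ha].
  - lia.
  - intros y Hy. apply HJ1. apply HRS in Hy. apply Hy.
  - intros y [Hy1 Hy2]. specialize (Hy2 ltac:(lia)).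
    replace (integrand_branch (S k) y) with (jump (S k) * integrand_branch k y)%C.
    + apply cderiv_scal, HI1, Hy1.
    + unfold integrand_branch. rewrite exp_branch_left by assumption. ring.
  - set (r := Re (z 1%nat) - 1).
    assert (E : a = RtoC 0).
    { assert (Hr : forall t, left_domain k k (r, t)).
      { intros t. split.
        - apply domain_left. change (r < Re (z 1%nat)). unfold r. lra.
        - intros _. assert (Re (z 1%nat) <= Re (z (S k))) by (apply Re_z_le; lia).
          change (r < Re (z (S k))). unfold r. lra. }
      assert (Hrr : r < Re (z 1%nat)) by (unfold r; lra).
      apply Cmod_eq_0. apply Rle_antisym; [|apply Cmod_ge_0]. apply le_epsilon. intros e He.
      set (A := Cmod (jump (S k)) + 1).
      assert (HA : 0 < A) by (unfold A; generalize (Cmod_ge_0 (jump (S k))); lra).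
      assert (He1 : 0 < e / 2) by lra.
      assert (He2 : 0 < e / 2 / A) by (apply Rdiv_lt_0_compat; lra).
      destruct (proj1 (clim_iff _ _ _) (HJ2 r Hrr) _ He1) as [T1 HT1].
      destruct (proj1 (clim_iff _ _ _) (HI2 r Hrr) _ He2) as [T2 HT2].
      set (t := Rmin T1 T2 - 1).
      assert (t < T1) by (unfold t; generalize (Rmin_l T1 T2); lra).
      assert (t < T2) by (unfold t; generalize (Rmin_r T1 T2); lra).
      specialize (HT1 t ltac:(assumption)). specialize (HT2 t ltac:(assumption)).
      rewrite <- (Ha (r, t) (Hr t)).
      replace (J (r, t) - jump (S k) * I (r, t))%C
        with ((J (r, t) - 0) + - (jump (S k) * (I (r, t) - 0)))%C by ring.
      eapply Rle_trans; [apply Cmod_triangle|]. rewrite Cmod_opp, Cmod_mult.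
      assert (Cmod (jump (S k)) * Cmod (I (r, t) - 0)%C <= A * (e / 2 / A)).
      { apply Rmult_le_compat; try apply Cmod_ge_0; [unfold A; lra|left; exact HT2]. }
      replace (A * (e / 2 / A)) with (e / 2) in H1 by (field; lra). lra. }
    specialize (Ha x (conj Hx (fun _ => HxR))). rewrite E in Ha.
    replace (J x) with ((J x - jump (S k) * I x) + jump (S k) * I x)%C by ring. rewrite Ha. ring.
Qed.

Definition W_branch (m : nat) (I : C -> C) (x : C) : C := (- (Ci / eps) * / exp_branch m x * I x)%C.

(** The jump of e^{-ih/eps} cancels against the same jump of its primitive. *)
Lemma W_branch_left (k : nat) (I J : C -> C) (x : C) : (S k <= P)%nat -> is_primitive k I -> is_primitive (S k) J ->
  domain k x -> Re x < Re (z (S k)) -> W_branch (S k) J x = W_branch k I x.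
Proof.
  intros Hk HI HJ Hx HxR. unfold W_branch. rewrite (primitive_left k I J x), exp_branch_left by assumption.
  assert (H1 := Cexp_neq_0 (2 * PI * c (S k) / eps)). fold (jump (S k)) in H1.
  assert (H2 := exp_branch_neq_0 k x). assert (H3 := eps_neq_0). field. auto.
Qed.

(** * Contour integrals *)

Lemma integrand_branch_ccont (m : nat) (x : C) : domain m x -> ccont (integrand_branch m) x.
Proof. apply holo2_ccont, holo2_integrand_branch; assumption. Qed.

Lemma primitive_ccont (m : nat) (I : C -> C) (x : C) : is_primitive m I -> domain m x -> ccont I x.
Proof. intros HI Hx. eapply cderiv_ccont, HI, Hx. Qed.

(** The data at b are limits, not values, so that one statement covers paths to a point of G, to the
    turning point of U_m and to the singularity z_m. *)
Lemma left_leg (I : C -> C) (gamma k : R -> C) (b : R) (lg lF : C) : is_primitive 0 I ->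
  piecewise_C1 gamma -> originates_at_minus_i_infty z gamma ->
  (forall t, t < b -> G P z (gamma t)) ->
  (forall t, t < b -> k t = (integrand_branch 0 (gamma t) * velocity gamma t)%C) ->
  clim (fun t => integrand_branch 0 (gamma t)) (at_left b) lg -> clim (fun t => I (gamma t)) (at_left b) lF ->
  is_RInt_gen (V := C_R_NormedModule) k (Rbar_locally m_infty) (at_point b) lF /\
  ex_RInt_gen (V := R_NormedModule) (fun t => Cmod (k t)) (Rbar_locally m_infty) (at_point b).
Proof.
  intros HI Hg [a [T0 HT0]] HG Hk Hlg HlF.
  destruct (integrand_branch_bound 0) as [M [T HM]].
  apply (improper_left k (fun t => I (gamma t)) b (Rmin b (Rmin T0 T)) M (lambda / eps)).
  - apply Rdiv_lt_0_compat; assumption.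
  - intros u Hu. apply (path_integral gamma k (integrand_branch 0) I u b lg lF Hu Hg).
    + intros t Ht. assert (Hr : domain 0 (gamma t)) by (apply G_iff, HG; lra).
      split; [apply HI, Hr|apply integrand_branch_ccont, Hr].
    + intros t Ht. apply Hk. lra.
    + exact Hlg.
    + exact HlF.
  - intros t Ht.
    assert (H1 : t < b) by exact (Rlt_Rmin_l _ _ _ Ht).
    assert (H2 : t < T0) by (eapply Rlt_le_trans; [exact Ht|]; eapply Rle_trans; [apply Rmin_r|apply Rmin_l]).
    assert (H3 : t < T) by (eapply Rlt_le_trans; [exact Ht|]; eapply Rle_trans; [apply Rmin_r|apply Rmin_r]).
    rewrite Hk by exact H1.
    rewrite (velocity_ext_loc gamma t (a, 0) Ci (T0 - t)); [|lra|].
    + destruct (HT0 t) as [E _]; [lra|]. rewrite Cmod_mult, Cmod_Ci, Rmult_1_r.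
      assert (EIm : Im (gamma t) = t) by (rewrite E; reflexivity). rewrite <- EIm.
      rewrite EIm. rewrite <- EIm at 2. apply HM. rewrite EIm. exact H3.
    + intros s Hs. apply Rabs_def2 in Hs. destruct (HT0 s) as [E _]; [lra|]. rewrite E.
      apply injective_projections; simpl; ring.
  - assert (Ha : a < Re (z 1%nat)).
    { destruct (HT0 T0 (Rle_refl _)) as [E HG0]. unfold G0 in HG0. rewrite E in HG0. exact HG0. }
    apply (clim_iff (Rbar_locally m_infty)). intros e He.
    destruct (proj1 (clim_iff _ _ _) (proj2 HI a Ha) e He) as [T1 HT1].
    exists (Rmin T0 T1). intros t Ht.
    destruct (Rmin_Rgt_l _ _ _ Ht) as [H2 H3].
    destruct (HT0 t) as [E _]; [lra|]. rewrite E. apply HT1, H3.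
Qed.

Lemma right_leg (m : nat) (J : C -> C) (gamma k : R -> C) (b : R) : is_primitive m J ->
  piecewise_C1 gamma -> ends_at_minus_i_infty z gamma ->
  (forall t, b <= t -> domain m (gamma t)) ->
  (forall t, b < t -> k t = (integrand_branch m (gamma t) * velocity gamma t)%C) ->
  is_RInt_gen (V := C_R_NormedModule) k (at_point b) (Rbar_locally p_infty) (- J (gamma b))%C /\
  ex_RInt_gen (V := R_NormedModule) (fun t => Cmod (k t)) (at_point b) (Rbar_locally p_infty).
Proof.
  intros HJ Hg [a [T0 HT0]] HG Hk. assert (Cg := proj1 Hg).
  destruct (integrand_branch_bound m) as [M [T HM]].
  apply (improper_right k (fun t => J (gamma t)) b (Rmax b (Rmax T0 (- T))) M (lambda / eps)).
  - apply Rdiv_lt_0_compat; assumption.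
  - intros u Hu. apply (path_integral gamma k (integrand_branch m) J b u (integrand_branch m (gamma u)) (J (gamma u)) Hu Hg).
    + intros t Ht. assert (Hr : domain m (gamma t)) by (apply HG; lra).
      split; [apply HJ, Hr|apply integrand_branch_ccont, Hr].
    + intros t Ht. apply Hk. lra.
    + apply filterlim_locally_left, (ccont_filterlim (integrand_branch m) (gamma u) (locally u)); [|apply Cg].
      apply integrand_branch_ccont, HG. lra.
    + apply filterlim_locally_left, (ccont_filterlim J (gamma u) (locally u)); [|apply Cg].
      apply (primitive_ccont m); [exact HJ|]. apply HG. lra.
  - intros t Ht.
    assert (H1 : b < t) by (eapply Rle_lt_trans; [apply Rmax_l|exact Ht]).
    assert (H2 : T0 < t) by (eapply Rle_lt_trans; [|exact Ht]; eapply Rle_trans; [|apply Rmax_r]; apply Rmax_l).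
    assert (H3 : - T < t) by (eapply Rle_lt_trans; [|exact Ht]; eapply Rle_trans; [|apply Rmax_r]; apply Rmax_r).
    rewrite Hk by exact H1.
    rewrite (velocity_ext_loc gamma t (a, 0) (- Ci)%C (t - T0)); [|lra|].
    + destruct (HT0 t) as [E _]; [lra|]. rewrite Cmod_mult, Cmod_opp, Cmod_Ci, Rmult_1_r.
      assert (EIm : Im (gamma t) = - t) by (rewrite E; reflexivity).
      rewrite <- EIm. apply HM. rewrite EIm. lra.
    + intros s Hs. apply Rabs_def2 in Hs. destruct (HT0 s) as [E _]; [lra|]. rewrite E.
      apply injective_projections; simpl; ring.
  - assert (Ha : a < Re (z 1%nat)).
    { destruct (HT0 T0 (Rle_refl _)) as [E HG0]. unfold G0 in HG0. rewrite E in HG0. exact HG0. }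
    apply (clim_iff (Rbar_locally p_infty)). intros e He.
    destruct (proj1 (clim_iff _ _ _) (proj2 HJ a Ha) e He) as [T1 HT1].
    exists (Rmax T0 (- T1)). intros t Ht.
    assert (H2 : T0 < t) by (eapply Rle_lt_trans; [apply Rmax_l|exact Ht]).
    assert (H3 : - T1 < t) by (eapply Rle_lt_trans; [apply Rmax_r|exact Ht]).
    destruct (HT0 t) as [E _]; [lra|]. rewrite E. apply HT1. lra.
Qed.

Lemma integrand_eq_branch (m : nat) (K : contour) (t : R) : fval K t = f_branch m (path K t) ->
  integrand eps lambda P z v K t = (integrand_branch m (path K t) * velocity (path K) t)%C.
Proof. intros E. unfold integrand, integrand_branch, exp_branch, rational_part. rewrite E. reflexivity. Qed.

Lemma contour_G_integral (I : C -> C) (gamma : R -> C) (lg lF : C) : is_primitive 0 I ->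
  piecewise_C1 gamma -> originates_at_minus_i_infty z gamma ->
  (forall t, t < 0 -> G P z (gamma t)) ->
  clim (fun t => integrand_branch 0 (gamma t)) (at_left 0) lg -> clim (fun t => I (gamma t)) (at_left 0) lF ->
  abs_convergent eps lambda P z v (contour_G P c z gamma 0) /\
  contour_int eps lambda P z v (contour_G P c z gamma 0) = lF.
Proof.
  intros HI Hg Ho HG Hlg HlF.
  destruct (left_leg I gamma (integrand eps lambda P z v (contour_G P c z gamma 0)) 0 lg lF) as [H1 H2];
    try assumption.
  - intros t _. apply (integrand_eq_branch 0). simpl. symmetry. apply f_branch_0.
  - split.
    + split; [exists lF; exact H1|exact H2].
    + unfold contour_int. simpl stop. apply (is_RInt_gen_unique (V := C_R_CompleteNormedModule)
        (Fa := Rbar_locally m_infty) (Fb := at_point 0)). exact H1.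
Qed.

Lemma contour_to_point (I : C -> C) (x : C) (gamma : R -> C) : is_primitive 0 I ->
  G P z x -> path_in_G_to P z x gamma ->
  abs_convergent eps lambda P z v (contour_G P c z gamma 0) /\
  contour_int eps lambda P z v (contour_G P c z gamma 0) = I x.
Proof.
  intros HI Hx [Hg [Ho [HG E]]].
  assert (Hr : domain 0 (gamma 0)) by (rewrite E; apply G_iff; assumption).
  apply (contour_G_integral I gamma (integrand_branch 0 x) (I x)); try assumption.
  - intros t Ht. apply HG. lra.
  - rewrite <- E. apply filterlim_locally_left, (ccont_filterlim (integrand_branch 0) (gamma 0) (locally 0)); [|apply Hg].
    apply integrand_branch_ccont, Hr.
  - rewrite <- E. apply filterlim_locally_left, (ccont_filterlim I (gamma 0) (locally 0)); [|apply Hg].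
    apply (primitive_ccont 0); assumption.
Qed.

(** In a small disc the local branch of the continuation and [f_branch m] are both primitives of
    [u0], so their difference is locally constant along the path. *)
Lemma continued_value (m : nat) (gamma phi : R -> C) (t0 : R) :
  (forall t : R, continuous (U := C_UniformSpace) gamma t) ->
  continued_along P c z gamma phi ->
  (forall t, t0 <= t -> domain m (gamma t)) ->
  phi t0 = f_branch m (gamma t0) ->
  forall t, t0 <= t -> phi t = f_branch m (gamma t).
Proof.
  intros Hg Hc HR H0 t Ht.
  assert (E : (phi t - f_branch m (gamma t))%C = (phi t0 - f_branch m (gamma t0))%C).
  { apply (locally_constant_eq (fun t => phi t - f_branch m (gamma t))%C t0 t Ht).
    intros s Hs. destruct (Hc s) as [r [F [Hr [HF [d Hd]]]]].
    destruct (domain_open m (gamma s)) as [r' [Hr' HO]]; [apply HR; lra|].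
    set (r0 := Rmin r r'). assert (Hr0 : 0 < r0) by (apply Rmin_pos; assumption).
    destruct (proj1 (clim_iff _ _ _) (Hg s) r0 Hr0) as [d' Hd'].
    exists (Rmin d d'). split; [apply Rmin_pos; apply cond_pos|]. intros u Hu.
    destruct (Rmin_Rgt_l _ _ _ Hu) as [Hu1 Hu2].
    rewrite (Hd u Hu1), (Hd s).
    2:{ change (Rabs (s - s) < d). rewrite Rminus_diag, Rabs_R0. apply cond_pos. }
    specialize (Hd' u Hu2).
    apply (primitive_unique_segment F (f_branch m) (u0 P c z) (gamma s) (gamma u)).
    intros w Hw.
    assert (Hn : Cmod (gamma s + RtoC w * (gamma u - gamma s) - gamma s)%C < r0).
    { replace (gamma s + RtoC w * (gamma u - gamma s) - gamma s)%C with (RtoC w * (gamma u - gamma s))%C by ring.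
      rewrite Cmod_mult, Cmod_R, Rabs_pos_eq by lra. generalize (Cmod_ge_0 (gamma u - gamma s)). nra. }
    split.
    - apply HF. exact (Rlt_Rmin_l _ _ _ Hn).
    - apply cderiv_f_branch, HO. exact (Rlt_Rmin_r _ _ _ Hn). }
  rewrite H0 in E.
  replace (phi t) with ((phi t - f_branch m (gamma t)) + f_branch m (gamma t))%C by ring.
  rewrite E. ring.
Qed.

Lemma contour_U_integral (m : nat) (I J : C -> C) (K : contour) : (1 <= m <= P)%nat ->
  is_primitive 0 I -> is_primitive m J -> is_U P c z m K ->
  abs_convergent eps lambda P z v K /\
  exists y, gap P z m y /\ contour_int eps lambda P z v K = (I y - J y)%C.
Proof.
  intros Hm HI HJ [Hstop [Hg [Ho [He [Hc [t0 [HL [Hgap HR]]]]]]]].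
  assert (Cg := proj1 Hg).
  assert (HR' : forall t, t0 <= t -> domain m (path K t)) by (intros t Ht; apply return_region_iff, HR, Ht).
  assert (Hr0 : domain 0 (path K t0)) by (apply G_iff, HL; lra).
  (* The turning point lies to the right of z_1, ..., z_m, where branch m still has the values of f;
     the return therefore starts, and stays, on branch m. *)
  assert (Hval : forall t, t0 <= t -> fval K t = f_branch m (path K t)).
  { apply continued_value; try assumption. rewrite (proj2 (HL t0 (Rle_refl _))), <- f_branch_0. symmetry.
    apply (f_branch_gap m m); [lia|lia|]. intros _. apply Hgap. }
  destruct (left_leg I (path K) (integrand eps lambda P z v K) t0 (integrand_branch 0 (path K t0)) (I (path K t0)))
    as [A1 A2]; try assumption.
  - intros t Ht. apply HL. lra.
  - intros t Ht. apply (integrand_eq_branch 0). rewrite f_branch_0. apply HL. lra.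
  - apply filterlim_locally_left, (ccont_filterlim (integrand_branch 0) (path K t0) (locally t0)); [|apply Cg].
    apply integrand_branch_ccont, Hr0.
  - apply filterlim_locally_left, (ccont_filterlim I (path K t0) (locally t0)); [|apply Cg].
    apply (primitive_ccont 0); assumption.
  - destruct (right_leg m J (path K) (integrand eps lambda P z v K) t0) as [B1 B2]; try assumption.
    + intros t Ht. apply (integrand_eq_branch m). apply Hval. lra.
    + assert (HC := is_RInt_gen_Chasles (V := C_R_NormedModule) _ _ _ _ A1 B1).
      unfold abs_convergent, contour_int. rewrite Hstop. simpl stop_filter. split; [split|].
      * eexists. exact HC.
      * destruct A2 as [l1 A2]. destruct B2 as [l2 B2].
        eexists. exact (is_RInt_gen_Chasles (V := R_NormedModule) _ _ _ _ A2 B2).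
      * exists (path K t0). split; [exact Hgap|].
        apply (is_RInt_gen_unique (V := C_R_CompleteNormedModule)
          (Fa := Rbar_locally m_infty) (Fb := Rbar_locally p_infty)). exact HC.
Qed.

(** * Behaviour at z_m *)

Section Local.
Variable m : nat.
Hypothesis Hm : (1 <= m <= P)%nat.
Hypothesis Hcm : c m <> RtoC 0.

(* Near z_m, e^{-ih/eps} = (i (x - z_m))^alpha kappa(x). *)
Definition alpha : C := (- Ci * c m / eps)%C.

Definition rest (x : C) : C :=
  (c m * (PI * Ci / 2) + Csum P (fun p => if Nat.eqb p m then RtoC 0 else f_branch_term 0 p x)
   + Cconj (c m) * (Log (- Ci * (x - Cconj (z m))) - PI * Ci / 2))%C.

Definition kappa (x : C) : C := Cexp (- Ci * (lambda * x + rest x) / eps).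

Definition numerator (x : C) : C :=
  (v m + (x - z m) * (Csum P (fun p => if Nat.eqb p m then RtoC 0 else v p / (x - z p)) + lambda))%C.

(** The function H of the expansion at z_m: H_0 and H_1 are its value and its derivative there. *)
Definition regular_factor (x : C) : C := (kappa x * numerator x)%C.

Definition near_zm (x : C) : Prop :=
  (forall p, (1 <= p <= P)%nat -> p <> m -> Re x <> Re (z p)) /\ 0 < Im x.

Lemma near_zm_ball : exists r, 0 < r <= 1 /\ r <= Im (z m) /\
  forall x, Cmod (x - z m)%C < r -> near_zm x.
Proof.
  destruct (finite_radius P (fun p x => p <> m -> Re x <> Re (z p)) (z m)) as [r [Hr H]].
  - intros p Hp. destruct (Nat.eq_dec p m) as [->|Hne]; [exists 1; split; [lra|tauto]|].
    assert (Hd : Re (z m) <> Re (z p)).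
    { destruct (Nat.lt_total p m) as [L|[L|L]]; [|tauto|].
      - assert (Re (z p) < Re (z m)) by (apply Re_z_lt; lia). lra.
      - assert (Re (z m) < Re (z p)) by (apply Re_z_lt; lia). lra. }
    exists (Rabs (Re (z m) - Re (z p))). split; [apply Rabs_pos_lt; lra|].
    intros y Hy _ E. generalize (re_le_Cmod (y - z m)). change (Re (y - z m)) with (Re y - Re (z m)).
    rewrite E, Rabs_minus_sym. lra.
  - assert (H0 := Hz m Hm). exists (Rmin r (Rmin 1 (Im (z m)))).
    generalize (Rmin_l r (Rmin 1 (Im (z m)))) (Rmin_r r (Rmin 1 (Im (z m))))
      (Rmin_l 1 (Im (z m))) (Rmin_r 1 (Im (z m))). intros.
    split; [split; [repeat apply Rmin_pos; lra|lra]|]. split; [lra|].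
    intros x Hx. split.
    + intros p Hp. apply H; [lra|exact Hp].
    + apply Im_near in Hx. lra.
Qed.

Lemma near_zm_neq (p : nat) (x : C) : (1 <= p <= P)%nat -> p <> m -> near_zm x -> (x - z p)%C <> 0.
Proof.
  intros Hp Hne [H _] E. apply (H p Hp Hne). apply (f_equal Re) in E.
  change (Re x - Re (z p) = 0) in E. lra.
Qed.

Lemma near_zm_slit (p : nat) (x : C) : (1 <= p <= P)%nat -> near_zm x -> slit (- Ci * (x - Cconj (z p))).
Proof.
  intros Hp [_ Hx]. apply slit_mCi. intros _. change (- Im (z p) < Im x). generalize (Hz p Hp). lra.
Qed.

Lemma holo2_kappa : holo2 near_zm kappa.
Proof.
  unfold kappa. apply (holo2_exp_branch_of near_zm rest). unfold rest.
  apply holo2_plus; [apply holo2_plus; [apply holo2_const|]|].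
  - apply (holo2_Csum _ P (fun p x => if Nat.eqb p m then RtoC 0 else f_branch_term 0 p x)).
    intros p Hp. destruct (Nat.eqb_spec p m) as [E|E]; [apply holo2_const|].
    apply (holo2_f_branch_term). intros x Hx. split; [lia|split; [intros _|apply near_zm_slit; assumption]].
    apply slit_Ci. intros E'. exfalso. apply (proj1 Hx p Hp E E').
  - apply holo2_mult; [apply holo2_const|]. apply holo2_minus; [|apply holo2_const].
    apply holo2_Log; [|apply holo2_shift]. intros x Hx. apply near_zm_slit; assumption.
Qed.

Lemma holo2_regular_factor : holo2 near_zm regular_factor.
Proof.
  apply holo2_mult; [apply holo2_kappa|]. unfold numerator.
  apply holo2_plus; [apply holo2_const|]. apply holo2_mult.
  - apply holo2_minus; [apply holo2_id|apply holo2_const].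
  - apply holo2_plus; [|apply holo2_const].
    apply (holo2_Csum _ P (fun p x => if Nat.eqb p m then RtoC 0 else v p / (x - z p))%C).
    intros p Hp. destruct (Nat.eqb_spec p m) as [E|E]; [apply holo2_const|].
    apply holo2_frac. intros x Hx. apply near_zm_neq; assumption.
Qed.

Lemma exp_branch_factor (x : C) : exp_branch 0 x = (Cexp (alpha * Log (Ci * (x - z m))) * kappa x)%C.
Proof.
  unfold kappa, exp_branch. rewrite <- Cexp_plus. f_equal. unfold f_branch.
  rewrite (Csum_extract P m) by exact Hm.
  unfold rest, alpha, f_branch_term at 2, log_branch. destruct (Nat.leb_spec m 0); [lia|].
  field. apply eps_neq_0.
Qed.

Lemma rational_part_numerator (x : C) : x <> z m -> ((x - z m) * rational_part x)%C = numerator x.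
Proof.
  intros Hx. unfold rational_part, numerator. rewrite (Csum_extract P m) by exact Hm.
  field. intros E. apply Hx. replace x with ((x - z m) + z m)%C by ring. rewrite E. ring.
Qed.

(* The inverse of x |-> Log (i (x - z_m)): it maps a half-strip onto a slit disc. *)
Definition chart (w : C) : C := (z m - Ci * Cexp w)%C.

Lemma Ci_chart (w : C) : (Ci * (chart w - z m))%C = Cexp w.
Proof.
  unfold chart. assert (E := Ci_sqr).
  transitivity (- (Ci * Ci) * Cexp w)%C; [ring|]. rewrite E. ring.
Qed.

Lemma chart_neq (w : C) : chart w <> z m.
Proof.
  intros E. assert (H := Ci_chart w). rewrite E in H. apply (Cexp_neq_0 w). rewrite <- H. ring.
Qed.

Lemma Cmod_chart (w : C) : Cmod (chart w - z m) = exp (Re w).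
Proof. rewrite <- Cmod_Cexp, <- Ci_chart, Cmod_mult, Cmod_Ci. ring. Qed.

Lemma Log_chart (w : C) : Rabs (Im w) < PI -> Log (Ci * (chart w - z m)) = w.
Proof.
  intros Hw. rewrite Ci_chart. apply Log_Cexp. apply Rabs_def2 in Hw. lra.
Qed.

Lemma chart_Log (x : C) : x <> z m -> chart (Log (Ci * (x - z m))) = x.
Proof.
  intros Hx. unfold chart. rewrite Cexp_Log.
  - assert (E := Ci_sqr).
    transitivity (z m - (Ci * Ci) * (x - z m))%C; [ring|]. rewrite E. ring.
  - intros E. apply Hx. apply (f_equal Cmod) in E. rewrite Cmod_mult, Cmod_Ci, Cmod_0, Rmult_1_l in E.
    apply Cmod_eq_0 in E. replace x with ((x - z m) + z m)%C by ring. rewrite E. ring.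
Qed.

Lemma cderiv_chart (w : C) : cderiv chart w (chart w - z m)%C.
Proof.
  unfold chart. eapply cderiv_eq.
  - apply cderiv_minus; [apply cderiv_const|apply cderiv_scal, cderiv_Cexp].
  - ring.
Qed.

Lemma chart_period (u : R) : chart (u, PI) = chart (u, - PI).
Proof.
  unfold chart. f_equal. f_equal. unfold Cexp, Re, Im; simpl.
  rewrite cos_neg, sin_neg, sin_PI. f_equal; ring.
Qed.

Variable r : R.
Hypothesis Hr : 0 < r <= 1.
Hypothesis Hr_Im : r <= Im (z m).
Hypothesis Hr_near : forall x, Cmod (x - z m)%C < r -> near_zm x.

Lemma chart_near (w : C) : Re w < ln r -> Cmod (chart w - z m) < r.
Proof.
  intros Hw. rewrite Cmod_chart. apply exp_increasing in Hw. rewrite exp_ln in Hw; lra.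
Qed.

(** In the open strip the line through z_m is met only for Im w = 0, that is on the ray below z_m
    and not on the cut above it; r <= Im z_m keeps the point above the conjugate of z_m. *)
Lemma chart_domain (w : C) : Re w < ln r -> Rabs (Im w) < PI -> domain 0 (chart w).
Proof.
  intros Hw Hi p Hp HRe. split; [lia|]. intros _.
  assert (Hn := chart_near w Hw).
  destruct (Nat.eq_dec p m) as [->|Hne].
  - assert (E1 : Re (chart w) = Re (z m) + exp (Re w) * sin (Im w)).
    { rewrite <- Cexp_Im. unfold chart, Re, Im; simpl. ring. }
    assert (E2 : Im (chart w) = Im (z m) - exp (Re w) * cos (Im w)).
    { rewrite <- Cexp_Re. unfold chart, Re, Im; simpl. ring. }
    assert (He := exp_pos (Re w)). apply Rabs_def2 in Hi.
    assert (Hs : sin (Im w) = 0) by (rewrite E1 in HRe; nra).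
    assert (Hi0 : Im w = 0).
    { destruct (Rtotal_order (Im w) 0) as [L|[L|L]]; [|exact L|].
      - assert (0 < sin (- Im w)) by (apply sin_gt_0; lra). rewrite sin_neg in *. lra.
      - assert (0 < sin (Im w)) by (apply sin_gt_0; lra). lra. }
    rewrite E2, Hi0, cos_0. rewrite Cmod_chart in Hn. generalize (Hz m Hm). lra.
  - exfalso. apply (proj1 (Hr_near _ Hn) p Hp Hne HRe).
Qed.

Lemma chart_of_near (x : C) : domain 0 x -> Cmod (x - z m)%C < r ->
  exists w, x = chart w /\ Re w < ln r /\ Rabs (Im w) < PI.
Proof.
  intros HR Hx. destruct (domain_slit 0 m x Hm HR) as [_ [Hs _]]. specialize (Hs ltac:(lia)).
  exists (Log (Ci * (x - z m))). split; [|split].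
  - symmetry. apply chart_Log. intros E. apply (slit_neq_0 _ Hs). rewrite E. ring.
  - change (ln (Cmod (Ci * (x - z m))) < ln r). apply ln_increasing.
    + apply Cmod_gt_0, slit_neq_0, Hs.
    + rewrite Cmod_mult, Cmod_Ci, Rmult_1_l. exact Hx.
  - apply Rabs_def1; apply (Carg_slit _ Hs).
Qed.

Variable I : C -> C.
Hypothesis HI : is_primitive 0 I.

Lemma integrand_branch_chart (w : C) : Rabs (Im w) < PI ->
  ((chart w - z m) * integrand_branch 0 (chart w))%C = (Cexp (alpha * w) * regular_factor (chart w))%C.
Proof.
  intros Hw. unfold integrand_branch, regular_factor. rewrite <- rational_part_numerator by apply chart_neq.
  rewrite exp_branch_factor, Log_chart by exact Hw. ring.
Qed.

(** The factor chart w - z_m produced by the chain rule cancels the simple pole of the rational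
    part. *)
Lemma cderiv_I_chart (w : C) : Re w < ln r -> Rabs (Im w) < PI ->
  cderiv (fun w => I (chart w)) w (Cexp (alpha * w) * regular_factor (chart w))%C.
Proof.
  intros Hw Hi. rewrite <- integrand_branch_chart by exact Hi.
  apply (cderiv_comp I chart); [|apply cderiv_chart]. apply HI, chart_domain; assumption.
Qed.

Lemma strip_convex (a b t : R) : Rabs a < PI -> Rabs b < PI -> 0 <= t <= 1 -> Rabs (a + t * (b - a)) < PI.
Proof.
  intros Ha Hb Ht. apply Rabs_def2 in Ha, Hb.
  apply Rabs_def1; [apply convex_lt|apply convex_gt]; lra.
Qed.

Lemma Cexp_natural_power (n : nat) (w : C) : Cexp (RtoC (INR n) * w) = (Cexp w ^ n)%C.
Proof.
  induction n as [|n IH].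
  - simpl. rewrite <- Cexp_0. f_equal. ring.
  - rewrite S_INR, RtoC_plus. replace ((INR n + 1) * w)%C with (INR n * w + w)%C by ring.
    rewrite Cexp_plus, IH. simpl. ring.
Qed.

(** For alpha = n + 1 the power (i (x - z_m))^(n+1) absorbs the simple pole, leaving i (i (x -
    z_m))^n H(x). *)
Lemma integrand_branch_removable (n : nat) : alpha = RtoC (INR (S n)) ->
  exists g, ccont g (z m) /\ forall x, domain 0 x -> Cmod (x - z m)%C < r ->
    integrand_branch 0 x = g x.
Proof.
  intros Ha. exists (fun x => Ci * (Ci * (x - z m)) ^ n * regular_factor x)%C. split.
  - apply ccont_mult; [apply ccont_mult|].
    + eapply cderiv_ccont, cderiv_const.
    + clear - n. induction n as [|n IH]; [exact (cderiv_ccont _ _ _ (cderiv_const (RtoC 1) (z m)))|].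
      apply (ccont_mult (fun x => Ci * (x - z m))%C); [eapply cderiv_ccont, cderiv_shift|exact IH].
    + apply (holo2_ccont near_zm); [apply holo2_regular_factor|]. apply Hr_near.
      replace (z m - z m)%C with (RtoC 0) by ring. rewrite Cmod_0. lra.
  - intros x HR Hx. destruct (chart_of_near x HR Hx) as [w [-> [Hw Hi]]].
    assert (E := integrand_branch_chart w Hi). rewrite Ha, Cexp_natural_power, <- Ci_chart in E. simpl in E.
    assert (Hd : (chart w - z m)%C <> 0).
    { intros E0. apply (chart_neq w). replace (chart w) with ((chart w - z m) + z m)%C by ring. rewrite E0. ring. }
    set (d := (chart w - z m)%C) in *.
    replace (integrand_branch 0 (chart w)) with ((d * integrand_branch 0 (chart w)) / d)%C
      by (field; exact Hd).
    rewrite E. field. exact Hd.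
Qed.

Lemma regular_factor_ccont_zm : ccont regular_factor (z m).
Proof.
  apply (holo2_ccont near_zm); [apply holo2_regular_factor|]. apply Hr_near.
  replace (z m - z m)%C with (RtoC 0) by ring. rewrite Cmod_0. lra.
Qed.

(** A bound on H near z_m suffices: in the chart the derivative of I is O(e^{(n+1) Re w}), and
    [half_strip_limit] applies with s = n + 1 > 0. *)
Lemma I_limit_zm (n : nat) : alpha = RtoC (INR (S n)) ->
  exists Y0, forall e, 0 < e -> exists d, 0 < d /\ forall x, domain 0 x -> Cmod (x - z m)%C < d ->
    Cmod (I x - Y0)%C < e.
Proof.
  intros Ha. destruct (regular_factor_ccont_zm 1 Rlt_0_1) as [d1 [Hd1 H1]].
  set (r1 := Rmin r d1). assert (Hr1 : 0 < r1) by (apply Rmin_pos; lra).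
  assert (Hln : ln r1 <= ln r).
  { apply ln_le_compat; [exact Hr1|apply Rmin_l]. }
  set (M := Cmod (regular_factor (z m)) + 1). set (s := INR (S n)).
  assert (Hs : 0 < s) by (apply lt_0_INR; lia).
  destruct (half_strip_limit (fun w => I (chart w)) (fun w => Cexp (alpha * w) * regular_factor (chart w))%C
    (fun y => Rabs y < PI) (ln r1) s M 0) as [Y0 HY0].
  - intros; apply strip_convex; assumption.
  - rewrite Rabs_R0. apply PI_RGT_0.
  - intros w Hw Hi. apply cderiv_I_chart; [lra|exact Hi].
  - intros w Hw Hi. rewrite Cmod_mult, Cmod_Cexp, Ha, Rmult_comm.
    replace (Re (INR (S n) * w)%C) with (s * Re w) by (unfold s, Re; simpl; ring).
    apply Rmult_le_compat_r; [left; apply exp_pos|].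
    assert (Hn : Cmod (chart w - z m) < d1).
    { rewrite Cmod_chart. apply exp_increasing in Hw. rewrite exp_ln in Hw by exact Hr1.
      exact (Rlt_Rmin_r _ _ _ Hw). }
    specialize (H1 _ Hn). generalize (Cmod_triangle_sub (regular_factor (chart w)) (regular_factor (z m))). unfold M. lra.
  - exact Hs.
  - exists Y0. intros e He.
    destruct (exp_small_left (M * (1 / s + PI)) s e Hs He) as [T HT].
    set (d := Rmin r1 (exp T)). exists d. split; [apply Rmin_pos; [exact Hr1|apply exp_pos]|].
    intros x HR Hx.
    destruct (Rmin_Rgt_l _ _ _ Hx) as [Hx1 Hx2].
    destruct (chart_of_near x HR) as [w [-> [Hw Hi]]].
    { exact (Rlt_Rmin_l _ _ _ Hx1). }
    rewrite Cmod_chart in Hx1, Hx2. apply exp_lt_inv in Hx2.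
    assert (Hwr : Re w < ln r1) by (rewrite <- (ln_exp (Re w)); apply ln_increasing; [apply exp_pos|exact Hx1]).
    eapply Rle_lt_trans; [apply HY0; assumption|].
    eapply Rle_lt_trans; [|apply (HT (Re w) Hx2)].
    apply Rmult_le_compat_r; [left; apply exp_pos|]. rewrite Rminus_0_r.
    apply Rmult_le_compat_l; [unfold M; generalize (Cmod_ge_0 (regular_factor (z m))); lra|]. lra.
Qed.

(** * Removing the singularity at z_m *)

Section Removable.
Variables (E : C -> C) (H1 : C) (M a : R).
Hypothesis E_W_branch : forall x, domain 0 x -> Cmod (x - z m)%C < r ->
  E x = W_branch 0 I x.
Hypothesis E_cont : forall x, x <> z m -> Cmod (x - z m)%C < r -> ccont E x.
Hypothesis I_zm : forall n, alpha = RtoC (INR (S n)) ->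
  forall e, 0 < e -> exists d, 0 < d /\ forall x, domain 0 x -> Cmod (x - z m)%C < d -> Cmod (I x) < e.
Hypothesis HM : 0 <= M.
Hypothesis Ha : a <= ln r.
Hypothesis H_taylor : forall w, Re w < a ->
  Cmod (regular_factor (chart w) - regular_factor (z m) - (chart w - z m) * H1)%C <= M * exp (2 * Re w).

(** The added factor is regular and nonzero at z_m, so nothing is lost for differentiability, and in
    the chart only e^{-alpha w} I remains. *)
Definition scaled_E (x : C) : C := (E x * (kappa x * (Ci * eps)))%C.

Lemma scaled_E_chart (w : C) : Re w < a -> Rabs (Im w) < PI ->
  scaled_E (chart w) = (Cexp (- (alpha * w)) * I (chart w))%C.
Proof.
  intros Hw Hi. unfold scaled_E. rewrite E_W_branch.
  - unfold W_branch. rewrite exp_branch_factor, Log_chart, Cexp_opp by exact Hi.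
    assert (K0 := Cexp_neq_0 (alpha * w)).
    assert (K1 : kappa (chart w) <> 0) by apply Cexp_neq_0.
    assert (K2 := eps_neq_0).
    assert (EC := Ci_sqr).
    transitivity (- (Ci * Ci) * (/ Cexp (alpha * w) * I (chart w)))%C; [field; auto|rewrite EC; ring].
  - apply chart_domain; [lra|exact Hi].
  - apply chart_near. lra.
Qed.

(** [E] is continuous across the cut above z_m, so this includes the lines Im w = PI and Im w = -PI,
    where [scaled_E_chart] says nothing. *)
Lemma scaled_E_chart_ccont (w : C) : Re w < a -> ccont (fun w => scaled_E (chart w)) w.
Proof.
  intros Hw. assert (Hn := chart_near w ltac:(lra)).
  assert (Hz' : ccont chart w) by (eapply cderiv_ccont, cderiv_chart).
  intros e He.
  assert (HB : ccont scaled_E (chart w)).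
  { apply ccont_mult; [apply E_cont; [apply chart_neq|exact Hn]|].
    apply ccont_mult; [|eapply cderiv_ccont, cderiv_const].
    apply (holo2_ccont near_zm); [apply holo2_kappa|apply Hr_near, Hn]. }
  destruct (HB e He) as [d [Hd HBd]]. destruct (Hz' d Hd) as [d' [Hd' Hzd]].
  exists d'. split; [exact Hd'|]. intros y Hy. apply HBd, Hzd, Hy.
Qed.

Definition strip_const : R := exp (Rabs (Im alpha) * PI).

Lemma a_nonpos : a <= 0.
Proof.
  eapply Rle_trans; [exact Ha|]. rewrite <- ln_1.
  apply ln_le_compat; apply Hr.
Qed.

Lemma Cexp_malpha_bound (w : C) : Rabs (Im w) <= PI ->
  Cmod (Cexp (- (alpha * w))) <= strip_const * exp (- Re alpha * Re w).
Proof.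
  intros Hi. replace (- (alpha * w))%C with ((- alpha) * w)%C by ring.
  eapply Rle_trans; [apply Cmod_Cexp_strip, Hi|]. unfold strip_const.
  change (Re (- alpha)) with (- Re alpha). change (Im (- alpha)) with (- Im alpha).
  rewrite Rabs_Ropp. lra.
Qed.

Lemma Cexp_malpha_ccont (w : C) : ccont (fun w => Cexp (- (alpha * w))) w.
Proof.
  eapply cderiv_ccont. apply (cderiv_comp Cexp (fun w => - (alpha * w))%C); [apply cderiv_Cexp|].
  apply (cderiv_ext (fun w => (- alpha) * w)%C); [intros y; ring|]. apply cderiv_scal, cderiv_id.
Qed.

Section Principal.
(** A primitive of the two leading terms e^{alpha w} (H_0 - i H_1 e^w). It is left abstract because
    its formula contains a term linear in w when alpha = -1. *)
Variable Sp : C -> C.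
Hypothesis Sp_deriv : forall w,
  cderiv Sp w (Cexp (alpha * w) * (regular_factor (z m) + (chart w - z m) * H1))%C.

Lemma remainder_deriv (w : C) : Re w < a -> Rabs (Im w) < PI ->
  cderiv (fun w => I (chart w) - Sp w)%C w
    (Cexp (alpha * w) * (regular_factor (chart w) - regular_factor (z m) - (chart w - z m) * H1))%C /\
  Cmod (Cexp (alpha * w) * (regular_factor (chart w) - regular_factor (z m) - (chart w - z m) * H1))%C
    <= strip_const * M * exp ((Re alpha + 2) * Re w).
Proof.
  intros Hw Hi. split.
  - eapply cderiv_eq; [apply cderiv_minus; [apply cderiv_I_chart; [lra|exact Hi]|apply Sp_deriv]|]. ring.
  - rewrite Cmod_mult.
    replace (strip_const * M * exp ((Re alpha + 2) * Re w)) with ((strip_const * exp (Re alpha * Re w)) * (M * exp (2 * Re w))).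
    2:{ rewrite Rmult_plus_distr_r, exp_plus. ring. }
    apply Rmult_le_compat; try apply Cmod_ge_0.
    + apply Cmod_Cexp_strip. lra.
    + apply H_taylor, Hw.
Qed.

(** The remainder has derivative O(e^{(Re alpha + 2) Re w}) with a positive exponent, so it
    converges to some [Y0] as Re w -> -oo. Multiplying by e^{-alpha w} turns the error into O(e^{2
    Re w}), whatever alpha is. *)
Lemma remainder_limit : - (3 / 2) < Re alpha ->
  exists (Y0 : C) (M' : R),
    (forall w, Re w < a -> Rabs (Im w) < PI ->
      Cmod (I (chart w) - Sp w - Y0)%C <= M' * exp ((Re alpha + 2) * Re w)) /\
    (forall w, Re w < a -> Rabs (Im w) <= PI ->
      Cmod (scaled_E (chart w) - Cexp (- (alpha * w)) * (Sp w + Y0))%C <= M' * exp (2 * Re w)).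
Proof.
  intros Hal. set (s := Re alpha + 2). assert (Hs : 0 < s) by (unfold s; lra).
  assert (HPI := PI_RGT_0).
  destruct (half_strip_limit (fun w => I (chart w) - Sp w)%C
    (fun w => Cexp (alpha * w) * (regular_factor (chart w) - regular_factor (z m) - (chart w - z m) * H1))%C
    (fun y => Rabs y < PI) a s (strip_const * M) 0) as [Y0 HY0].
  - intros; apply strip_convex; assumption.
  - rewrite Rabs_R0. exact HPI.
  - intros w Hw Hi. apply remainder_deriv; assumption.
  - intros w Hw Hi. apply remainder_deriv; assumption.
  - exact Hs.
  - assert (HK : 1 <= strip_const).
    { unfold strip_const. rewrite <- exp_0. assert (0 <= Rabs (Im alpha) * PI).
      { apply Rmult_le_pos; [apply Rabs_pos|lra]. }
      apply exp_le_compat, H. }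
    set (M1 := strip_const * M * (1 / s + PI)).
    assert (HM1 : 0 <= M1).
    { unfold M1. assert (0 <= 1 / s) by (left; apply Rdiv_lt_0_compat; lra).
      apply Rmult_le_pos; [apply Rmult_le_pos|]; lra. }
    assert (Hlim : forall w, Re w < a -> Rabs (Im w) < PI ->
      Cmod (I (chart w) - Sp w - Y0)%C <= M1 * exp (s * Re w)).
    { intros w Hw Hi. eapply Rle_trans; [apply HY0; assumption|].
      apply Rmult_le_compat_r; [left; apply exp_pos|]. unfold M1.
      apply Rmult_le_compat_l; [apply Rmult_le_pos; lra|]. rewrite Rminus_0_r. lra. }
    exists Y0, (strip_const * M1). split.
    + intros w Hw Hi. eapply Rle_trans; [apply Hlim; assumption|].
      apply Rmult_le_compat_r; [left; apply exp_pos|]. nra.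
    + apply (closed_strip_bound (fun w => scaled_E (chart w) - Cexp (- (alpha * w)) * (Sp w + Y0))%C).
      * intros w Hw. apply ccont_minus; [apply scaled_E_chart_ccont, Hw|].
        apply ccont_mult; [apply Cexp_malpha_ccont|eapply cderiv_ccont, cderiv_plus_const, Sp_deriv].
      * intros w Hw Hi. rewrite scaled_E_chart by assumption.
        replace (Cexp (- (alpha * w)) * I (chart w) - Cexp (- (alpha * w)) * (Sp w + Y0))%C
          with (Cexp (- (alpha * w)) * (I (chart w) - Sp w - Y0))%C by ring.
        rewrite Cmod_mult.
        replace (strip_const * M1 * exp (2 * Re w)) with ((strip_const * exp (- Re alpha * Re w)) * (M1 * exp (s * Re w))).
        2:{ replace (2 * Re w) with (- Re alpha * Re w + s * Re w) by (unfold s; ring).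
            rewrite exp_plus. ring. }
        apply Rmult_le_compat; try apply Cmod_ge_0; [apply Cexp_malpha_bound; lra|apply Hlim; assumption].
Qed.

(* Any exponent in the open interval (1, 3/2) could replace 5/4. *)
Lemma remainder_bound : Re alpha <= - (3 / 2) ->
  exists (M' : R), forall w, Re w < a - 1 -> Rabs (Im w) <= PI ->
      Cmod (scaled_E (chart w) - Cexp (- (alpha * w)) * Sp w)%C <= M' * exp (5 / 4 * Re w).
Proof.
  intros Hal. set (s := Re alpha + 5 / 4). assert (Hs : s < 0) by (unfold s; lra).
  assert (HPI := PI_RGT_0). assert (Ha0 := a_nonpos).
  assert (HK : 0 < strip_const) by apply exp_pos.
  destruct (half_strip_bound (fun w => I (chart w) - Sp w)%C
    (fun w => Cexp (alpha * w) * (regular_factor (chart w) - regular_factor (z m) - (chart w - z m) * H1))%C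
    (fun y => Rabs y < PI) a s (strip_const * M) 0) with (l := PI) as [M1 HM1].
  - intros; apply strip_convex; assumption.
  - rewrite Rabs_R0. exact HPI.
  - intros w Hw Hi. apply remainder_deriv; assumption.
  - intros w Hw Hi. eapply Rle_trans; [apply remainder_deriv; assumption|].
    apply Rmult_le_compat_l; [apply Rmult_le_pos; lra|].
    (* As Re w < 0, the exponent 2 may be weakened to 5/4. This makes s negative for every alpha
       considered and avoids a logarithm at alpha = -2. *)
    assert (HE : (Re alpha + 2) * Re w <= s * Re w) by (unfold s; nra).
    apply exp_le_compat, HE.
  - exact Hs.
  - intros y Hy. rewrite Rminus_0_r. lra.
  - exists (strip_const * M1).
    apply (closed_strip_bound (fun w => scaled_E (chart w) - Cexp (- (alpha * w)) * Sp w)%C).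
    + intros w Hw. apply ccont_minus; [apply scaled_E_chart_ccont; lra|].
      apply ccont_mult; [apply Cexp_malpha_ccont|eapply cderiv_ccont, Sp_deriv].
    + intros w Hw Hi. rewrite scaled_E_chart by (assumption || lra).
      replace (Cexp (- (alpha * w)) * I (chart w) - Cexp (- (alpha * w)) * Sp w)%C
        with (Cexp (- (alpha * w)) * (I (chart w) - Sp w))%C by ring.
      rewrite Cmod_mult.
      replace (strip_const * M1 * exp (5 / 4 * Re w)) with ((strip_const * exp (- Re alpha * Re w)) * (M1 * exp (s * Re w))).
      2:{ replace (5 / 4 * Re w) with (- Re alpha * Re w + s * Re w) by (unfold s; ring).
          rewrite exp_plus. ring. }
      apply Rmult_le_compat; try apply Cmod_ge_0; [apply Cexp_malpha_bound; lra|].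
      apply (HM1 w); assumption.
Qed.

(* Since chart has period 2 pi i, the two sides of the cut at z_m give the same value of E. *)
Lemma monodromy (Y0 : C) (M' : R) :
  (forall w, Re w < a -> Rabs (Im w) <= PI ->
      Cmod (scaled_E (chart w) - Cexp (- (alpha * w)) * (Sp w + Y0))%C <= M' * exp (2 * Re w)) ->
  forall u, u < a ->
    Cmod (Cexp (- (alpha * (u, PI))) * (Sp (u, PI) + Y0)
      - Cexp (- (alpha * (u, (- PI)%R))) * (Sp (u, (- PI)%R) + Y0))%C <= 2 * M' * exp (2 * u).
Proof.
  intros H u Hu. assert (HPI := PI_RGT_0).
  assert (G1 := H (u, PI) Hu). assert (G2 := H (u, - PI) Hu). rewrite chart_period in G1.
  change (Im (u, PI)) with PI in G1. change (Im (u, - PI)) with (- PI) in G2.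
  change (Re (u, PI)) with u in G1. change (Re (u, - PI)) with u in G2.
  rewrite Rabs_Ropp in G2. rewrite (Rabs_pos_eq PI) in * by lra.
  specialize (G1 (Rle_refl _)). specialize (G2 (Rle_refl _)).
  rewrite Cmod_sub_sym in G1.
  eapply Rle_trans; [apply (Cmod_sub_triangle _ _ (scaled_E (chart (u, - PI))))|]. lra.
Qed.
End Principal.

Lemma cderiv_Cexp_scal (b w : C) : cderiv (fun w => Cexp (b * w)) w (b * Cexp (b * w))%C.
Proof.
  eapply cderiv_eq; [apply (cderiv_comp Cexp (fun w => b * w)%C); [apply cderiv_Cexp|apply cderiv_scal, cderiv_id]|].
  ring.
Qed.

Lemma chart_sub (w : C) : (chart w - z m)%C = (- Ci * Cexp w)%C.
Proof. unfold chart. ring. Qed.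

Lemma alpha_neq_0 : alpha <> 0.
Proof.
  intros H. apply Hcm. unfold alpha in H. assert (K2 := eps_neq_0).
  assert (EC := Ci_sqr).
  replace (c m) with (Ci * eps * (- Ci * c m / eps))%C.
  - rewrite H. ring.
  - transitivity (- (Ci * Ci) * c m)%C; [field; exact K2|rewrite EC; ring].
Qed.

(* H1 multiplies log(x - z_m) in the resonant case alpha = -1. *)
Lemma expansion_resonant : alpha = (- (1))%C ->
  exists (b0 b1 : C) (M' : R), forall w, Re w < a - 1 -> Rabs (Im w) <= PI ->
    Cmod (scaled_E (chart w) - b0 - b1 * (chart w - z m))%C <= M' * exp (5 / 4 * Re w).
Proof.
  intros Hal. assert (Ha0 := a_nonpos). assert (HPI := PI_RGT_0).
  set (Sp := fun w => (- regular_factor (z m) * Cexp (- (1) * w) + - Ci * H1 * w)%C).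
  assert (HSp : forall w, cderiv Sp w (Cexp (alpha * w) * (regular_factor (z m) + (chart w - z m) * H1))%C).
  { intros w. eapply cderiv_eq.
    - apply cderiv_plus; apply cderiv_scal; [apply cderiv_Cexp_scal|apply cderiv_id].
    - rewrite Hal, chart_sub. replace (- (1) * w)%C with (- w)%C by ring. rewrite Cexp_opp.
      field. apply Cexp_neq_0. }
  destruct (remainder_limit Sp HSp) as [Y0 [M' [_ HB]]].
  { rewrite Hal. unfold Re; simpl. lra. }
  assert (Hmono := monodromy Sp Y0 M' HB).
  (* Between the two sides of the cut the linear term of [Sp] changes by 2 PI H1 in modulus, while
     e^w is the same. Single-valuedness gives 2 PI e^u |H1| <= 2 M' e^{2u}, and u -> -oo. *)
  assert (EH1 : H1 = RtoC 0).
  { apply Cmod_eq_0. apply Rle_antisym; [|apply Cmod_ge_0].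
    apply (vanishing_exponential (Cmod H1) (M' / PI) 1 a Rlt_0_1). intros u Hu.
    specialize (Hmono u Hu). rewrite Hal in Hmono. rewrite Rmult_1_l.
    assert (E1 : forall y, (- (- (1) * ((u, y) : C)))%C = ((u, y) : C)) by (intros; ring).
    rewrite !E1 in Hmono.
    assert (E2 : Cexp (u, PI) = RtoC (- exp u)).
    { unfold Cexp, Re, Im; simpl. rewrite cos_PI, sin_PI. apply injective_projections; simpl; ring. }
    assert (E3 : Cexp (u, - PI) = RtoC (- exp u)).
    { unfold Cexp, Re, Im; simpl. rewrite cos_neg, sin_neg, cos_PI, sin_PI.
      apply injective_projections; simpl; ring. }
    assert (E4 : forall w, Cexp w <> 0 -> (Cexp w * (Sp w + Y0) =
      - regular_factor (z m) + Cexp w * (- Ci * H1 * w) + Cexp w * Y0)%C).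
    { intros w Hw. unfold Sp. replace (- (1) * w)%C with (- w)%C by ring. rewrite Cexp_opp.
      field. exact Hw. }
    rewrite !E4, E2, E3 in Hmono by apply Cexp_neq_0.
    assert (E5 : ((u, PI) - (u, (- PI)%R))%C = (Ci * RtoC (2 * PI))%C)
      by (apply injective_projections; simpl; ring).
    match type of Hmono with Cmod ?X <= _ => replace X with
      (RtoC (- exp u) * (- Ci * H1 * ((u, PI) - (u, (- PI)%R))))%C in Hmono by ring end.
    rewrite E5, !Cmod_mult, Cmod_opp, Cmod_Ci, !Cmod_R, Rabs_Ropp in Hmono.
    assert (He := exp_pos u). rewrite (Rabs_pos_eq (exp u)), (Rabs_pos_eq (2 * PI)) in Hmono by lra.
    replace (2 * u) with (u + u) in Hmono by ring. rewrite exp_plus in Hmono.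
    replace (M' / PI * exp u) with ((2 * M' * (exp u * exp u)) / (2 * PI * exp u)) by (field; lra).
    apply Rle_div_r; [nra|]. lra. }
  (* Since e^w = i (x - z_m), the constant [Y0], multiplied by e^{-alpha w} = e^w, becomes the
     linear term. *)
  exists (- regular_factor (z m))%C, (Ci * Y0)%C, (Rabs M'). intros w Hw Hi.
  assert (EC := Ci_sqr).
  replace (scaled_E (chart w) - - regular_factor (z m) - Ci * Y0 * (chart w - z m))%C
    with (scaled_E (chart w) - Cexp (- (alpha * w)) * (Sp w + Y0))%C.
  - eapply Rle_trans; [apply HB; [lra|exact Hi]|].
    assert (HE : exp (2 * Re w) <= exp (5 / 4 * Re w)) by (left; apply exp_increasing; lra).
    generalize (Rle_abs M') (Rabs_pos M') (exp_pos (2 * Re w)). nra.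
  - rewrite Hal, chart_sub. unfold Sp. rewrite EH1.
    replace (- (- (1) * w))%C with w by ring. replace (- (1) * w)%C with (- w)%C by ring.
    rewrite Cexp_opp.
    transitivity (scaled_E (chart w) + regular_factor (z m) + (Ci * Ci) * (Cexp w * Y0))%C; [rewrite EC; field; apply Cexp_neq_0|ring].
Qed.

(** The threshold -3/2 lies between -2 and -1: apart from the excluded values -1 and 0, only
    positive integers lie above it. *)
Lemma IZR_above (k : Z) : - (3 / 2) < IZR k -> RtoC (IZR k) <> 0 -> RtoC (IZR k) <> (- (1))%C ->
  exists n, IZR k = INR (S n).
Proof.
  intros H1' H2 H3.
  assert (Hk : (-2 < k)%Z) by (apply lt_IZR; lra).
  assert (Hk0 : k <> 0%Z) by (intros ->; apply H2; reflexivity).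
  assert (Hk1 : k <> (-1)%Z).
  { intros ->. apply H3. apply injective_projections; simpl; lra. }
  exists (Z.to_nat (k - 1)). rewrite INR_IZR_INZ. f_equal. lia.
Qed.

Lemma expansion_nonresonant : alpha <> (- (1))%C ->
  exists (b0 b1 : C) (M' : R), forall w, Re w < a - 1 -> Rabs (Im w) <= PI ->
    Cmod (scaled_E (chart w) - b0 - b1 * (chart w - z m))%C <= M' * exp (5 / 4 * Re w).
Proof.
  intros Hal. assert (Ha0 := a_nonpos). assert (HPI := PI_RGT_0). assert (Hal0 := alpha_neq_0).
  assert (Hal1 : (alpha + 1)%C <> 0).
  { intros H. apply Hal. replace alpha with ((alpha + 1) - 1)%C by ring. rewrite H. ring. }
  set (b0 := (regular_factor (z m) / alpha)%C). set (b1 := (H1 / (alpha + 1))%C).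
  set (Sp := fun w => (b0 * Cexp (alpha * w) + - Ci * b1 * Cexp ((alpha + 1) * w))%C).
  assert (HSp : forall w, cderiv Sp w (Cexp (alpha * w) * (regular_factor (z m) + (chart w - z m) * H1))%C).
  { intros w. eapply cderiv_eq.
    - apply cderiv_plus; apply cderiv_scal; apply cderiv_Cexp_scal.
    - rewrite chart_sub. replace ((alpha + 1) * w)%C with (alpha * w + w)%C by ring. rewrite Cexp_plus.
      unfold b0, b1. field. auto. }
  assert (ESp : forall w Y0, (Cexp (- (alpha * w)) * (Sp w + Y0))%C =
    (b0 + b1 * (chart w - z m) + Cexp (- (alpha * w)) * Y0)%C).
  { intros w Y0. rewrite chart_sub. unfold Sp.
    replace ((alpha + 1) * w)%C with (alpha * w + w)%C by ring. rewrite Cexp_plus, Cexp_opp.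
    field. apply Cexp_neq_0. }
  destruct (Rlt_le_dec (- (3 / 2)) (Re alpha)) as [L|L].
  - destruct (remainder_limit Sp HSp L) as [Y0 [M' [HY HB]]].
    assert (Hmono := monodromy Sp Y0 M' HB).
    assert (EY0 : Y0 = RtoC 0).
    (* For integer alpha the factor e^{-alpha w} is the same on both sides of the cut, so
       single-valuedness does not detect [Y0]; the assumption [I_zm] replaces it. *)
    { destruct (classic (Cexp (Ci * PI * alpha) = Cexp (- (Ci * PI * alpha)))) as [Hint|Hint].
      - destruct (Cexp_PI_integer alpha Hint) as [k Hk].
        destruct (IZR_above k) as [n Hn].
        + rewrite Hk in L. exact L.
        + rewrite <- Hk. exact Hal0.
        + rewrite <- Hk. exact Hal.
        + assert (Han : alpha = RtoC (INR (S n))) by (rewrite Hk, Hn; reflexivity).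
          assert (HR : Re alpha = INR (S n)) by (rewrite Han; reflexivity).
          assert (HIm : Im alpha = 0) by (rewrite Han; reflexivity).
          assert (Hn1 : 1 <= INR (S n)) by (rewrite S_INR; generalize (pos_INR n); lra).
          apply Cmod_eq_0. apply Rle_antisym; [|apply Cmod_ge_0]. apply le_epsilon. intros e He.
          destruct (I_zm n Han (e / 2) ltac:(lra)) as [d [Hd HId]].
          set (M2 := Cmod b0 + Cmod b1 + Rabs M').
          destruct (exp_small_left M2 1 (e / 2) Rlt_0_1 ltac:(lra)) as [T HT].
          (* A point so far to the left that I, [Sp] and the remainder are all small: I tends to 0
             by [I_zm], and [Sp] because alpha >= 1. Hence [Y0] is arbitrarily small. *)
          set (u := Rmin a (Rmin (ln d) T) - 1).
          assert (Hu1 : u < a) by (unfold u; generalize (Rmin_l a (Rmin (ln d) T)); lra).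
          assert (Hu2 : u < ln d).
          { unfold u; generalize (Rmin_r a (Rmin (ln d) T)) (Rmin_l (ln d) T); lra. }
          assert (Hu3 : u < T).
          { unfold u; generalize (Rmin_r a (Rmin (ln d) T)) (Rmin_r (ln d) T); lra. }
          set (w := (u, 0) : C). assert (Hi : Rabs (Im w) < PI) by (unfold w; simpl; rewrite Rabs_R0; exact HPI).
          assert (HIw : Cmod (I (chart w)) < e / 2).
          { apply HId; [apply chart_domain; [change (u < ln r); lra|exact Hi]|].
            rewrite Cmod_chart. apply exp_increasing in Hu2. rewrite exp_ln in Hu2 by exact Hd. exact Hu2. }
          assert (HYw := HY w Hu1 Hi). change (Re w) with u in HYw.
          assert (Hexp : forall q, 1 <= q -> exp (q * u) <= exp u).
          { intros q Hq. assert (HE : q * u <= u) by nra.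
            apply exp_le_compat, HE. }
          assert (HSw : Cmod (Sp w) <= (Cmod b0 + Cmod b1) * exp u).
          { unfold Sp. eapply Rle_trans; [apply Cmod_triangle|].
            rewrite !Cmod_mult, Cmod_opp, Cmod_Ci, !Cmod_Cexp, Rmult_1_l.
            replace (Re (alpha * w)) with (INR (S n) * u) by (rewrite Han; unfold w, Re; simpl; ring).
            replace (Re ((alpha + 1) * w)) with ((INR (S n) + 1) * u) by (rewrite Han; unfold w, Re; simpl; ring).
            generalize (Hexp (INR (S n)) Hn1) (Hexp (INR (S n) + 1) ltac:(lra)) (Cmod_ge_0 b0) (Cmod_ge_0 b1). nra. }
          specialize (HT u Hu3). rewrite Rmult_1_l in HT.
          assert (HYw' : Cmod (I (chart w) - Sp w - Y0) <= Rabs M' * exp u).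
          { eapply Rle_trans; [exact HYw|]. rewrite HR.
            generalize (Hexp (INR (S n) + 2) ltac:(lra)) (Rle_abs M') (Rabs_pos M') (exp_pos ((INR (S n) + 2) * u)). nra. }
          replace Y0 with (I (chart w) + - (Sp w + (I (chart w) - Sp w - Y0)))%C by ring.
          eapply Rle_trans; [apply Cmod_triangle|]. rewrite Cmod_opp.
          generalize (Cmod_triangle (Sp w) (I (chart w) - Sp w - Y0)).
          unfold M2 in HT. lra.
      (* Comparing the two sides of the cut gives |D| |Y0| e^{-Re alpha u} <= 2 M' e^{2u} with D <>
         0; since Re alpha + 2 > 0, this is impossible as u -> -oo unless [Y0] = 0. *)
      - apply NNPP. intros HY0.
        set (D := (Cexp (- (Ci * PI * alpha)) - Cexp (Ci * PI * alpha))%C).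
        assert (HD : 0 < Cmod D).
        { apply Cmod_gt_0. intros E0. apply Hint. unfold D in E0.
          replace (Cexp (Ci * PI * alpha)) with
            (Cexp (- (Ci * PI * alpha)) - (Cexp (- (Ci * PI * alpha)) - Cexp (Ci * PI * alpha)))%C by ring.
          rewrite E0. ring. }
        assert (HY0' : 0 < Cmod Y0) by (apply Cmod_gt_0, HY0).
        assert (Hle : Cmod D * Cmod Y0 <= 0).
        { apply (vanishing_exponential _ (2 * M') (2 + Re alpha) a); [lra|]. intros u Hu.
          specialize (Hmono u Hu). rewrite !ESp, chart_period in Hmono.
          match type of Hmono with Cmod ?X <= _ => replace X with
            ((Cexp (- (alpha * (u, PI))) - Cexp (- (alpha * (u, (- PI)%R)))) * Y0)%C in Hmono by ring end.
          assert (E1 : (- (alpha * (u, PI)))%C = (- (alpha * u) + - (Ci * PI * alpha))%C).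
          { replace ((u, PI) : C) with (RtoC u + Ci * PI)%C by (apply injective_projections; simpl; ring). ring. }
          assert (E2 : (- (alpha * (u, (- PI)%R)))%C = (- (alpha * u) + Ci * PI * alpha)%C).
          { replace ((u, (- PI)%R) : C) with (RtoC u - Ci * PI)%C by (apply injective_projections; simpl; ring). ring. }
          rewrite E1, E2, !Cexp_plus in Hmono.
          match type of Hmono with Cmod ?X <= _ => replace X with
            (Cexp (- (alpha * u)) * (D * Y0))%C in Hmono by (unfold D; ring) end.
          rewrite !Cmod_mult, Cmod_Cexp in Hmono.
          replace (Re (- (alpha * u))) with (- (Re alpha * u)) in Hmono by (unfold Re; simpl; ring).
          apply Rmult_le_reg_l with (exp (- (Re alpha * u))); [apply exp_pos|].
          eapply Rle_trans; [exact Hmono|]. right.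
          replace (2 * u) with (- (Re alpha * u) + (2 + Re alpha) * u) by ring. rewrite exp_plus. ring. }
        nra. }
    exists b0, b1, (Rabs M'). intros w Hw Hi.
    replace (scaled_E (chart w) - b0 - b1 * (chart w - z m))%C
      with (scaled_E (chart w) - Cexp (- (alpha * w)) * (Sp w + Y0))%C by (rewrite ESp, EY0; ring).
    eapply Rle_trans; [apply HB; [lra|exact Hi]|].
    assert (HE : exp (2 * Re w) <= exp (5 / 4 * Re w)) by (left; apply exp_increasing; lra).
    generalize (Rle_abs M') (Rabs_pos M') (exp_pos (2 * Re w)). nra.
  - destruct (remainder_bound Sp HSp L) as [M' HB].
    exists b0, b1, M'. intros w Hw Hi.
    replace (scaled_E (chart w) - b0 - b1 * (chart w - z m))%C
      with (scaled_E (chart w) - Cexp (- (alpha * w)) * Sp w)%C; [apply HB; assumption|].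
    replace (Sp w) with (Sp w + 0)%C by ring. rewrite ESp. ring.
Qed.

(** An error of order |x - z_m|^{5/4} is o(x - z_m), so b0 and b1 are the value and the derivative
    of [scaled_E] at z_m; dividing by the regular factor returns to [E]. *)
Lemma extension_deriv : exists E0 E1 : C,
  cderiv (fun x => if Ceq_dec x (z m) then E0 else E x) (z m) E1.
Proof.
  assert (Hexp : exists (b0 b1 : C) (M' : R), forall w, Re w < a - 1 -> Rabs (Im w) <= PI ->
    Cmod (scaled_E (chart w) - b0 - b1 * (chart w - z m))%C <= M' * exp (5 / 4 * Re w)).
  { destruct (classic (alpha = (- (1))%C)); [apply expansion_resonant|apply expansion_nonresonant]; assumption. }
  destruct Hexp as [b0 [b1 [M' HB]]].
  set (Kf := fun x => (- (Ci / eps) * / kappa x)%C).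
  assert (Hk0 : forall x, kappa x <> 0) by (intros; apply Cexp_neq_0).
  assert (Hzm : near_zm (z m)).
  { apply Hr_near. replace (z m - z m)%C with (RtoC 0) by ring. rewrite Cmod_0. lra. }
  destruct (holo2_cderiv near_zm (fun x => / kappa x)%C (z m)) as [k1 Hk1]; [|exact Hzm|].
  { apply holo2_inv; [intros; apply Hk0|apply holo2_kappa]. }
  set (B := fun x => if Ceq_dec x (z m) then b0 else scaled_E x).
  assert (HBd : cderiv B (z m) b1).
  { apply cderiv_iff. intros e He.
    destruct (exp_small_left (Rabs M') (1 / 4) e ltac:(lra) He) as [T HT].
    set (d := Rmin (exp (a - 1)) (exp T)).
    exists d. split; [apply Rmin_pos; apply exp_pos|]. intros x Hx.
    destruct (Rmin_Rgt_l _ _ _ Hx) as [Hx1 Hx2].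
    unfold B. destruct (Ceq_dec (z m) (z m)) as [_|n]; [|tauto].
    destruct (Ceq_dec x (z m)) as [->|Hne].
    - replace (b0 - b0 - (z m - z m) * b1)%C with (RtoC 0) by ring.
      replace (z m - z m)%C with (RtoC 0) by ring. rewrite Cmod_0. lra.
    - set (w := Log (Ci * (x - z m))). assert (Ew : chart w = x) by (apply chart_Log, Hne).
      rewrite <- Ew in *. rewrite Cmod_chart in *. apply exp_lt_inv in Hx1, Hx2.
      (* A point x on the cut gives Im w = PI; for its sake the expansion was carried to the closed
         strip. *)
      assert (Hi : Rabs (Im w) <= PI).
      { apply Rabs_le_between. apply Carg_bound. intros E0. apply Hne.
        assert (EC := Ci_sqr).
        rewrite Ew. replace x with (z m + - Ci * (Ci * (x - z m)))%C.
        - rewrite E0. ring.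
        - transitivity (z m + - (Ci * Ci) * (x - z m))%C; [ring|rewrite EC; ring]. }
      replace (scaled_E (chart w) - b0 - (chart w - z m) * b1)%C with (scaled_E (chart w) - b0 - b1 * (chart w - z m))%C by ring.
      eapply Rle_trans; [apply HB; assumption|].
      (* One factor exp (Re w) is |x - z_m| itself; the remaining exp (Re w / 4) is made small. *)
      replace (5 / 4 * Re w) with (1 / 4 * Re w + Re w) by field. rewrite exp_plus, <- Rmult_assoc.
      apply Rmult_le_compat_r; [left; apply exp_pos|].
      specialize (HT (Re w) Hx2). generalize (Rle_abs M') (exp_pos (1 / 4 * Re w)). nra. }
  exists (Kf (z m) * b0)%C. eexists.
  apply (cderiv_ext (fun x => Kf x * B x)%C).
  - intros x. unfold B, Kf. destruct (Ceq_dec x (z m)) as [->|Hne]; [reflexivity|].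
    unfold scaled_E. assert (K2 := eps_neq_0).
    assert (EC := Ci_sqr).
    transitivity (- (Ci * Ci) * E x)%C; [field; split; [apply Hk0|exact K2]|rewrite EC; ring].
  - apply cderiv_mult; [|exact HBd]. unfold Kf. apply cderiv_scal. exact Hk1.
Qed.
End Removable.
End Local.

(** * Gluing across the cuts *)

Lemma negative_integer_alpha (m : nat) :
  strictly_negative_integer (Ci * c m / eps)%C <-> exists n, alpha m = RtoC (INR (S n)).
Proof.
  assert (E : alpha m = (- (Ci * c m / eps))%C) by (unfold alpha; field; apply eps_neq_0).
  rewrite E. split.
  - intros [n [Hn ->]]. exists (pred n). replace (S (pred n)) with n by lia.
    rewrite <- RtoC_opp. f_equal. ring.
  - intros [n Hn]. exists (S n). split; [lia|].
    replace (Ci * c m / eps)%C with (- - (Ci * c m / eps))%C by ring.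
    rewrite Hn, RtoC_opp. reflexivity.
Qed.

Variable Is : nat -> C -> C.
Hypothesis HIs : forall m, is_primitive m (Is m).

(* band m is gap m if m >= 1, and band 0 is G_0. *)
Definition band (k : nat) (x : C) : Prop :=
  ((1 <= k)%nat -> Re (z k) < Re x) /\ ((k < P)%nat -> Re x < Re (z (S k))).

Lemma band_domain (k m : nat) (x : C) : (k <= P)%nat -> band k x -> domain m x.
Proof.
  intros Hk [H1 H2]. destruct k as [|k].
  - apply domain_left. apply H2. lia.
  - apply (domain_gap m (S k)); [lia|]. split; [apply H1; lia|exact H2].
Qed.

Lemma domain_0_P_band (x : C) : domain 0 x -> domain P x -> exists k, (k <= P)%nat /\ band k x.
Proof.
  intros H0 H1.
  assert (Hne : forall p, (1 <= p <= P)%nat -> Re x <> Re (z p)).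
  { intros p Hp E. destruct (H0 p Hp E) as [_ G0]. destruct (H1 p Hp E) as [G1 _].
    specialize (G0 ltac:(lia)). specialize (G1 ltac:(lia)). lra. }
  assert (H : forall n, (n <= P)%nat -> (exists k, (k <= P)%nat /\ band k x) \/
    ((1 <= n)%nat -> Re (z n) < Re x)).
  { induction n as [|n IH]; intros Hn; [right; lia|].
    destruct (IH ltac:(lia)) as [G|G]; [left; exact G|].
    destruct (Rtotal_order (Re x) (Re (z (S n)))) as [L|[L|L]].
    - left. exists n. split; [lia|]. split; [exact G|intros _; exact L].
    - exfalso. apply (Hne (S n)); [lia|exact L].
    - right. intros _. exact L. }
  destruct (H P (le_n P)) as [G|G]; [exact G|]. exists P. split; [lia|]. split; [exact G|lia].
Qed.

Lemma W_branch_band (m k : nat) (x : C) : (k <= m)%nat -> (m <= P)%nat -> band k x ->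
  W_branch m (Is m) x = W_branch k (Is k) x.
Proof.
  intros Hkm HmP Hb. induction Hkm as [|m Hkm IH]; [reflexivity|].
  rewrite <- IH by lia.
  apply (W_branch_left m (Is m) (Is (S m)) x); auto.
  - apply (band_domain k); [lia|exact Hb].
  - destruct Hb as [_ H2]. specialize (H2 ltac:(lia)).
    eapply Rlt_le_trans; [exact H2|]. apply Re_z_le; lia.
Qed.

Lemma exp_branch_band (m k : nat) (x : C) : (m <= k)%nat -> (k <= P)%nat -> band k x -> exp_branch m x = exp_branch 0 x.
Proof.
  intros Hmk HkP [H1 _]. apply (exp_branch_gap m k); assumption.
Qed.

Lemma W_branch_inv (m : nat) (I : C -> C) (x : C) : (exp_branch m x * (W_branch m I x * (Ci * eps)))%C = I x.
Proof.
  unfold W_branch. assert (K2 := eps_neq_0). assert (K1 := exp_branch_neq_0 m x).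
  assert (EC := Ci_sqr).
  transitivity (- (Ci * Ci) * I x)%C; [field; auto|rewrite EC; ring].
Qed.

Lemma cderiv_W_branch (m : nat) (x : C) : domain m x -> exists l, cderiv (W_branch m (Is m)) x l.
Proof.
  intros Hx. destruct (holo2_cderiv (domain m) (fun x => / exp_branch m x)%C x) as [l1 Hl1].
  - apply holo2_inv; [intros; apply exp_branch_neq_0|apply holo2_exp_branch; assumption].
  - exact Hx.
  - eexists. unfold W_branch. apply cderiv_mult; [apply cderiv_scal, Hl1|apply HIs, Hx].
Qed.

Lemma ccont_W_branch (m : nat) (x : C) : domain m x -> ccont (W_branch m (Is m)) x.
Proof. intros Hx. destruct (cderiv_W_branch m x Hx) as [l Hl]. eapply cderiv_ccont, Hl. Qed.

(** In band m the branches 0 and m of e^{-ih/eps} coincide, so [Is 0] and [Is m] are primitives of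
    the same function on a convex set. *)
Lemma band_difference (m : nat) (x y : C) : (m <= P)%nat -> band m x -> band m y ->
  (Is 0 x - Is m x)%C = (Is 0 y - Is m y)%C.
Proof.
  intros Hm [X1 X2] [Y1 Y2]. apply (primitive_unique_segment (Is 0) (Is m) (integrand_branch 0)). intros t Ht.
  assert (Hb : band m (y + RtoC t * (x - y))%C).
  { split; intros L; rewrite Re_segment; [apply convex_gt|apply convex_lt]; auto. }
  split; [apply HIs, (band_domain m); assumption|].
  replace (integrand_branch 0 (y + RtoC t * (x - y))%C) with (integrand_branch m (y + RtoC t * (x - y))%C).
  - apply HIs, (band_domain m); assumption.
  - unfold integrand_branch. rewrite (exp_branch_band m m) by (lia || assumption). reflexivity.
Qed.

(** For m >= 1 this expresses the vanishing of the integral over U_m without reference to a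
    contour. *)
Definition agree (m : nat) : Prop := forall x, band m x -> Is 0 x = Is m x.

Lemma agree_0 : agree 0.
Proof. intros x _. reflexivity. Qed.

Lemma agree_of_point (m : nat) (y : C) : (m <= P)%nat -> band m y -> Is 0 y = Is m y -> agree m.
Proof.
  intros Hm Hy E x Hx. assert (H := band_difference m x y Hm Hx Hy).
  replace (Is 0 x) with ((Is 0 x - Is m x) + Is m x)%C by ring. rewrite H, E. ring.
Qed.

Lemma W_branch_agree (m : nat) (x : C) : (m <= P)%nat -> agree m -> band m x -> W_branch m (Is m) x = W_branch 0 (Is 0) x.
Proof.
  intros Hm HA Hx. unfold W_branch. rewrite (exp_branch_band m m), (HA x Hx) by (lia || assumption). reflexivity.
Qed.

Lemma cut_domain (k : nat) (t : R) : (S k <= P)%nat -> 0 < t -> domain (S k) (z (S k) + Ci * t)%C.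
Proof.
  intros Hk Ht p Hp HRe.
  assert (E1 : Re (z (S k) + Ci * t)%C = Re (z (S k))) by (unfold Re; simpl; ring).
  assert (E2 : Im (z (S k) + Ci * t)%C = Im (z (S k)) + t) by (unfold Im; simpl; ring).
  rewrite E1 in HRe. rewrite E2.
  destruct (Nat.lt_total p (S k)) as [L|[L|L]].
  - assert (Re (z p) < Re (z (S k))) by (apply Re_z_lt; lia). lra.
  - subst p. split; [intros _; lra|lia].
  - assert (Re (z (S k)) < Re (z p)) by (apply Re_z_lt; lia). lra.
Qed.

Lemma cut_sides (k : nat) (y : C) (d : R) : (S k <= P)%nat -> Re y = Re (z (S k)) -> 0 < d ->
  (exists x, band k x /\ Cmod (x - y)%C < d /\ Im x = Im y) /\
  (exists x, band (S k) x /\ Cmod (x - y)%C < d /\ Im x = Im y).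
Proof.
  intros Hk HRe Hd.
  assert (Hl : exists s, 0 < s /\ s < d /\ ((1 <= k)%nat -> Re (z k) < Re y - s)).
  { destruct k as [|k]; [exists (d / 2); split; [lra|split; [lra|lia]]|].
    assert (Re (z (S k)) < Re (z (S (S k)))) by (apply Re_z_lt; lia).
    set (q := Re y - Re (z (S k))). assert (0 < q) by (unfold q; lra).
    exists (Rmin d q / 2). generalize (Rmin_l d q) (Rmin_r d q) (Rmin_pos d q Hd H0).
    split; [lra|split; [lra|intros _; unfold q in *; lra]]. }
  assert (Hr : exists s, 0 < s /\ s < d /\ ((S k < P)%nat -> Re y + s < Re (z (S (S k))))).
  { destruct (Nat.lt_ge_cases (S k) P) as [L|L]; [|exists (d / 2); split; [lra|split; [lra|lia]]].
    assert (Re (z (S k)) < Re (z (S (S k)))) by (apply Re_z_lt; lia).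
    set (q := Re (z (S (S k))) - Re y). assert (0 < q) by (unfold q; lra).
    exists (Rmin d q / 2). generalize (Rmin_l d q) (Rmin_r d q) (Rmin_pos d q Hd H0).
    split; [lra|split; [lra|intros _; unfold q in *; lra]]. }
  split.
  - destruct Hl as [s [Hs [Hsd Hl]]]. exists (Re y + - s, Im y). split; [|split; [|reflexivity]].
    + split; change (Re (Re y + - s, Im y)) with (Re y + - s); intros L; [specialize (Hl L)|]; lra.
    + rewrite Cmod_shift_Re, Rabs_Ropp, Rabs_pos_eq; lra.
  - destruct Hr as [s [Hs [Hsd Hr]]]. exists (Re y + s, Im y). split; [|split; [|reflexivity]].
    + split; change (Re (Re y + s, Im y)) with (Re y + s); intros L; [|specialize (Hr L)]; lra.
    + rewrite Cmod_shift_Re, Rabs_pos_eq; lra.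
Qed.

(** It is enough to look at one point y above z_m, where both E and W_m are continuous. To the left
    of it W_m = W_k = W_0 = E, by [W_branch_band] and the induction hypothesis, so E = W_m at y. *)
Lemma agree_of_extension (E : C -> C) :
  (forall x, 0 < Im x -> domain 0 x -> E x = W_branch 0 (Is 0) x) ->
  (forall x, 0 < Im x -> ccont E x) ->
  forall m, (m <= P)%nat -> agree m.
Proof.
  intros HE HEc. induction m as [|k IH]; intros Hm; [apply agree_0|].
  specialize (IH ltac:(lia)). set (m := S k) in *.
  set (y := (z m + Ci * 1)%C).
  assert (Hy : domain m y) by (apply (cut_domain k 1); [exact Hm|lra]).
  assert (Hzm := Hz m ltac:(unfold m in *; lia)).
  assert (HIy : Im y = Im (z m) + 1) by (unfold y, Im; simpl; ring).
  assert (HRy : Re y = Re (z m)) by (unfold y, Re; simpl; ring).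
  assert (Hc1 : ccont (fun x => E x - W_branch m (Is m) x)%C y).
  { apply ccont_minus; [apply HEc; lra|apply ccont_W_branch, Hy]. }
  assert (E0 : (E y - W_branch m (Is m) y)%C = 0).
  { apply (ccont_value (fun x => E x - W_branch m (Is m) x)%C y 0 Hc1). intros d Hd.
    destruct (cut_sides k y d Hm HRy Hd) as [[x [Hx [Hxd HxI]]] _].
    exists x. split; [exact Hxd|].
    rewrite HE by (try (apply (band_domain k); [lia|exact Hx]); lra).
    rewrite (W_branch_band m k x) by (unfold m; lia || assumption).
    rewrite (W_branch_agree k x) by (lia || assumption). ring. }
  destruct (cut_sides k y 1 Hm HRy Rlt_0_1) as [_ [x1 [Hx1 _]]].
  (* To the right of the cut this product is the constant value of [Is 0 - Is m] in band m, so it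
     has that value at y too, where by E0 it is 0. *)
  assert (E2 : (exp_branch m y * ((E y - W_branch m (Is m) y) * (Ci * eps)))%C = (Is 0 x1 - Is m x1)%C).
  { apply (ccont_value (fun x => exp_branch m x * ((E x - W_branch m (Is m) x) * (Ci * eps)))%C).
    - apply ccont_mult; [apply (holo2_ccont (domain m)); [apply holo2_exp_branch; assumption|exact Hy]|].
      apply ccont_mult; [exact Hc1|apply ccont_const].
    - intros d Hd. destruct (cut_sides k y d Hm HRy Hd) as [_ [x [Hx [Hxd HxI]]]].
      exists x. split; [exact Hxd|].
      rewrite (band_difference m x1 x Hm Hx1 Hx).
      rewrite HE by (try (apply (band_domain m); [lia|exact Hx]); lra).
      rewrite <- (W_branch_inv 0 (Is 0) x), <- (W_branch_inv m (Is m) x).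
      rewrite (exp_branch_band m m x) by (lia || assumption). ring. }
  apply (agree_of_point m x1 Hm Hx1).
  rewrite E0 in E2.
  replace (Is 0 x1) with ((Is 0 x1 - Is m x1) + Is m x1)%C by ring. rewrite <- E2. ring.
Qed.

(** * Singularities reached by a contour ending at z_m *)

Lemma ell0_integral (m : nat) (K : contour) : (1 <= m <= P)%nat ->
  strictly_negative_integer (Ci * c m / eps)%C -> is_ell0 P c z m K ->
  abs_convergent eps lambda P z v K /\
  exists Y0, contour_int eps lambda P z v K = Y0 /\
    forall e, 0 < e -> exists d, 0 < d /\ forall x, domain 0 x -> Cmod (x - z m)%C < d ->
      Cmod (Is 0 x - Y0)%C < e.
Proof.
  intros Hm Hn [gamma [-> [Hg [Ho [HG E]]]]].
  apply (negative_integer_alpha m) in Hn. destruct Hn as [n Hn].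
  destruct (near_zm_ball m Hm) as [r [Hr [HrI Hrn]]].
  destruct (integrand_branch_removable m Hm r Hr Hrn n Hn) as [g [Hgc Hgb]].
  destruct (I_limit_zm m Hm r Hr HrI Hrn (Is 0) (HIs 0) n Hn) as [Y0 HY0].
  assert (Hgam : forall d, 0 < d -> at_left 0 (fun t => domain 0 (gamma t) /\ Cmod (gamma t - z m)%C < d)).
  { intros d Hd. assert (Hlim := filterlim_locally_left gamma 0 (gamma 0) (proj1 Hg 0)).
    rewrite E in Hlim.
    assert (H1 : at_left 0 (fun t => Cmod (gamma t - z m)%C < d))
      by exact (proj1 (clim_iff (at_left 0) gamma (z m)) Hlim d Hd).
    assert (H2 : at_left 0 (fun t => t < 0)) by (exists (mkposreal 1 Rlt_0_1); intros t _ Ht; exact Ht).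
    generalize (filter_and _ _ H1 H2). apply filter_imp. intros t [G1 G2]. split; [|exact G1].
    apply G_iff, HG, G2. }
  destruct (contour_G_integral (Is 0) gamma (g (z m)) Y0) as [H1 H2];
    try assumption.
  - apply HIs.
  - apply (clim_iff (at_left 0)). intros e He. destruct (Hgc e He) as [d [Hd Hgd]].
    generalize (Hgam (Rmin r d) (Rmin_pos _ _ (proj1 Hr) Hd)). apply filter_imp.
    intros t [G1 G2].
    rewrite (Hgb (gamma t) G1); [|exact (Rlt_Rmin_l _ _ _ G2)].
    apply Hgd. exact (Rlt_Rmin_r _ _ _ G2).
  - apply (clim_iff (at_left 0)). intros e He. destruct (HY0 e He) as [d [Hd HYd]].
    generalize (Hgam d Hd). apply filter_imp. intros t [G1 G2]. apply HYd; assumption.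
  - split; [exact H1|]. exists Y0. split; [exact H2|exact HY0].
Qed.

Lemma domain_near_zm (m : nat) (d : R) : (1 <= m <= P)%nat -> 0 < d ->
  exists x, domain 0 x /\ Cmod (x - z m)%C < d.
Proof.
  intros Hm Hd. destruct (near_zm_ball m Hm) as [r [Hr [HrI Hrn]]].
  set (r1 := Rmin r d). assert (Hr1 : 0 < r1) by (apply Rmin_pos; lra).
  set (w := (ln r1 - 1, 0) : C).
  assert (Hln : ln r1 <= ln r).
  { apply ln_le_compat; [exact Hr1|apply Rmin_l]. }
  exists (chart m w). split.
  - apply (chart_domain m Hm r Hr HrI Hrn).
    + change (ln r1 - 1 < ln r). lra.
    + change (Rabs 0 < PI). rewrite Rabs_R0. apply PI_RGT_0.
  - rewrite Cmod_chart. apply Rlt_le_trans with r1; [|apply Rmin_r].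
    assert (L : exp (Re w) < exp (ln r1)) by (apply exp_increasing; change (ln r1 - 1 < ln r1); lra).
    rewrite (exp_ln r1 Hr1) in L. exact L.
Qed.

(* e^{-ih/eps} vanishes at z_m in this case, so a bounded W_+ forces the integral to vanish there. *)
Lemma I_vanishes_of_extension (E : C -> C) (m n : nat) (Y0 : C) : (1 <= m <= P)%nat ->
  (forall x, 0 < Im x -> domain 0 x -> E x = W_branch 0 (Is 0) x) ->
  (forall x, 0 < Im x -> ccont E x) ->
  alpha m = RtoC (INR (S n)) ->
  (forall e, 0 < e -> exists d, 0 < d /\ forall x, domain 0 x -> Cmod (x - z m)%C < d ->
      Cmod (Is 0 x - Y0)%C < e) -> Y0 = RtoC 0.
Proof.
  intros Hm HE HEc Hn HY. destruct (near_zm_ball m Hm) as [r [Hr [HrI Hrn]]].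
  (* The power is e^{alpha w} written without a logarithm, so [F] equals [Is 0] on domain 0 near
     z_m, is continuous at z_m and vanishes there. *)
  set (F := fun x => ((Ci * (x - z m)) ^ S n * (kappa m x * (E x * (Ci * eps))))%C).
  assert (Hnz : near_zm m (z m)).
  { apply Hrn. replace (z m - z m)%C with (RtoC 0) by ring. rewrite Cmod_0. lra. }
  assert (HF : ccont F (z m)).
  { apply ccont_mult.
    - clear. induction (S n) as [|k IH]; [apply (ccont_const 1)|].
      apply (ccont_mult (fun x => Ci * (x - z m))%C); [eapply cderiv_ccont, cderiv_shift|exact IH].
    - apply ccont_mult.
      + apply (holo2_ccont (near_zm m)); [apply holo2_kappa; assumption|exact Hnz].
      + apply ccont_mult; [apply HEc, Hz, Hm|apply ccont_const]. }
  assert (F0 : F (z m) = RtoC 0).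
  { unfold F. replace (z m - z m)%C with (RtoC 0) by ring. simpl. ring. }
  assert (HFI : forall x, domain 0 x -> Cmod (x - z m)%C < r -> F x = Is 0 x).
  { intros x HR Hx. rewrite <- (W_branch_inv 0 (Is 0) x), <- HE; [|apply Hrn, Hx|exact HR].
    unfold F. rewrite (exp_branch_factor m Hm), Hn, Cexp_natural_power.
    rewrite Cexp_Log; [ring|]. destruct (domain_slit 0 m x Hm HR) as [_ [Hs _]].
    apply slit_neq_0, Hs. lia. }
  apply Cmod_eq_0. apply Rle_antisym; [|apply Cmod_ge_0]. apply le_epsilon. intros e He.
  destruct (HY (e / 2) ltac:(lra)) as [d1 [Hd1 G1]]. destruct (HF (e / 2) ltac:(lra)) as [d2 [Hd2 G2]].
  destruct (domain_near_zm m (Rmin r (Rmin d1 d2)) Hm) as [x [HR Hx]].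
  { repeat apply Rmin_pos; lra. }
  assert (Hx0 : Cmod (x - z m) < r) by exact (Rlt_Rmin_l _ _ _ Hx).
  assert (Hx1 : Cmod (x - z m) < d1)
    by (eapply Rlt_le_trans; [exact Hx|]; eapply Rle_trans; [apply Rmin_r|apply Rmin_l]).
  assert (Hx2 : Cmod (x - z m) < d2)
    by (eapply Rlt_le_trans; [exact Hx|]; eapply Rle_trans; [apply Rmin_r|apply Rmin_r]).
  specialize (G1 x HR Hx1). specialize (G2 x Hx2). rewrite F0, HFI in G2 by assumption.
  rewrite Cmod_sub_sym in G1.
  replace Y0 with ((Y0 - Is 0 x) + (Is 0 x - 0))%C by ring.
  eapply Rle_trans; [apply Cmod_triangle|]. lra.
Qed.

(** For alpha a positive integer the jump is 1, so [Is m] = [Is 0] to the left of the cut. Near z_m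
    the values of [Is 0] on both sides are small, and [Is m] is continuous across the cut; hence the
    constant difference in band m is arbitrarily small. *)
Lemma agree_step_removable (k n : nat) : (S k <= P)%nat -> agree k ->
  alpha (S k) = RtoC (INR (S n)) ->
  (forall e, 0 < e -> exists d, 0 < d /\ forall x, domain 0 x -> Cmod (x - z (S k))%C < d ->
      Cmod (Is 0 x) < e) -> agree (S k).
Proof.
  intros Hk IH Hn HY. set (m := S k) in *.
  assert (Hj : jump m = RtoC 1).
  { unfold jump. replace (2 * PI * c m / eps)%C with (INR (S n) * (Ci * PI + Ci * PI))%C.
    - rewrite Cexp_natural_power, Cexp_plus, Cexp_Ci_PI.
      replace (- (1) * - (1))%C with (RtoC 1) by ring. clear. induction (S n) as [|j IH]; simpl; [reflexivity|rewrite IH; ring].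
    - rewrite <- Hn. unfold alpha.
      assert (EC := Ci_sqr).
      assert (K2 := eps_neq_0).
      transitivity (- (Ci * Ci) * (2 * PI * c m / eps))%C; [field; exact K2|rewrite EC; ring]. }
  set (y0 := (z m + Ci * 1)%C). assert (HRy : Re y0 = Re (z m)) by (unfold y0, Re; simpl; ring).
  destruct (cut_sides k y0 1 Hk HRy Rlt_0_1) as [_ [x1 [Hx1 _]]].
  apply (agree_of_point m x1 Hk Hx1).
  assert (HD : (Is 0 x1 - Is m x1)%C = 0).
  { apply Cmod_eq_0. apply Rle_antisym; [|apply Cmod_ge_0]. apply le_epsilon. intros e He.
    destruct (HY (e / 4) ltac:(lra)) as [d [Hd HYd]].
    set (y := (z m + Ci * (d / 2)%R)%C).
    assert (Hy : domain m y) by (apply (cut_domain k (d / 2)); [exact Hk|lra]).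
    assert (Hyz : Cmod (y - z m) = d / 2).
    { replace (y - z m)%C with (Ci * (d / 2)%R)%C by (unfold y; ring).
      rewrite Cmod_mult, Cmod_Ci, Cmod_R, Rabs_pos_eq; lra. }
    assert (HRy' : Re y = Re (z m)) by (unfold y, Re; simpl; ring).
    destruct (primitive_ccont m (Is m) y (HIs m) Hy (e / 4) ltac:(lra)) as [d' [Hd' Hcy]].
    destruct (cut_sides k y (Rmin (d / 2) d') Hk HRy') as [[xl [Hl [Hld _]]] [xr [Hr [Hrd _]]]].
    { apply Rmin_pos; lra. }
    assert (Hnear : forall x, Cmod (x - y) < Rmin (d / 2) d' -> Cmod (x - z m) < d /\ Cmod (x - y) < d').
    { intros x Hx. assert (A1 := Rlt_Rmin_l _ _ _ Hx).
      assert (A2 := Rlt_Rmin_r _ _ _ Hx). split; [|exact A2].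
      eapply Rle_lt_trans; [apply (Cmod_sub_triangle x (z m) y)|]. lra. }
    destruct (Hnear xl Hld) as [L1 L2]. destruct (Hnear xr Hrd) as [R1 R2].
    assert (A1 := HYd xl (band_domain k 0 xl ltac:(lia) Hl) L1).
    assert (A2 := HYd xr (band_domain m 0 xr Hk Hr) R1).
    assert (El : Is m xl = Is 0 xl).
    { unfold m. rewrite (primitive_left k (Is k) (Is (S k)) xl Hk (HIs k) (HIs (S k))).
      - fold m. rewrite Hj, (IH xl Hl). ring.
      - apply (band_domain k); [lia|exact Hl].
      - apply Hl. lia. }
    rewrite (band_difference m x1 xr Hk Hx1 Hr).
    assert (B1 := Hcy xl L2). assert (B2 := Hcy xr R2). rewrite El in B1.
    replace (Is 0 xr - Is m xr)%C with
      (Is 0 xr + - ((Is m xr - Is m y) + (- (Is 0 xl - Is m y) + Is 0 xl)))%C by ring.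
    eapply Rle_trans; [apply Cmod_triangle|]. rewrite Cmod_opp.
    assert (T1 := Cmod_triangle (Is m xr - Is m y) (- (Is 0 xl - Is m y) + Is 0 xl)).
    assert (T2 := Cmod_triangle (- (Is 0 xl - Is m y)) (Is 0 xl)). rewrite Cmod_opp in T2. lra. }
  replace (Is 0 x1) with ((Is 0 x1 - Is m x1) + Is m x1)%C by ring. rewrite HD. ring.
Qed.

(* The domains of the branches 0 and P cover the upper half plane except z_1, ..., z_P. *)
Definition glued (x : C) : C :=
  if excluded_middle_informative (domain 0 x) then W_branch 0 (Is 0) x else W_branch P (Is P) x.

(** * Construction of the extension *)

Section Agreement.
Hypothesis Hagree : forall m, (m <= P)%nat -> agree m.
Hypothesis Hvanish : forall m n, (1 <= m <= P)%nat -> alpha m = RtoC (INR (S n)) ->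
  forall e, 0 < e -> exists d, 0 < d /\ forall x, domain 0 x -> Cmod (x - z m)%C < d ->
      Cmod (Is 0 x) < e.

Lemma glued_0 (x : C) : domain 0 x -> glued x = W_branch 0 (Is 0) x.
Proof. intros Hx. unfold glued. destruct (excluded_middle_informative (domain 0 x)); tauto. Qed.

(** Where the domains 0 and P overlap, x lies in some band k, and there W_P = W_k = W_0; the
    preference given to branch 0 in [glued] is therefore immaterial. *)
Lemma glued_P (x : C) : domain P x -> glued x = W_branch P (Is P) x.
Proof.
  intros Hx. unfold glued. destruct (excluded_middle_informative (domain 0 x)) as [H|H]; [|reflexivity].
  destruct (domain_0_P_band x H Hx) as [k [Hk Hb]].
  rewrite (W_branch_band P k x Hk (le_n P) Hb). symmetry. apply W_branch_agree; auto.
Qed.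

Lemma domain_cases (x : C) : 0 < Im x -> (forall p, (1 <= p <= P)%nat -> x <> z p) ->
  domain 0 x \/ domain P x.
Proof.
  intros Hx Hne. destruct (classic (domain 0 x)) as [H|H]; [left; exact H|right].
  intros p Hp HRe. split; [intros _|lia].
  destruct (Rlt_le_dec (Im (z p)) (Im x)) as [L|L]; [exact L|exfalso].
  assert (L' : Im x < Im (z p)).
  { destruct (Rle_lt_or_eq_dec _ _ L) as [Q|Q]; [exact Q|]. exfalso. apply (Hne p Hp).
    destruct x, (z p). unfold Re, Im in *. simpl in *. congruence. }
  apply H. intros q Hq HRq. split; [lia|intros _].
  assert (q = p).
  { destruct (Nat.lt_total q p) as [Q|[Q|Q]]; [|exact Q|].
    - assert (Re (z q) < Re (z p)) by (apply Re_z_lt; lia). exfalso; lra.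
    - assert (Re (z p) < Re (z q)) by (apply Re_z_lt; lia). exfalso; lra. }
  subst q. generalize (Hz p Hp). lra.
Qed.

Lemma glued_deriv (x : C) : 0 < Im x -> (forall p, (1 <= p <= P)%nat -> x <> z p) ->
  exists l, cderiv glued x l.
Proof.
  intros Hx Hne. destruct (domain_cases x Hx Hne) as [H|H];
  destruct (domain_open _ x H) as [r [Hr HO]]; destruct (cderiv_W_branch _ x H) as [l Hl];
  exists l; (eapply cderiv_ext_loc; [exact Hr| |exact Hl]); intros y Hy; symmetry.
  - apply glued_0, HO, Hy.
  - apply glued_P, HO, Hy.
Qed.

Lemma glued_at_zm (m : nat) : (1 <= m <= P)%nat -> exists E0 E1 : C,
  cderiv (fun x => if Ceq_dec x (z m) then E0 else glued x) (z m) E1.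
Proof.
  intros Hm. destruct (near_zm_ball m Hm) as [r [Hr [HrI Hrn]]].
  destruct (taylor_quadratic (near_zm m) (regular_factor m) (z m) r (proj1 Hr)
    (holo2_regular_factor m Hm) Hrn) as [H1 [M [r' [HM [Hr' HT]]]]].
  apply (extension_deriv m Hm (Hc0 m Hm) r Hr HrI Hrn (Is 0) (HIs 0)
    glued H1 M (ln r')).
  - intros x HR _. apply glued_0, HR.
  - intros x Hne Hx. assert (Hnx := Hrn x Hx). destruct (glued_deriv x) as [l Hl].
    + apply Hnx.
    + intros p Hp E. destruct (Nat.eq_dec p m) as [->|Hpm]; [auto|].
      apply (near_zm_neq m p x Hp Hpm Hnx). rewrite E. ring.
    + eapply cderiv_ccont, Hl.
  - intros n Hn. apply (Hvanish m n Hm Hn).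
  - exact HM.
  - apply ln_le_compat; apply Hr'.
  - intros w Hw. replace (exp (2 * Re w)) with (Cmod (chart m w - z m) * Cmod (chart m w - z m)).
    + apply HT. rewrite Cmod_chart. apply exp_increasing in Hw. rewrite exp_ln in Hw; lra.
    + rewrite Cmod_chart, <- exp_plus. f_equal. ring.
Qed.

Lemma extension_exists : exists E : C -> C,
  (forall x, 0 < Im x -> domain 0 x -> E x = W_branch 0 (Is 0) x) /\
  (forall x, 0 < Im x -> exists l, cderiv E x l).
Proof.
  (* Vacuous for m outside 1, ..., P, so that the values at all the singularities can be chosen by
     one function on nat. *)
  set (Q := fun (m : nat) (E0 : C) => (1 <= m <= P)%nat -> exists E1 : C,
    cderiv (fun x => if Ceq_dec x (z m) then E0 else glued x) (z m) E1).
  assert (HQ : forall m, exists E0, Q m E0).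
  { intros m. destruct (classic (1 <= m <= P)%nat) as [Hm|Hm].
    - destruct (glued_at_zm m Hm) as [E0 [E1 H]]. exists E0. intros _. exists E1. exact H.
    - exists (RtoC 0). intros H. contradiction. }
  set (e0 := fun m => proj1_sig (constructive_indefinite_description _ (HQ m))).
  assert (He0 : forall m, Q m (e0 m)).
  { intros m. unfold e0. destruct (constructive_indefinite_description _ (HQ m)) as [E0 H]. exact H. }
  set (isz := fun x m => (1 <= m <= P)%nat /\ x = z m).
  set (E := fun x => match excluded_middle_informative (exists m, isz x m) with
    | left H => e0 (proj1_sig (constructive_indefinite_description _ H))
    | right _ => glued x end).
  assert (HEn : forall x, (forall p, (1 <= p <= P)%nat -> x <> z p) -> E x = glued x).
  { intros x Hx. unfold E. destruct (excluded_middle_informative _) as [[m [Hm Em]]|_]; [|reflexivity].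
    exfalso. apply (Hx m Hm Em). }
  assert (Hinj : forall p q, (1 <= p <= P)%nat -> (1 <= q <= P)%nat -> z p = z q -> p = q).
  { intros p q Hp Hq Hpq. apply (f_equal Re) in Hpq.
    destruct (Nat.lt_total p q) as [L|[L|L]]; [|exact L|].
    - assert (Re (z p) < Re (z q)) by (apply Re_z_lt; lia). exfalso; lra.
    - assert (Re (z q) < Re (z p)) by (apply Re_z_lt; lia). exfalso; lra. }
  assert (HEz : forall m, (1 <= m <= P)%nat -> E (z m) = e0 m).
  { intros m Hm. unfold E. destruct (excluded_middle_informative _) as [H|H].
    - destruct (constructive_indefinite_description _ H) as [p [Hp Ep]]. simpl. f_equal.
      symmetry. apply Hinj; assumption.
    - exfalso. apply H. exists m. split; [exact Hm|reflexivity]. }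
  exists E. split.
  - intros x _ HR. rewrite HEn; [apply glued_0, HR|]. intros p Hp Ex.
    destruct (domain_neq 0 p x Hp HR) as [Hne _]. apply Hne. rewrite Ex. ring.
  - intros x Hx. destruct (classic (exists m, isz x m)) as [[m [Hm ->]]|Hn].
    + destruct (He0 m Hm) as [E1 HE1]. exists E1.
      destruct (near_zm_ball m Hm) as [r [Hr [HrI Hrn]]].
      eapply cderiv_ext_loc; [exact (proj1 Hr)| |exact HE1]. intros y Hy. simpl.
      destruct (Ceq_dec y (z m)) as [->|Hne]; [symmetry; apply HEz, Hm|].
      symmetry. apply HEn. intros p Hp Ey. destruct (Nat.eq_dec p m) as [->|Hpm]; [auto|].
      apply (near_zm_neq m p y Hp Hpm (Hrn y Hy)). rewrite Ey. ring.
    + assert (Hne : forall p, (1 <= p <= P)%nat -> x <> z p).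
      { intros p Hp Ex. apply Hn. exists p. split; assumption. }
      destruct (glued_deriv x Hx Hne) as [l Hl]. exists l.
      destruct (finite_radius P (fun p y => y <> z p) x) as [r [Hr HO]].
      { intros p Hp. exists (Cmod (x - z p)). split.
        - apply Cmod_gt_0. intros E0. apply (Hne p Hp).
          replace x with ((x - z p) + z p)%C by ring. rewrite E0. ring.
        - intros y Hy ->. rewrite Cmod_sub_sym in Hy. lra. }
      eapply cderiv_ext_loc; [exact Hr| |exact Hl]. intros y Hy. symmetry. apply HEn. auto.
Qed.
End Agreement.
End Data.

(** * Equivalence of analyticity and the contour conditions *)

Theorem corollary1
  (eps : R) (P : nat) (c z : nat -> C) (lambda : R) (v : nat -> C)
  (Heps : 0 < eps)
  (HP : (1 <= P)%nat)
  (Hc : forall p : nat, (1 <= p <= P)%nat -> c p <> RtoC 0)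
  (Hcsum : Csum P (fun p => (c p + Cconj (c p))%C) = RtoC 0)
  (Hz : forall p : nat, (1 <= p <= P)%nat -> 0 < Im (z p))
  (Hzord : forall p : nat, (1 <= p < P)%nat -> Re (z p) < Re (z (S p)))
  (Hlambda : 0 < lambda)
  (gamma : C -> R -> C)
  (Hgamma : forall x : C, G P z x -> path_in_G_to P z x (gamma x))
  (K : nat -> contour)
  (HK : forall m : nat, (1 <= m <= P)%nat -> is_C_contour eps P c z m (K m)) :
  (forall x : C, G P z x ->
     abs_convergent eps lambda P z v (contour_G P c z (gamma x) 0)) /\
  (forall m : nat, (1 <= m <= P)%nat ->
     abs_convergent eps lambda P z v (K m)) /\
  (extends_analytically_to_upper_half_plane P z
     (W_plus eps lambda P c z v gamma)
   <->
   forall m : nat, (1 <= m <= P)%nat ->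
     contour_int eps lambda P z v (K m) = RtoC 0).
Proof.
  assert (Hprim := primitive_exists P z HP Hz Hzord eps c lambda v Heps Hlambda).
  set (Is := fun m => proj1_sig (constructive_indefinite_description _ (Hprim m))).
  assert (HIs : forall m, is_primitive P z eps c lambda v m (Is m)).
  { intros m. unfold Is. destruct (constructive_indefinite_description _ (Hprim m)) as [I HI]. exact HI. }
  clearbody Is. clear Hprim.
  assert (Hpt := fun x Hx => contour_to_point P z HP Hz eps c lambda v Heps Hlambda (Is 0%nat) x (gamma x)
    (HIs 0%nat) Hx (Hgamma x Hx)).
  assert (HU : forall m, (1 <= m <= P)%nat -> ~ strictly_negative_integer (Ci * c m / eps)%C ->
    abs_convergent eps lambda P z v (K m) /\
    exists y, gap P z m y /\ contour_int eps lambda P z v (K m) = (Is 0%nat y - Is m y)%C).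
  { intros m Hm Hn. apply (contour_U_integral P z HP Hz Hzord eps c lambda v); try assumption; try apply HIs.
    apply (HK m Hm), Hn. }
  assert (Hl : forall m, (1 <= m <= P)%nat -> strictly_negative_integer (Ci * c m / eps)%C ->
    abs_convergent eps lambda P z v (K m) /\
    exists Y0, contour_int eps lambda P z v (K m) = Y0 /\
      forall e, 0 < e -> exists d, 0 < d /\ forall x, domain P z 0 x -> Cmod (x - z m)%C < d ->
        Cmod (Is 0%nat x - Y0)%C < e).
  { intros m Hm Hn. apply (ell0_integral P z HP Hz Hzord eps c lambda v); try assumption. apply (HK m Hm), Hn. }
  assert (HW : forall x, G P z x -> W_plus eps lambda P c z v gamma x = W_branch P z eps c lambda 0 (Is 0%nat) x).
  { intros x Hx. unfold W_plus, W_branch. rewrite (proj2 (Hpt x Hx)). f_equal. f_equal.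
    unfold exp_branch, h. rewrite <- Cexp_opp, f_branch_0 by exact HP. f_equal. field. apply eps_neq_0, Heps. }
  assert (Hband : forall m x, (1 <= m <= P)%nat -> gap P z m x -> band P z m x).
  { intros m x Hm [H1 H2]. split; [intros _; exact H1|exact H2]. }
  split; [intros x Hx; apply (Hpt x Hx)|]. split; [|split].
  - intros m Hm. destruct (classic (strictly_negative_integer (Ci * c m / eps)%C)) as [Hn|Hn].
    + apply (Hl m Hm Hn).
    + apply (HU m Hm Hn).
  - intros [E [HE1 HE2]] m Hm.
    assert (HE : forall x, 0 < Im x -> domain P z 0 x -> E x = W_branch P z eps c lambda 0 (Is 0%nat) x).
    { intros x Hx HR. apply (G_iff P z HP) in HR. rewrite HE1 by assumption. apply HW, HR. }
    assert (HEc : forall x, 0 < Im x -> ccont E x).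
    { intros x Hx. destruct (HE2 x Hx) as [l Hd]. eapply cderiv_ccont. exact Hd. }
    destruct (classic (strictly_negative_integer (Ci * c m / eps)%C)) as [Hn|Hn].
    + destruct (Hl m Hm Hn) as [_ [Y0 [-> HY]]].
      apply (negative_integer_alpha P HP eps c Heps m) in Hn. destruct Hn as [n Hn].
      apply (I_vanishes_of_extension P z HP Hz Hzord eps c lambda v Heps Is E m n Y0); assumption.
    + destruct (HU m Hm Hn) as [_ [y [Hy ->]]].
      rewrite (agree_of_extension P z HP Hz Hzord eps c lambda v Heps Is HIs E HE HEc m (proj2 Hm) y); [ring|].
      apply Hband; assumption.
  - intros H0.
    assert (Hvan : forall m n, (1 <= m <= P)%nat -> alpha eps c m = RtoC (INR (S n)) ->
      forall e, 0 < e -> exists d, 0 < d /\ forall x, domain P z 0 x -> Cmod (x - z m)%C < d ->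
        Cmod (Is 0%nat x) < e).
    { intros m n Hm Hn e He.
      assert (Hs : strictly_negative_integer (Ci * c m / eps)%C).
      { apply (negative_integer_alpha P HP eps c Heps m). exists n. exact Hn. }
      destruct (Hl m Hm Hs) as [_ [Y0 [HY0 HY]]]. rewrite H0 in HY0 by exact Hm. subst Y0.
      destruct (HY e He) as [d [Hd HYd]]. exists d. split; [exact Hd|]. intros x HR Hx.
      replace (Is 0%nat x) with (Is 0%nat x - 0)%C by ring. apply HYd; assumption. }
    (* At a point where l_0(z_m) replaces U_m, the condition gives only that I_0 vanishes at z_m;
       agreement across its cut then follows from agreement in the preceding band, so the induction
       passes through both kinds of points. *)
    assert (Hagree : forall m, (m <= P)%nat -> agree P z Is m).
    { induction m as [|k IH]; intros Hm; [apply agree_0|]. specialize (IH ltac:(lia)).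
      assert (Hm' : (1 <= S k <= P)%nat) by lia.
      destruct (classic (strictly_negative_integer (Ci * c (S k) / eps)%C)) as [Hn|Hn].
      - apply (negative_integer_alpha P HP eps c Heps (S k)) in Hn. destruct Hn as [n Hn].
        apply (agree_step_removable P z HP Hz Hzord eps c lambda v Heps Is HIs k n Hm IH Hn).
        apply (Hvan (S k) n Hm' Hn).
      - destruct (HU (S k) Hm' Hn) as [_ [y [Hy E]]]. rewrite H0 in E by exact Hm'.
        apply (agree_of_point P z HP Hzord eps c lambda v Is HIs (S k) y Hm (Hband _ _ Hm' Hy)).
        replace (Is 0%nat y) with ((Is 0%nat y - Is (S k) y) + Is (S k) y)%C by ring.
        rewrite <- E. ring. }
    destruct (extension_exists P z HP Hz Hzord eps c lambda v Heps Hc Is HIs Hagree Hvan) as [E [HE1 HE2]].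
    exists E. split.
    + intros x Hx HG. rewrite HE1, HW; [reflexivity|exact HG|exact Hx|apply G_iff; assumption].
    + exact HE2.
Qed.
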